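(* Work in $\mathrm{ZF}+\neg\mathbb{VP}$. If $\mathbb{VP}^\omega$ holds, then there is an ordinal $\delta>\omega$ such that $\mathbb{VP}^\delta$ holds while $\mathbb{VP}^{\delta+1}$ fails, and moreover $\delta$ is a Berkeley cardinal.
   Context: Background theory is $\mathrm{ZF}$ (no Axiom of Choice). Vopěnka's Principle for a proper class $\mathcal{C}$ of structures all of the same type (signature) means: there exist $A\neq B$ in $\mathcal{C}$ and an elementary embedding of $A$ into $B$. $\mathbb{VP}$ is the schema asserting this for every proper class of structures of the same type that is definable with arbitrary set parameters. For an ordinal $\alpha$, $\mathbb{VP}^\alpha$ is the same schema restricted to classes of structures whose common type $\tau$ belongs to $V_\alpha$; in particular $\mathbb{VP}^\omega$ concerns structures of the same finite type. $\neg\mathbb{VP}$ means that some proper class, definable with parameters, of structures of the same type has no two distinct members with one elementarily embeddable into the other. A cardinal $\delta$ is $\zeta$-proto Berkeley (for $\zeta<\delta$) iff for every transitive set $M$ with $\delta\in M$ there is an elementary embedding $j:M\to M$ with $\zeta<\operatorname{crit} j<\delta$; $\delta$ is Berkeley iff it is $\zeta$-proto Berkeley for all $\zeta<\delta$. *)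

(* Defs.v *)
Set Implicit Arguments.
Unset Strict Implicit.
Unset Printing Implicit Defensive.

(** * First-order set theory and models of ZF

    Every set-theoretic notion below is evaluated inside an arbitrary
    (possibly ill-founded, possibly omega-nonstandard) structure [M] for the
    language of set theory: quantifiers range over [M] only. *)

Record set_model : Type := SetModel {
  carrier :> Type;
  mem : carrier -> carrier -> Prop
}.

Declare Scope set_model_scope.
Open Scope set_model_scope.
Notation "x ∈ y" := (mem x y) (at level 70, no associativity) : set_model_scope.

(** Formulas of the language of set theory, with de Bruijn indices. *)
Inductive fm : Type :=
| FMem (i j : nat)
| FEq (i j : nat)
| FNeg (p : fm)
| FAnd (p q : fm)
| FOr (p q : fm)
| FImp (p q : fm)
| FAll (p : fm)
| FEx (p : fm).

Definition scons (T : Type) (x : T) (e : nat -> T) (n : nat) : T :=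
  match n with O => x | S n' => e n' end.

Fixpoint holds (M : set_model) (e : nat -> M) (p : fm) : Prop :=
  match p with
  | FMem i j => e i ∈ e j
  | FEq i j => e i = e j
  | FNeg p => ~ holds e p
  | FAnd p q => holds e p /\ holds e q
  | FOr p q => holds e p \/ holds e q
  | FImp p q => holds e p -> holds e q
  | FAll p => forall x : M, holds (scons x e) p
  | FEx p => exists x : M, holds (scons x e) p
  end.

(** Definability with parameters: the tail of the environment [e] carries the
    parameters. *)
Definition definable_class (M : set_model) (C : M -> Prop) : Prop :=
  exists (p : fm) (e : nat -> M), forall x, C x <-> holds (scons x e) p.

Definition definable_rel (M : set_model) (R : M -> M -> Prop) : Prop :=
  exists (p : fm) (e : nat -> M),
    forall x y, R x y <-> holds (scons x (scons y e)) p.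

Definition proper_class (M : set_model) (C : M -> Prop) : Prop :=
  ~ exists a : M, forall x, x ∈ a <-> C x.

Definition is_empty (M : set_model) (x : M) : Prop := forall y, ~ y ∈ x.

Definition incl (M : set_model) (x y : M) : Prop := forall z, z ∈ x -> z ∈ y.

(** [p = {x, y}] *)
Definition is_upair (M : set_model) (p x y : M) : Prop :=
  forall z, z ∈ p <-> z = x \/ z = y.

(** [s = x ∪ {x}] *)
Definition is_succ (M : set_model) (s x : M) : Prop :=
  forall z, z ∈ s <-> z ∈ x \/ z = x.

Definition inductive (M : set_model) (w : M) : Prop :=
  (exists z, is_empty z /\ z ∈ w) /\
  (forall x, x ∈ w -> exists s, is_succ s x /\ s ∈ w).

Record ZF (M : set_model) : Prop := {
  ZF_extensionality :
    forall a b : M, (forall x, x ∈ a <-> x ∈ b) -> a = b;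
  ZF_foundation :
    forall a : M, (exists x, x ∈ a) ->
      exists x, x ∈ a /\ forall y, y ∈ x -> ~ y ∈ a;
  ZF_pairing : forall a b : M, exists p, is_upair p a b;
  ZF_union :
    forall a : M, exists u, forall x, x ∈ u <-> exists y, y ∈ a /\ x ∈ y;
  ZF_power : forall a : M, exists b, forall x, x ∈ b <-> incl x a;
  ZF_infinity : exists w : M, inductive w;
  ZF_separation :
    forall C : M -> Prop, definable_class C ->
    forall a, exists b, forall x, x ∈ b <-> x ∈ a /\ C x;
  ZF_replacement :
    forall R : M -> M -> Prop, definable_rel R ->
    forall a, (forall x, x ∈ a -> exists! y, R x y) ->
    exists b, forall y, y ∈ b <-> exists x, x ∈ a /\ R x y
}.

(** * Basic set theory inside a model *)

(** [p = (x, y)], Kuratowski pair. *)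
Definition is_opair (M : set_model) (p x y : M) : Prop :=
  exists a b, is_upair a x x /\ is_upair b x y /\ is_upair p a b.

(** [(x, y) ∈ f]; when [f] is a function this reads [f x = y]. *)
Definition pair_in (M : set_model) (f x y : M) : Prop :=
  exists p, is_opair p x y /\ p ∈ f.

Definition is_function_on (M : set_model) (f a : M) : Prop :=
  (forall p, p ∈ f -> exists x y, x ∈ a /\ is_opair p x y) /\
  (forall x, x ∈ a -> exists! y, pair_in f x y).

Definition is_map (M : set_model) (f a b : M) : Prop :=
  is_function_on f a /\ (forall x y, pair_in f x y -> y ∈ b).

Definition is_bijection (M : set_model) (f a b : M) : Prop :=
  is_map f a b /\
  (forall y, y ∈ b -> exists! x, pair_in f x y).

Definition is_transitive (M : set_model) (a : M) : Prop :=
  forall x, x ∈ a -> incl x a.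

(** Under Foundation this is the usual von Neumann notion. *)
Definition is_ordinal (M : set_model) (a : M) : Prop :=
  is_transitive a /\ (forall x, x ∈ a -> is_transitive x).

Definition is_cardinal (M : set_model) (k : M) : Prop :=
  is_ordinal k /\ (forall a, a ∈ k -> ~ exists f, is_bijection f a k).

Definition is_omega (M : set_model) (w : M) : Prop :=
  inductive w /\ (forall w', inductive w' -> incl w w').

Definition is_nat (M : set_model) (n : M) : Prop :=
  exists w, is_omega w /\ n ∈ w.

(** [x] is the von Neumann numeral of the standard natural number [k]. *)
Fixpoint is_num (M : set_model) (k : nat) (x : M) : Prop :=
  match k with
  | O => is_empty x
  | S k' => exists y, is_num k' y /\ is_succ x y
  end.

(** [v = V_a], where [V_b] is the union of the power sets of [V_c] for
    [c < b]; the set [f] is the function [b |-> V_b] on [a + 1]. *)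
Definition is_V (M : set_model) (v a : M) : Prop :=
  exists f s, is_succ s a /\ is_function_on f s /\
    (forall b u, pair_in f b u ->
       forall x, x ∈ u <-> exists c u', c ∈ b /\ pair_in f c u' /\ incl x u') /\
    pair_in f a v.

Definition in_V (M : set_model) (a x : M) : Prop :=
  exists v, is_V v a /\ x ∈ v.

(** * Signatures and structures

    A signature is a set function [tau] defined on a set of symbols, with value
    [(0, n)] at an [n]-ary relation symbol and [(1, n)] at an [n]-ary function
    symbol (constants are the 0-ary function symbols).  Pitfall: [tau] must be
    one set of pairs, not a tuple of sets; the rank of a tuple of sets is never
    a limit ordinal, so [V_(d+1)] would contain no more signatures than [V_d]
    for [d] limit. *)

(** [x = (k, a)] *)
Definition is_tagged (M : set_model) (k : nat) (x a : M) : Prop :=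
  exists n, is_num k n /\ is_opair x n a.

(** [x = (k, (a, b))] *)
Definition is_tagged2 (M : set_model) (k : nat) (x a b : M) : Prop :=
  exists p, is_opair p a b /\ is_tagged k x p.

Definition is_signature (M : set_model) (tau : M) : Prop :=
  exists S, is_function_on tau S /\
    (forall s v, pair_in tau s v ->
       exists n, is_nat n /\ (is_tagged 0 v n \/ is_tagged 1 v n)).

Definition rel_symbol (M : set_model) (tau s n : M) : Prop :=
  is_nat n /\ exists v, pair_in tau s v /\ is_tagged 0 v n.

Definition fun_symbol (M : set_model) (tau s n : M) : Prop :=
  is_nat n /\ exists v, pair_in tau s v /\ is_tagged 1 v n.

(** [A = (D, I)]; an [n]-tuple of elements of [D] is a map from [n] to [D]. *)
Definition is_structure (M : set_model) (tau A : M) : Prop :=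
  exists D I, is_opair A D I /\
    (exists x, x ∈ D) /\
    (exists S, is_function_on tau S /\ is_function_on I S) /\
    (forall s n r, rel_symbol tau s n -> pair_in I s r ->
       forall t, t ∈ r -> is_map t n D) /\
    (forall s n g, fun_symbol tau s n -> pair_in I s g ->
       exists P, (forall t, t ∈ P <-> is_map t n D) /\ is_map g P D).

(** * Syntax and satisfaction inside a model

    Terms and formulas of type [tau] are coded by sets of [M]:
    - terms: variables [(0, n)], applications [(1, (s, ts))];
    - formulas: equations [(0, (t, u))], atomic relations [(1, (s, ts))],
      negations [(2, p)], conjunctions [(3, (p, q))], existential
      quantifications [(4, (n, p))] of the variable number [n];
    where [ts] is a finite sequence of terms of the right length. *)

Definition terms_closed (M : set_model) (tau T : M) : Prop :=
  (forall n x, is_nat n -> is_tagged 0 x n -> x ∈ T) /\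
  (forall s n ts x, fun_symbol tau s n -> is_map ts n T ->
     is_tagged2 1 x s ts -> x ∈ T).

Definition is_term (M : set_model) (tau t : M) : Prop :=
  forall T, terms_closed tau T -> t ∈ T.

Definition is_term_seq (M : set_model) (tau ts n : M) : Prop :=
  is_function_on ts n /\ (forall i t, pair_in ts i t -> is_term tau t).

Definition formulas_closed (M : set_model) (tau F : M) : Prop :=
  (forall t u x, is_term tau t -> is_term tau u ->
     is_tagged2 0 x t u -> x ∈ F) /\
  (forall s n ts x, rel_symbol tau s n -> is_term_seq tau ts n ->
     is_tagged2 1 x s ts -> x ∈ F) /\
  (forall p x, p ∈ F -> is_tagged 2 x p -> x ∈ F) /\
  (forall p q x, p ∈ F -> q ∈ F -> is_tagged2 3 x p q -> x ∈ F) /\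
  (forall n p x, is_nat n -> p ∈ F -> is_tagged2 4 x n p -> x ∈ F).

Definition is_formula (M : set_model) (tau p : M) : Prop :=
  forall F, formulas_closed tau F -> p ∈ F.

Definition is_assignment (M : set_model) (D s : M) : Prop :=
  exists w, is_omega w /\ is_map s w D.

(** [e] is the function sending each term to its value under [s]. *)
Definition is_evaluation (M : set_model) (tau D I s e : M) : Prop :=
  (exists T, (forall t, t ∈ T <-> is_term tau t) /\ is_map e T D) /\
  (forall n x d, is_nat n -> is_tagged 0 x n ->
     (pair_in e x d <-> pair_in s n d)) /\
  (forall f n ts x d, fun_symbol tau f n -> is_term_seq tau ts n ->
     is_tagged2 1 x f ts ->
     (pair_in e x d <->
      exists vs g, is_map vs n D /\
        (forall i v, pair_in vs i v <->
           exists t, pair_in ts i t /\ pair_in e t v) /\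
        pair_in I f g /\ pair_in g vs d)).

Definition term_value (M : set_model) (tau D I s t d : M) : Prop :=
  exists e, is_evaluation tau D I s e /\ pair_in e t d.

(** [S] obeys Tarski's clauses for satisfaction in [(D, I)]; [pair_in S p s]
    reads "[s] satisfies [p]". *)
Definition is_satisfaction (M : set_model) (tau D I S : M) : Prop :=
  forall s, is_assignment D s ->
  (forall t u x, is_term tau t -> is_term tau u -> is_tagged2 0 x t u ->
     (pair_in S x s <->
      exists d, term_value tau D I s t d /\ term_value tau D I s u d)) /\
  (forall r n ts x, rel_symbol tau r n -> is_term_seq tau ts n ->
     is_tagged2 1 x r ts ->
     (pair_in S x s <->
      exists vs R, is_map vs n D /\
        (forall i v, pair_in vs i v <->
           exists t, pair_in ts i t /\ term_value tau D I s t v) /\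
        pair_in I r R /\ vs ∈ R)) /\
  (forall p x, is_formula tau p -> is_tagged 2 x p ->
     (pair_in S x s <-> ~ pair_in S p s)) /\
  (forall p q x, is_formula tau p -> is_formula tau q -> is_tagged2 3 x p q ->
     (pair_in S x s <-> pair_in S p s /\ pair_in S q s)) /\
  (forall n p x, is_nat n -> is_formula tau p -> is_tagged2 4 x n p ->
     (pair_in S x s <->
      exists s', is_assignment D s' /\
        (forall m d, m <> n -> (pair_in s' m d <-> pair_in s m d)) /\
        pair_in S p s')).

Definition satisfies (M : set_model) (tau A p s : M) : Prop :=
  exists D I S, is_opair A D I /\ is_satisfaction tau D I S /\ pair_in S p s.

(** [M] may have nonstandard formulas; elementarity is required for all of
    them, as the notion is the one of the theory ZF. *)
Definition elementary_embedding (M : set_model) (tau A B f : M) : Prop :=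
  exists DA IA DB IB, is_opair A DA IA /\ is_opair B DB IB /\
    is_map f DA DB /\
    (forall p s s', is_formula tau p ->
       is_assignment DA s -> is_assignment DB s' ->
       (forall n y, pair_in s' n y <->
          exists x, pair_in s n x /\ pair_in f x y) ->
       (satisfies tau A p s <-> satisfies tau B p s')).

(** * Vopěnka's Principle *)

Definition VP_for (M : set_model) (allowed : M -> Prop) : Prop :=
  forall (C : M -> Prop) (tau : M),
    definable_class C -> proper_class C ->
    is_signature tau -> allowed tau ->
    (forall A, C A -> is_structure tau A) ->
    exists A B f, C A /\ C B /\ A <> B /\ elementary_embedding tau A B f.

Definition VP (M : set_model) : Prop := VP_for (fun _ : M => True).

Definition VP_at (M : set_model) (a : M) : Prop := VP_for (in_V a).

(** * Berkeley cardinals *)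

(** The signature with one binary relation symbol, namely the empty set. *)
Definition is_eps_signature (M : set_model) (tau : M) : Prop :=
  exists z two v p, is_num 0 z /\ is_num 2 two /\ is_tagged 0 v two /\
    is_opair p z v /\ is_upair tau p p.

(** [A = (N, ∈)] *)
Definition is_eps_structure (M : set_model) (A N : M) : Prop :=
  exists z one two r p I, is_num 0 z /\ is_num 1 one /\ is_num 2 two /\
    (forall t, t ∈ r <-> is_map t two N /\
       exists x y, pair_in t z x /\ pair_in t one y /\ x ∈ y) /\
    is_opair p z r /\ is_upair I p p /\ is_opair A N I.

Definition eps_elementary (M : set_model) (N j : M) : Prop :=
  exists tau A, is_eps_signature tau /\ is_eps_structure A N /\
    elementary_embedding tau A A j.

Definition is_crit (M : set_model) (j k : M) : Prop :=
  is_ordinal k /\ (exists b, pair_in j k b /\ b <> k) /\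
  (forall a, a ∈ k -> pair_in j a a).

Definition proto_Berkeley (M : set_model) (z d : M) : Prop :=
  is_cardinal d /\ z ∈ d /\
  (forall N, is_transitive N -> d ∈ N ->
     exists j k, eps_elementary N j /\ is_crit j k /\ z ∈ k /\ k ∈ d).

Definition Berkeley (M : set_model) (d : M) : Prop :=
  is_cardinal d /\ (forall z, z ∈ d -> proto_Berkeley z d).

(* Main.v *)
From Stdlib Require Import Classical ClassicalEpsilon FunctionalExtensionality
  PropExtensionality PeanoNat Lia List.
Require Import Defs.
Set Implicit Arguments.
Unset Strict Implicit.
Unset Printing Implicit Defensive.

(** Let [C0], a class of structures of type [tau0], witness the failure of
    Vopenka's Principle.  Call the symbols of [tau0] movable over a set [X] if for
    every transitive [N] and every [c] in [N] some elementary [j : N -> N] fixes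
    [c] and all of [X] but moves a symbol of [tau0].  This is one formula of set
    theory, whereas Vopenka's Principle is a schema.

    If Vopenka's Principle holds for the signature having one binary relation
    symbol for each element of [X], then [tau0] is movable over [X]: apply it to
    stages [V_l] expanded so that an embedding [j] must carry [A] in [C0] to some
    other [B] in [C0] and fix [X], [tau0] and [c]; if [j] fixed all symbols of
    [tau0], its restriction to [A] would be an embedding of [A] into [B].
    Conversely, if [tau0] is movable over the set of symbols of [sigma], then
    Vopenka's Principle holds for [sigma]: an embedding of a stage fixing every
    member of a proper class fixes the enumeration of their ranks, hence all
    ordinals; so some member [A] is moved, and it embeds into [j A].

    Let [delta] be least such that [tau0] is not movable over [V_delta].  As an
    embedding fixing [a] and [V_a] fixes [V_(a+1)], [delta] is a limit, and the two
    implications give the principle at [delta] and its failure at [delta + 1].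
    An embedding fixing [V_(z+1)] and a witness of the failure at [delta] has its
    critical point between [z] and [delta], whence the Berkeley property. *)

(* [M] may have nonstandard natural numbers, so two notions of formula coexist: the type [fm], on
   which definability, separation and reflection rest, and the formulas coded in [M], over which
   [elementary_embedding] quantifies. Every [fm] has a code, but not conversely. From codes to [fm]
   one passes by [elementary_tru]. The way back needs a device: a good stage [V_l] reflects a fixed
   finite list of [fm], among them the one defining [satisfies]. An embedding of good stages that
   preserves every [fm] and fixes all codes for a signature preserves [satisfies] itself, so its
   restriction to a structure is elementary for all codes at once, nonstandard ones included. This
   is why fixing the symbols matters: they generate the codes. Without choice no member can be
   picked from each rank of a class; least stages and the enumeration of ranks replace such choices.
   An embedding fixing all ordinals is absurd because it fixes pointwise a stage [V_r] containing
   the symbols of [tau0], while movability makes it move one of them. *)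
Existing Class ZF.

(** * Definable predicates of environments *)

Fixpoint ren (r : nat -> nat) (p : fm) : fm :=
  let up r n := match n with O => O | S n' => S (r n') end in
  match p with
  | FMem i j => FMem (r i) (r j)
  | FEq i j => FEq (r i) (r j)
  | FNeg p => FNeg (ren r p)
  | FAnd p q => FAnd (ren r p) (ren r q)
  | FOr p q => FOr (ren r p) (ren r q)
  | FImp p q => FImp (ren r p) (ren r q)
  | FAll p => FAll (ren (up r) p)
  | FEx p => FEx (ren (up r) p)
  end.

Lemma scons_ren (T : Type) (x : T) (e : nat -> T) (r : nat -> nat) :
  (fun n => scons x e (match n with O => O | S n' => S (r n') end))
  = scons x (fun n => e (r n)).
Proof. apply functional_extensionality; intros [|n]; reflexivity. Qed.

Lemma scons_eta (T : Type) (e : nat -> T) : scons (e 0) (fun n => e (S n)) = e.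
Proof. apply functional_extensionality; intros [|n]; reflexivity. Qed.

Lemma holds_ren (M : set_model) (p : fm) :
  forall (r : nat -> nat) (e : nat -> M),
  holds e (ren r p) <-> holds (fun n => e (r n)) p.
Proof.
  induction p; intros r e; simpl; try tauto;
    try (rewrite IHp; tauto); try (rewrite IHp1, IHp2; tauto).
  - split; intros H x; specialize (H x); rewrite IHp, scons_ren in *; exact H.
  - split; intros [x H]; exists x; rewrite IHp, scons_ren in *; exact H.
Qed.

Fixpoint free_below (k : nat) (p : fm) : Prop :=
  match p with
  | FMem i j | FEq i j => i < k /\ j < k
  | FNeg p => free_below k p
  | FAnd p q | FOr p q | FImp p q => free_below k p /\ free_below k q
  | FAll p | FEx p => free_below (S k) p
  end.

Lemma free_below_mono (p : fm) : forall k l, k <= l -> free_below k p -> free_below l p.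
Proof.
  induction p; simpl; intros k l H Hp.
  1,2: lia.
  1: exact (IHp _ _ H Hp).
  1-3: split; [apply (IHp1 k)|apply (IHp2 k)]; tauto.
  all: apply (IHp (S k)); [lia|assumption].
Qed.

Lemma free_below_ex (p : fm) : exists k, free_below k p.
Proof.
  assert (J : forall p q, (exists k, free_below k p) -> (exists k, free_below k q) ->
    exists k, free_below k p /\ free_below k q).
  { intros q r [k Hk] [l Hl]; exists (k + l).
    split; [apply (free_below_mono (k := k))|apply (free_below_mono (k := l))];
      (lia || assumption). }
  induction p; simpl; auto.
  - exists (S (i + j)); lia.
  - exists (S (i + j)); lia.
  - destruct IHp as [k H]; exists k; apply (free_below_mono (k := k)); [lia|assumption].
  - destruct IHp as [k H]; exists k; apply (free_below_mono (k := k)); [lia|assumption].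
Qed.

Lemma holds_free_below (M : set_model) (p : fm) : forall k (e e' : nat -> M),
  free_below k p -> (forall n, n < k -> e n = e' n) -> (holds e p <-> holds e' p).
Proof.
  induction p; simpl; intros k e e' H E.
  - rewrite !E by tauto; tauto.
  - rewrite !E by tauto; tauto.
  - rewrite (IHp k e e'); tauto.
  - rewrite (IHp1 k e e'), (IHp2 k e e'); tauto.
  - rewrite (IHp1 k e e'), (IHp2 k e e'); tauto.
  - rewrite (IHp1 k e e'), (IHp2 k e e'); tauto.
  - assert (K : forall x, holds (scons x e) p <-> holds (scons x e') p).
    { intros x; apply (IHp (S k)); [assumption|]. intros [|n] Hn; simpl; [reflexivity|].
      apply E; lia. }
    firstorder.
  - assert (K : forall x, holds (scons x e) p <-> holds (scons x e') p).
    { intros x; apply (IHp (S k)); [assumption|]. intros [|n] Hn; simpl; [reflexivity|].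
      apply E; lia. }
    firstorder.
Qed.

(** Abstracted so that the closure lemmas and [solve_def] serve both definability without
    parameters, [Def], and with parameters, [PDef]. A bound variable is passed to the body as index
    0 and shifts the others by one. *)
Class definability (M : set_model) (D : ((nat -> M) -> Prop) -> Prop) : Prop := {
  d_ext : forall P Q : (nat -> M) -> Prop, (forall e, P e <-> Q e) -> D Q -> D P;
  d_mem0 : forall i j, D (fun e => e i ∈ e j);
  d_eq0 : forall i j, D (fun e => e i = e j);
  d_not : forall P, D P -> D (fun e => ~ P e);
  d_and : forall P Q, D P -> D Q -> D (fun e => P e /\ Q e);
  d_or : forall P Q, D P -> D Q -> D (fun e => P e \/ Q e);
  d_imp : forall P Q : (nat -> M) -> Prop, D P -> D Q -> D (fun e => P e -> Q e);
  d_all : forall P : M -> (nat -> M) -> Prop,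
    D (fun e => P (e 0) (fun n => e (S n))) -> D (fun e => forall x, P x e);
  d_ex : forall P : M -> (nat -> M) -> Prop,
    D (fun e => P (e 0) (fun n => e (S n))) -> D (fun e => exists x, P x e);
  d_ren : forall P (r : nat -> nat), D P -> D (fun e => P (fun n => e (r n)))
}.

Definition Def (M : set_model) (P : (nat -> M) -> Prop) : Prop :=
  exists p, forall e, holds e p <-> P e.

Global Instance Def_definability (M : set_model) : definability (@Def M).
Proof.
  split.
  - intros P Q H [p Hp]; exists p; intros e; rewrite Hp, H; tauto.
  - intros i j; exists (FMem i j); simpl; tauto.
  - intros i j; exists (FEq i j); simpl; tauto.
  - intros P [p Hp]; exists (FNeg p); intros e; simpl; rewrite Hp; tauto.
  - intros P Q [p Hp] [q Hq]; exists (FAnd p q); intros e; simpl; rewrite Hp, Hq; tauto.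
  - intros P Q [p Hp] [q Hq]; exists (FOr p q); intros e; simpl; rewrite Hp, Hq; tauto.
  - intros P Q [p Hp] [q Hq]; exists (FImp p q); intros e; simpl; rewrite Hp, Hq; tauto.
  - intros P [p Hp]; exists (FAll p); intros e; simpl.
    split; intros H x; specialize (H x); rewrite Hp in *; exact H.
  - intros P [p Hp]; exists (FEx p); intros e; simpl.
    split; intros [x H]; exists x; rewrite Hp in *; exact H.
  - intros P r [p Hp]; exists (ren r p); intros e; rewrite holds_ren, Hp; tauto.
Qed.


(** The default given to [nth] is the value of the shifted environment, so it is taken exactly when
    [n] is beyond the list. *)
Definition pre (T : Type) (l : list T) (e : nat -> T) (n : nat) : T :=
  nth n l (e (n - length l)).

(** The parameters form a finite list, unlike the infinite environment of [definable_class]: finite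
    lists can be concatenated, and coded by one set that an embedding is asked to fix. *)
Definition PDef (M : set_model) (P : (nat -> M) -> Prop) : Prop :=
  exists Q l, Def Q /\ forall e, P e <-> Q (pre l e).

Lemma pre_app_l (T : Type) (l l' : list T) (e : nat -> T) :
  pre l e = fun n => pre (l ++ l') e (if Nat.ltb n (length l) then n else n + length l').
Proof.
  apply functional_extensionality; intros n; unfold pre.
  destruct (Nat.ltb_spec n (length l)).
  - rewrite app_nth1 by lia. apply nth_indep; lia.
  - rewrite app_nth2 by lia. rewrite !nth_overflow by (rewrite ?length_app; lia).
    rewrite length_app; f_equal; lia.
Qed.

Lemma pre_app_r (T : Type) (l l' : list T) (e : nat -> T) :
  pre l' e = fun n => pre (l ++ l') e (n + length l).
Proof.
  apply functional_extensionality; intros n; unfold pre.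
  rewrite app_nth2, length_app by lia. do 2 f_equal; lia.
Qed.

Lemma pre_scons (T : Type) (l : list T) (x : T) (e : nat -> T) :
  pre l (scons x e) = fun n => scons x (pre l e)
    (if Nat.ltb n (length l) then S n else if Nat.eqb n (length l) then 0 else n).
Proof.
  apply functional_extensionality; intros n; unfold pre.
  destruct (Nat.ltb_spec n (length l)); simpl.
  - apply nth_indep; lia.
  - rewrite nth_overflow by lia. destruct (Nat.eqb_spec n (length l)).
    + subst; rewrite PeanoNat.Nat.sub_diag; reflexivity.
    + destruct n; [lia|].
      replace (S n - length l) with (S (n - length l)) by lia. simpl scons.
      rewrite nth_overflow by lia. reflexivity.
Qed.

Lemma pre_ren (T : Type) (l : list T) (e : nat -> T) (r : nat -> nat) :
  pre l (fun n => e (r n)) = fun n => pre l e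
    (if Nat.ltb n (length l) then n else r (n - length l) + length l).
Proof.
  apply functional_extensionality; intros n; unfold pre.
  destruct (Nat.ltb_spec n (length l)).
  - apply nth_indep; lia.
  - rewrite !nth_overflow by lia. f_equal; lia.
Qed.

Lemma Def_PDef (M : set_model) (P : (nat -> M) -> Prop) : Def P -> PDef P.
Proof.
  intros H; exists P, nil; split; [exact H|]; intros e.
  replace (pre nil e) with e; [tauto|].
  apply functional_extensionality; intros [|n]; reflexivity.
Qed.

Lemma PDef_join (M : set_model) (P Q : (nat -> M) -> Prop) : PDef P -> PDef Q ->
  exists P' Q' l, Def P' /\ Def Q' /\ (forall e, P e <-> P' (pre l e)) /\
    forall e, Q e <-> Q' (pre l e).
Proof.
  intros (P' & l & HP & H) (Q' & l' & HQ & H').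
  exists (fun f => P' (fun n => f (if Nat.ltb n (length l) then n else n + length l'))).
  exists (fun f => Q' (fun n => f (n + length l))), (l ++ l').
  split; [apply (@d_ren _ _ _ P'), HP|]. split; [apply (@d_ren _ _ _ Q'), HQ|].
  split; intros e.
  - rewrite H, (pre_app_l l l'); reflexivity.
  - rewrite H', (pre_app_r l l'); reflexivity.
Qed.

Global Instance PDef_definability (M : set_model) : definability (@PDef M).
Proof.
  split.
  - intros P Q H (R & l & HR & HQ); exists R, l; split; [exact HR|].
    intros e; rewrite H; apply HQ.
  - intros; apply Def_PDef, d_mem0.
  - intros; apply Def_PDef, d_eq0.
  - intros P (Q & l & HQ & H); exists (fun e => ~ Q e), l; split; [apply d_not, HQ|].
    intros e; rewrite H; tauto.
  - intros P Q HP HQ; destruct (PDef_join HP HQ) as (P' & Q' & l & DP & DQ & H & H').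
    exists (fun e => P' e /\ Q' e), l; split; [apply d_and; assumption|].
    intros e; rewrite H, H'; tauto.
  - intros P Q HP HQ; destruct (PDef_join HP HQ) as (P' & Q' & l & DP & DQ & H & H').
    exists (fun e => P' e \/ Q' e), l; split; [apply d_or; assumption|].
    intros e; rewrite H, H'; tauto.
  - intros P Q HP HQ; destruct (PDef_join HP HQ) as (P' & Q' & l & DP & DQ & H & H').
    exists (fun e => P' e -> Q' e), l; split; [apply d_imp; assumption|].
    intros e; rewrite H, H'; tauto.
  - intros P (Q & l & HQ & H).
    set (r := fun n => if Nat.ltb n (length l) then S n
      else if Nat.eqb n (length l) then 0 else n).
    exists (fun e => forall x, Q (fun n => scons x e (r n))), l; split.
    + apply d_all. apply (d_ext (Q := fun e => Q (fun n => e (r n)))); [|apply d_ren, HQ].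
      intros e. rewrite scons_eta; tauto.
    + intros e. assert (K : forall x, P x e <-> Q (fun n => scons x (pre l e) (r n))).
      { intros x. rewrite (H (scons x e)), pre_scons; reflexivity. }
      split; intros H' x; apply K, H'.
  - intros P (Q & l & HQ & H).
    set (r := fun n => if Nat.ltb n (length l) then S n
      else if Nat.eqb n (length l) then 0 else n).
    exists (fun e => exists x, Q (fun n => scons x e (r n))), l; split.
    + apply d_ex. apply (d_ext (Q := fun e => Q (fun n => e (r n)))); [|apply d_ren, HQ].
      intros e. rewrite scons_eta; tauto.
    + intros e. assert (K : forall x, P x e <-> Q (fun n => scons x (pre l e) (r n))).
      { intros x. rewrite (H (scons x e)), pre_scons; reflexivity. }
      split; intros [x H']; exists x; apply K, H'.
  - intros P r (Q & l & HQ & H).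
    exists (fun e => Q (fun n => e (if Nat.ltb n (length l) then n
      else r (n - length l) + length l))), l; split.
    + apply (@d_ren _ _ _ Q), HQ.
    + intros e; rewrite H, pre_ren; tauto.
Qed.

(** The environment [e'] supplies infinitely many parameters, but only those at indices below a
    bound for the free variables count; these make up the list. *)
Lemma PDef_holds (M : set_model) (p : fm) (e' : nat -> M) (k : nat) :
  PDef (fun e => holds (fun n => if Nat.ltb n k then e n else e' (n - k)) p).
Proof.
  destruct (free_below_ex p) as [m Hm].
  set (l := map e' (seq 0 m)).
  set (r := fun n => if Nat.ltb n k then n + m else n - k).
  exists (fun e => holds (fun n => e (r n)) p), l; split.
  - apply (@d_ren _ _ _ (fun e => holds e p)). exists p; tauto.
  - intros e. apply (holds_free_below Hm). intros n Hn. unfold r, pre, l.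
    rewrite length_map, length_seq. destruct (Nat.ltb_spec n k).
    + rewrite nth_overflow by (rewrite length_map, length_seq; lia). f_equal; lia.
    + rewrite nth_indep with (d' := e' 0) by (rewrite length_map, length_seq; lia).
      rewrite map_nth, seq_nth by lia. reflexivity.
Qed.

Notation definable_map G := (PDef (fun e => e 0 = G (e 1))).

Ltac same_env :=
  match goal with
  | |- ?P ?e <-> ?P ?e' => replace e' with e; [tauto|]
  | |- ?P ?e _ <-> ?P ?e' _ => replace e' with e; [tauto|]
  end; apply functional_extensionality.

(** * Closure of definability under substitution of terms *)

Definition DT (M : set_model) (D : ((nat -> M) -> Prop) -> Prop) (t : (nat -> M) -> M) :=
  D (fun e => e 0 = t (fun n => e (S n))).

Section Substitution.
Context {M : set_model} {D : ((nat -> M) -> Prop) -> Prop} {HD : definability D}.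

Lemma d_iff (P Q : (nat -> M) -> Prop) : D P -> D Q -> D (fun e => P e <-> Q e).
Proof. intros; apply d_and; apply d_imp; assumption. Qed.

Lemma d_const (Q : Prop) : D (fun _ => Q).
Proof.
  destruct (classic Q).
  - apply (d_ext (Q := fun e => e 0 = e 0)); [tauto|apply d_eq0].
  - apply (d_ext (Q := fun e => ~ e 0 = e 0)); [tauto|apply d_not, d_eq0].
Qed.

Lemma dt_var i : DT D (fun e => e i).
Proof. exact (d_eq0 0 (S i)). Qed.

(** The term is eliminated in favour of a variable equal to it, since [fm] has no terms. *)
Lemma d_sub (R : (nat -> M) -> M -> Prop) (t : (nat -> M) -> M) :
  D (fun e => R (fun n => e (S n)) (e 0)) -> DT D t -> D (fun e => R e (t e)).
Proof.
  intros HR Ht. apply (d_ext (Q := fun e => exists y, y = t e /\ R e y)).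
  - intros e; split; [intros H; exists (t e); auto|intros (y & -> & H); exact H].
  - apply d_ex, d_and; assumption.
Qed.

Lemma dt_ren (t : (nat -> M) -> M) (r : nat -> nat) :
  DT D t -> DT D (fun e => t (fun n => e (r n))).
Proof.
  intros H. exact (@d_ren M D _ (fun e => e 0 = t (fun n => e (S n)))
    (fun n => match n with O => O | S n' => S (r n') end) H).
Qed.

Lemma dt_shift (t : (nat -> M) -> M) : DT D t -> DT D (fun e => t (fun n => e (S n))).
Proof. apply dt_ren. Qed.

(** Arguments are replaced by variables one at a time, from the last to the first, each step
    shifting the environment of the remaining terms by one. Smaller arities are padded with dummy
    arguments. *)
Lemma d_app6 (R : M -> M -> M -> M -> M -> M -> Prop) t u v w s a :
  D (fun e => R (e 0) (e 1) (e 2) (e 3) (e 4) (e 5)) ->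
  DT D t -> DT D u -> DT D v -> DT D w -> DT D s -> DT D a ->
  D (fun e => R (t e) (u e) (v e) (w e) (s e) (a e)).
Proof.
  intros HR Ht Hu Hv Hw Hs Ha.
  apply (d_sub (R := fun e y => R (t e) (u e) (v e) (w e) (s e) y)); [|assumption].
  apply (d_sub (R := fun e x => R (t (fun n => e (S n))) (u (fun n => e (S n)))
    (v (fun n => e (S n))) (w (fun n => e (S n))) x (e 0))); [|apply dt_shift, Hs].
  apply (d_sub (R := fun e x => R (t (fun n => e (S (S n)))) (u (fun n => e (S (S n))))
    (v (fun n => e (S (S n)))) x (e 0) (e 1)));
    [|exact (@dt_ren _ (fun n => S (S n)) Hw)].
  apply (d_sub (R := fun e x => R (t (fun n => e (S (S (S n))))) (u (fun n => e (S (S (S n)))))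
    x (e 0) (e 1) (e 2))); [|exact (@dt_ren _ (fun n => S (S (S n))) Hv)].
  apply (d_sub (R := fun e x => R (t (fun n => e (S (S (S (S n)))))) x (e 0) (e 1) (e 2) (e 3)));
    [|exact (@dt_ren _ (fun n => S (S (S (S n)))) Hu)].
  apply (d_sub (R := fun e x => R x (e 0) (e 1) (e 2) (e 3) (e 4)));
    [|exact (@dt_ren _ (fun n => S (S (S (S (S n))))) Ht)].
  exact HR.
Qed.

Lemma d_app5 (R : M -> M -> M -> M -> M -> Prop) t u v w s :
  D (fun e => R (e 0) (e 1) (e 2) (e 3) (e 4)) ->
  DT D t -> DT D u -> DT D v -> DT D w -> DT D s ->
  D (fun e => R (t e) (u e) (v e) (w e) (s e)).
Proof.
  intros. apply (d_app6 (R := fun x1 x2 x3 x4 x5 _ => R x1 x2 x3 x4 x5) (a := fun e => e 0));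
    auto using dt_var.
Qed.

Lemma d_app4 (R : M -> M -> M -> M -> Prop) t u v w : D (fun e => R (e 0) (e 1) (e 2) (e 3)) ->
  DT D t -> DT D u -> DT D v -> DT D w ->
  D (fun e => R (t e) (u e) (v e) (w e)).
Proof.
  intros. apply (d_app5 (R := fun x1 x2 x3 x4 _ => R x1 x2 x3 x4) (s := fun e => e 0));
    auto using dt_var.
Qed.

Lemma d_app3 (R : M -> M -> M -> Prop) t u v : D (fun e => R (e 0) (e 1) (e 2)) ->
  DT D t -> DT D u -> DT D v ->
  D (fun e => R (t e) (u e) (v e)).
Proof.
  intros. apply (d_app4 (R := fun x1 x2 x3 _ => R x1 x2 x3) (w := fun e => e 0)); auto using dt_var.
Qed.

Lemma d_app2 (R : M -> M -> Prop) t u : D (fun e => R (e 0) (e 1)) ->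
  DT D t -> DT D u ->
  D (fun e => R (t e) (u e)).
Proof.
  intros. apply (d_app3 (R := fun x1 x2 _ => R x1 x2) (v := fun e => e 0)); auto using dt_var.
Qed.

Lemma d_app1 (R : M -> Prop) t : D (fun e => R (e 0)) ->
  DT D t ->
  D (fun e => R (t e)).
Proof.
  intros. apply (d_app2 (R := fun x1 _ => R x1) (u := fun e => e 0)); auto using dt_var.
Qed.

Lemma dt_app1 (f : M -> M) t : D (fun e => e 0 = f (e 1)) ->
  DT D t -> DT D (fun e => f (t e)).
Proof.
  intros H Ht. apply (d_app2 (R := fun x y => x = f y)); [exact H|apply dt_var|].
  apply dt_shift, Ht.
Qed.

Lemma dt_app2 (f : M -> M -> M) t u : D (fun e => e 0 = f (e 1) (e 2)) ->
  DT D t -> DT D u -> DT D (fun e => f (t e) (u e)).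
Proof.
  intros H Ht Hu. apply (d_app3 (R := fun x y z => x = f y z)); [exact H|apply dt_var| |].
  - apply dt_shift, Ht.
  - apply dt_shift, Hu.
Qed.

End Substitution.

Lemma dt_const (M : set_model) (a : M) : DT (@PDef M) (fun _ => a).
Proof.
  exists (fun e => e 1 = e 0), (a :: nil); split; [apply d_eq0|].
  intros e; unfold pre; simpl. tauto.
Qed.

Create HintDb defdb.

Ltac dleaf := solve [eauto 2 with defdb nocore | apply Def_PDef; eauto 2 with defdb nocore].

Ltac dapp :=
  match goal with
  | |- ?D (fun e => ?R (@?t e) (@?u e) (@?v e) (@?w e) (@?s e) (@?a e)) =>
      apply (@d_app6 _ D _ R t u v w s a)
  | |- ?D (fun e => ?R (@?t e) (@?u e) (@?v e) (@?w e) (@?s e)) =>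
      apply (@d_app5 _ D _ R t u v w s)
  | |- ?D (fun e => ?R (@?t e) (@?u e) (@?v e) (@?w e)) => apply (@d_app4 _ D _ R t u v w)
  | |- ?D (fun e => ?R (@?t e) (@?u e) (@?v e)) => apply (@d_app3 _ D _ R t u v)
  | |- ?D (fun e => ?R (@?t e) (@?u e)) => apply (@d_app2 _ D _ R t u)
  | |- ?D (fun e => ?R (@?t e)) => apply (@d_app1 _ D _ R t)
  end.

Ltac dtapp :=
  match goal with
  | |- DT ?D (fun e => ?f (@?t e) (@?u e)) => apply (@dt_app2 _ D _ f t u)
  | |- DT ?D (fun e => ?f (@?t e)) => apply (@dt_app1 _ D _ f t)
  end.

Ltac dterm :=
  lazymatch goal with
  | |- DT _ (fun e => e ?i) => apply dt_var
  | |- DT _ (fun _ => ?a) => first [apply dt_const | unfold DT; cbn beta; dleaf]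
  | |- DT _ _ => dtapp; dterm
  | |- _ => dleaf
  end.

(** Recursion on the logical shape of the predicate. An atom is looked up in [defdb] with variables
    as arguments, and its actual arguments are then substituted by the [d_app] lemmas. *)
Ltac solve_def :=
  cbn beta;
  lazymatch goal with
  | |- _ (fun _ => ?Q) => apply d_const
  | |- _ (fun e => _ /\ _) => apply d_and; solve_def
  | |- _ (fun e => _ \/ _) => apply d_or; solve_def
  | |- _ (fun e => ~ _) => apply d_not; solve_def
  | |- _ (fun e => _ <-> _) => apply d_iff; solve_def
  | |- _ (fun e => exists! x, _) => unfold unique; solve_def
  | |- _ (fun e => exists x, _) => apply d_ex; solve_def
  | |- _ (fun e => (@?A e) -> (@?B e)) => apply (d_imp (P := A) (Q := B)); solve_def
  | |- _ (fun e => forall x, _) => apply d_all; solve_def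
  | |- ?D (fun e => @eq _ (@?t e) (@?u e)) =>
      apply (@d_app2 _ D _ (fun x y => x = y) t u); [apply d_eq0|dterm|dterm]
  | |- ?D (fun e => @mem _ (@?t e) (@?u e)) =>
      apply (@d_app2 _ D _ (fun x y => x ∈ y) t u); [apply d_mem0|dterm|dterm]
  | |- _ => dapp; dterm
  end.

Lemma D_is_empty (M : set_model) : Def (fun e : nat -> M => is_empty (e 0)).
Proof. unfold is_empty. solve_def. Qed.
Lemma D_incl (M : set_model) : Def (fun e : nat -> M => incl (e 0) (e 1)).
Proof. unfold incl. solve_def. Qed.
Lemma D_is_upair (M : set_model) : Def (fun e : nat -> M => is_upair (e 0) (e 1) (e 2)).
Proof. unfold is_upair. solve_def. Qed.
Lemma D_is_succ (M : set_model) : Def (fun e : nat -> M => is_succ (e 0) (e 1)).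
Proof. unfold is_succ. solve_def. Qed.
#[global] Hint Resolve D_is_empty D_incl D_is_upair D_is_succ : defdb.

Lemma D_inductive (M : set_model) : Def (fun e : nat -> M => inductive (e 0)).
Proof. unfold inductive. solve_def. Qed.
Lemma D_is_opair (M : set_model) : Def (fun e : nat -> M => is_opair (e 0) (e 1) (e 2)).
Proof. unfold is_opair. solve_def. Qed.
Lemma D_is_transitive (M : set_model) : Def (fun e : nat -> M => is_transitive (e 0)).
Proof. unfold is_transitive. solve_def. Qed.
Lemma D_is_num (M : set_model) (k : nat) : Def (fun e : nat -> M => is_num k (e 0)).
Proof. induction k; simpl; [solve_def|]. apply d_ex, d_and; [|solve_def]. exact (d_ren (fun _ => 0) IHk). Qed.
#[global] Hint Resolve D_inductive D_is_opair D_is_transitive D_is_num : defdb.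

Lemma D_pair_in (M : set_model) : Def (fun e : nat -> M => pair_in (e 0) (e 1) (e 2)).
Proof. unfold pair_in. solve_def. Qed.
Lemma D_is_ordinal (M : set_model) : Def (fun e : nat -> M => is_ordinal (e 0)).
Proof. unfold is_ordinal. solve_def. Qed.
Lemma D_is_omega (M : set_model) : Def (fun e : nat -> M => is_omega (e 0)).
Proof. unfold is_omega. solve_def. Qed.
Lemma D_is_tagged (M : set_model) (k : nat) : Def (fun e : nat -> M => is_tagged k (e 0) (e 1)).
Proof. unfold is_tagged. solve_def. Qed.
#[global] Hint Resolve D_pair_in D_is_ordinal D_is_omega D_is_tagged : defdb.

Lemma D_is_function_on (M : set_model) : Def (fun e : nat -> M => is_function_on (e 0) (e 1)).
Proof. unfold is_function_on. solve_def. Qed.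
Lemma D_is_nat (M : set_model) : Def (fun e : nat -> M => is_nat (e 0)).
Proof. unfold is_nat. solve_def. Qed.
Lemma D_is_tagged2 (M : set_model) (k : nat) : Def (fun e : nat -> M => is_tagged2 k (e 0) (e 1) (e 2)).
Proof. unfold is_tagged2. solve_def. Qed.
Lemma D_is_eps_signature (M : set_model) : Def (fun e : nat -> M => is_eps_signature (e 0)).
Proof. unfold is_eps_signature. solve_def. Qed.
#[global] Hint Resolve D_is_function_on D_is_nat D_is_tagged2 D_is_eps_signature : defdb.

Lemma D_is_map (M : set_model) : Def (fun e : nat -> M => is_map (e 0) (e 1) (e 2)).
Proof. unfold is_map. solve_def. Qed.
Lemma D_is_V (M : set_model) : Def (fun e : nat -> M => is_V (e 0) (e 1)).
Proof. unfold is_V. solve_def. Qed.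
Lemma D_rel_symbol (M : set_model) : Def (fun e : nat -> M => rel_symbol (e 0) (e 1) (e 2)).
Proof. unfold rel_symbol. solve_def. Qed.
Lemma D_fun_symbol (M : set_model) : Def (fun e : nat -> M => fun_symbol (e 0) (e 1) (e 2)).
Proof. unfold fun_symbol. solve_def. Qed.
#[global] Hint Resolve D_is_map D_is_V D_rel_symbol D_fun_symbol : defdb.

Lemma D_terms_closed (M : set_model) : Def (fun e : nat -> M => terms_closed (e 0) (e 1)).
Proof. unfold terms_closed. solve_def. Qed.
Lemma D_is_assignment (M : set_model) : Def (fun e : nat -> M => is_assignment (e 0) (e 1)).
Proof. unfold is_assignment. solve_def. Qed.
Lemma D_is_eps_structure (M : set_model) : Def (fun e : nat -> M => is_eps_structure (e 0) (e 1)).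
Proof. unfold is_eps_structure. solve_def. Qed.
#[global] Hint Resolve D_terms_closed D_is_assignment D_is_eps_structure : defdb.

Lemma D_is_term (M : set_model) : Def (fun e : nat -> M => is_term (e 0) (e 1)).
Proof. unfold is_term. solve_def. Qed.
#[global] Hint Resolve D_is_term : defdb.

Lemma D_is_term_seq (M : set_model) : Def (fun e : nat -> M => is_term_seq (e 0) (e 1) (e 2)).
Proof. unfold is_term_seq. solve_def. Qed.
#[global] Hint Resolve D_is_term_seq : defdb.

Lemma D_formulas_closed (M : set_model) : Def (fun e : nat -> M => formulas_closed (e 0) (e 1)).
Proof. unfold formulas_closed. solve_def. Qed.
Lemma D_is_evaluation (M : set_model) :
  Def (fun e : nat -> M => is_evaluation (e 0) (e 1) (e 2) (e 3) (e 4)).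
Proof. unfold is_evaluation. solve_def. Qed.
#[global] Hint Resolve D_formulas_closed D_is_evaluation : defdb.

Lemma D_is_formula (M : set_model) : Def (fun e : nat -> M => is_formula (e 0) (e 1)).
Proof. unfold is_formula. solve_def. Qed.
Lemma D_term_value (M : set_model) :
  Def (fun e : nat -> M => term_value (e 0) (e 1) (e 2) (e 3) (e 4) (e 5)).
Proof. unfold term_value. solve_def. Qed.
#[global] Hint Resolve D_is_formula D_term_value : defdb.

Lemma D_is_satisfaction (M : set_model) :
  Def (fun e : nat -> M => is_satisfaction (e 0) (e 1) (e 2) (e 3)).
Proof. unfold is_satisfaction. solve_def. Qed.
#[global] Hint Resolve D_is_satisfaction : defdb.

Lemma D_satisfies (M : set_model) : Def (fun e : nat -> M => satisfies (e 0) (e 1) (e 2) (e 3)).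
Proof. unfold satisfies. solve_def. Qed.
#[global] Hint Resolve D_satisfies : defdb.

Lemma D_elementary_embedding (M : set_model) :
  Def (fun e : nat -> M => elementary_embedding (e 0) (e 1) (e 2) (e 3)).
Proof. unfold elementary_embedding. solve_def. Qed.
#[global] Hint Resolve D_elementary_embedding : defdb.

Lemma D_eps_elementary (M : set_model) : Def (fun e : nat -> M => eps_elementary (e 0) (e 1)).
Proof. unfold eps_elementary. solve_def. Qed.
#[global] Hint Resolve D_eps_elementary : defdb.

(** * Set theory inside a model of ZF *)

Section BasicSets.
Context {M : set_model} {hZF : ZF M}.

Lemma ext (a b : M) : (forall x, x ∈ a <-> x ∈ b) -> a = b.
Proof. apply (ZF_extensionality hZF). Qed.

Lemma ZF_inhabited : inhabited M.
Proof. destruct (ZF_infinity hZF) as [w _]; exact (inhabits w). Qed.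

Lemma PDef_env (P : (nat -> M) -> Prop) : PDef P ->
  exists (p : fm) (l : list M), forall e, P e <-> holds (pre l e) p.
Proof. intros (Q & l & (p & Hp) & H). exists p, l. intros e; rewrite H, Hp; tauto. Qed.

Lemma PDef_class (C : M -> Prop) : PDef (fun e => C (e 0)) <-> definable_class C.
Proof.
  split.
  - intros H. destruct (PDef_env H) as (p & l & Hp). destruct ZF_inhabited as [a].
    exists (ren (fun n => if Nat.ltb n (length l) then S n
      else if Nat.eqb n (length l) then 0 else n) p), (pre l (fun _ => a)).
    intros x. rewrite holds_ren, <- pre_scons, <- Hp. simpl; tauto.
  - intros (p & e' & Hp). apply (d_ext (Q := fun e =>
      holds (fun n => if Nat.ltb n 1 then e n else e' (n - 1)) p)).
    + intros e. rewrite Hp.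
      replace (scons (e 0) e') with (fun n => if Nat.ltb n 1 then e n else e' (n - 1)); [tauto|].
      apply functional_extensionality; intros [|n]; simpl; [reflexivity|].
      rewrite Nat.sub_0_r; reflexivity.
    + apply PDef_holds.
Qed.

Lemma PDef_rel (R : M -> M -> Prop) : PDef (fun e => R (e 0) (e 1)) -> definable_rel R.
Proof.
  intros H. destruct (PDef_env H) as (p & l & Hp). destruct ZF_inhabited as [a].
  exists (ren (fun n => if Nat.ltb n (length l) then S (S n)
      else match n - length l with 0 => 0 | 1 => 1 | _ => n end) p), (pre l (fun _ => a)).
  intros x y. rewrite holds_ren, (Hp (scons x (scons y (fun _ => a)))).
  match goal with |- holds ?e _ <-> holds ?e' _ => replace e' with e; [tauto|] end.
  apply functional_extensionality; intros n; unfold pre.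
  destruct (Nat.ltb_spec n (length l)).
  - simpl. apply nth_indep; lia.
  - rewrite nth_overflow by lia. destruct (n - length l) as [|[|m]] eqn:E; try reflexivity.
    destruct n as [|[|n]]; try lia. simpl scons. rewrite nth_overflow by lia. reflexivity.
Qed.

Lemma sep_ex (C : M -> Prop) : PDef (fun e => C (e 0)) ->
  forall a, exists b, forall x, x ∈ b <-> x ∈ a /\ C x.
Proof. intros H; apply (ZF_separation hZF), PDef_class, H. Qed.

Lemma rep_ex (R : M -> M -> Prop) : PDef (fun e => R (e 0) (e 1)) ->
  forall a, (forall x, x ∈ a -> exists! y, R x y) ->
  exists b, forall y, y ∈ b <-> exists x, x ∈ a /\ R x y.
Proof. intros H; apply (ZF_replacement hZF), PDef_rel, H. Qed.

Lemma definable_class_PDef (C : M -> Prop) : definable_class C -> PDef (fun e => C (e 0)).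
Proof. apply PDef_class. Qed.

(** A description operator of the metatheory. It is applied to properties that at most one set has,
    so no choice enters [M]; that the resulting operation is definable has to be proved from the
    property itself. *)
Definition choose (P : M -> Prop) : M := epsilon ZF_inhabited P.

Lemma chooseP (P : M -> Prop) : (exists x, P x) -> P (choose P).
Proof. apply epsilon_spec. Qed.

Definition sep (a : M) (C : M -> Prop) : M := choose (fun b => forall x, x ∈ b <-> x ∈ a /\ C x).

Lemma mem_sep (a : M) (C : M -> Prop) (x : M) : PDef (fun e => C (e 0)) ->
  (x ∈ sep a C <-> x ∈ a /\ C x).
Proof. intros H; revert x. exact (chooseP (sep_ex H a)). Qed.

Definition emp : M := choose (@is_empty M).

Lemma emp_empty : is_empty emp.
Proof.
  apply (chooseP (P := @is_empty M)). destruct (ZF_infinity hZF) as [w [[z [H _]] _]].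
  exists z; exact H.
Qed.

Lemma mem_emp x : x ∈ emp <-> False.
Proof. split; [apply emp_empty|tauto]. Qed.

Lemma is_emptyE x : is_empty x <-> x = emp.
Proof.
  split; [|intros ->; exact emp_empty].
  intros H; apply ext; intros z; rewrite mem_emp. split; [apply H|tauto].
Qed.

Definition upair (x y : M) : M := choose (fun p => is_upair p x y).

Lemma mem_upair x y z : z ∈ upair x y <-> z = x \/ z = y.
Proof. exact (chooseP (ZF_pairing hZF x y) z). Qed.

Lemma is_upairE p x y : is_upair p x y <-> p = upair x y.
Proof.
  split; [|intros ->; intros z; apply mem_upair].
  intros H; apply ext; intros z; rewrite mem_upair; apply H.
Qed.

Definition pr (x y : M) : M := upair (upair x x) (upair x y).

Lemma is_opairE p x y : is_opair p x y <-> p = pr x y.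
Proof.
  unfold is_opair, pr. setoid_rewrite is_upairE. split.
  - intros (a & b & -> & -> & H); exact H.
  - intros H; exists (upair x x), (upair x y); auto.
Qed.

Lemma upair_inj x y z : upair x y = upair x z -> y = z.
Proof.
  intros H. assert (Hy : y ∈ upair x z) by (rewrite <- H, mem_upair; auto).
  assert (Hz : z ∈ upair x y) by (rewrite H, mem_upair; auto).
  rewrite mem_upair in *. intuition congruence.
Qed.

Lemma pr_inj x y x' y' : pr x y = pr x' y' <-> x = x' /\ y = y'.
Proof.
  split; [|intros [-> ->]; reflexivity]. intros H.
  assert (Hx : x = x').
  { assert (K : upair x' x' ∈ pr x y) by (rewrite H; unfold pr; rewrite mem_upair; auto).
    unfold pr in K; rewrite mem_upair in K.
    assert (K' : x ∈ upair x' x').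
    { destruct K as [->| ->]; rewrite mem_upair; auto. }
    rewrite mem_upair in K'; tauto. }
  subst x'. split; [reflexivity|]. apply upair_inj in H. apply upair_inj in H. exact H.
Qed.

Lemma pair_inE f x y : pair_in f x y <-> pr x y ∈ f.
Proof.
  unfold pair_in. setoid_rewrite is_opairE. split.
  - intros (p & -> & H); exact H.
  - intros H; exists (pr x y); auto.
Qed.

Definition un (a : M) : M := choose (fun u => forall x, x ∈ u <-> exists y, y ∈ a /\ x ∈ y).

Lemma mem_un a x : x ∈ un a <-> exists y, y ∈ a /\ x ∈ y.
Proof. exact (chooseP (ZF_union hZF a) x). Qed.

Definition cup (a b : M) : M := un (upair a b).

Lemma mem_cup a b x : x ∈ cup a b <-> x ∈ a \/ x ∈ b.
Proof.
  unfold cup; rewrite mem_un. setoid_rewrite mem_upair. split.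
  - intros (y & [->| ->] & H); auto.
  - intros [H|H]; eauto.
Qed.

Definition suc (x : M) : M := cup x (upair x x).

Lemma mem_suc x z : z ∈ suc x <-> z ∈ x \/ z = x.
Proof. unfold suc; rewrite mem_cup, mem_upair; tauto. Qed.

Lemma is_succE s x : is_succ s x <-> s = suc x.
Proof.
  split; [|intros ->; intros z; apply mem_suc].
  intros H; apply ext; intros z; rewrite mem_suc; apply H.
Qed.

Definition pow (a : M) : M := choose (fun b => forall x, x ∈ b <-> incl x a).

Lemma mem_pow a x : x ∈ pow a <-> incl x a.
Proof. exact (chooseP (ZF_power hZF a) x). Qed.

Fixpoint num (k : nat) : M := match k with O => emp | S k' => suc (num k') end.

Lemma is_numE k x : is_num k x <-> x = num k.
Proof.
  revert x; induction k; intros x; simpl; [apply is_emptyE|].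
  setoid_rewrite IHk. setoid_rewrite is_succE. split.
  - intros (y & -> & H); exact H.
  - intros H; eauto.
Qed.

Lemma is_taggedE k x a : is_tagged k x a <-> x = pr (num k) a.
Proof.
  unfold is_tagged. setoid_rewrite is_numE. setoid_rewrite is_opairE. split.
  - intros (n & -> & H); exact H.
  - intros H; eauto.
Qed.

Lemma is_tagged2E k x a b : is_tagged2 k x a b <-> x = pr (num k) (pr a b).
Proof.
  unfold is_tagged2. setoid_rewrite is_taggedE. setoid_rewrite is_opairE. split.
  - intros (n & -> & H); exact H.
  - intros H; eauto.
Qed.

Lemma D_emp : Def (fun e : nat -> M => e 0 = emp).
Proof. eapply d_ext; [intros; symmetry; apply is_emptyE|]. solve_def. Qed.
Lemma D_upair : Def (fun e : nat -> M => e 0 = upair (e 1) (e 2)).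
Proof. eapply d_ext; [intros; symmetry; apply is_upairE|]. solve_def. Qed.
Lemma D_pr : Def (fun e : nat -> M => e 0 = pr (e 1) (e 2)).
Proof. eapply d_ext; [intros; symmetry; apply is_opairE|]. solve_def. Qed.
Lemma D_suc : Def (fun e : nat -> M => e 0 = suc (e 1)).
Proof. eapply d_ext; [intros; symmetry; apply is_succE|]. solve_def. Qed.

Lemma unE u a : (forall x, x ∈ u <-> exists y, y ∈ a /\ x ∈ y) <-> u = un a.
Proof.
  split; [|intros ->; apply mem_un].
  intros H; apply ext; intros z; rewrite mem_un; apply H.
Qed.

Lemma powE u a : (forall x, x ∈ u <-> incl x a) <-> u = pow a.
Proof.
  split; [|intros ->; apply mem_pow].
  intros H; apply ext; intros z; rewrite mem_pow; apply H.
Qed.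

Lemma D_un : Def (fun e : nat -> M => e 0 = un (e 1)).
Proof. eapply d_ext; [intros; symmetry; apply unE|]. solve_def. Qed.
Lemma D_pow : Def (fun e : nat -> M => e 0 = pow (e 1)).
Proof. eapply d_ext; [intros; symmetry; apply powE|]. solve_def. Qed.
End BasicSets.
#[global] Hint Resolve D_emp D_upair D_pr D_suc D_un D_pow : defdb.

(** * Ordinals *)

Section Ordinals.
Context {M : set_model} {hZF : ZF M}.

Lemma mem_irrefl (x : M) : ~ x ∈ x.
Proof.
  intros H. destruct (@ZF_foundation _ hZF (upair x x)) as (y & Hy & K).
  - exists x; rewrite mem_upair; auto.
  - rewrite mem_upair in Hy. assert (y = x) by tauto; subst.
    apply (K x H), mem_upair; auto.
Qed.

Lemma mem_asym (x y : M) : x ∈ y -> ~ y ∈ x.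
Proof.
  intros H H'. destruct (@ZF_foundation _ hZF (upair x y)) as (z & Hz & K).
  - exists x; rewrite mem_upair; auto.
  - rewrite mem_upair in Hz. destruct Hz as [->| ->].
    + apply (K y H'), mem_upair; auto.
    + apply (K x H), mem_upair; auto.
Qed.

Lemma suc_inj (x y : M) : suc x = suc y -> x = y.
Proof.
  intros H. assert (Hx : x ∈ suc y) by (rewrite <- H, mem_suc; auto).
  assert (Hy : y ∈ suc x) by (rewrite H, mem_suc; auto).
  rewrite mem_suc in *. destruct Hx; [|auto]. destruct Hy; [|auto].
  exfalso; eapply mem_asym; eauto.
Qed.

Lemma num_inj j k : num j = num k :> M -> j = k.
Proof.
  revert k; induction j; intros [|k]; simpl; intros H; try reflexivity.
  - exfalso. apply (@emp_empty _ _ (num k)). rewrite H, mem_suc; auto.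
  - exfalso. apply (@emp_empty _ _ (num j)). rewrite <- H, mem_suc; auto.
  - f_equal; apply IHj, suc_inj, H.
Qed.

Lemma ord_in (a x : M) : is_ordinal a -> x ∈ a -> is_ordinal x.
Proof.
  intros [H1 H2] Hx. split; [apply H2, Hx|]. intros y Hy; apply H2. eapply H1; eauto.
Qed.

Lemma ord_trans (a x y : M) : is_ordinal a -> x ∈ a -> y ∈ x -> y ∈ a.
Proof. intros [H _] Hx Hy; eapply H; eauto. Qed.

Lemma ord_suc (a : M) : is_ordinal a -> is_ordinal (suc a).
Proof.
  intros H; split.
  - intros x Hx y Hy; rewrite mem_suc in *. left. destruct Hx as [Hx| ->]; [|exact Hy].
    eapply ord_trans; eauto.
  - intros x Hx; rewrite mem_suc in Hx. destruct Hx as [Hx| ->]; [|exact (proj1 H)].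
    exact (proj1 (ord_in H Hx)).
Qed.

(** Foundation speaks of sets only, so the class is first cut down to [suc a]. *)
Lemma ord_least (C : M -> Prop) : PDef (fun e => C (e 0)) ->
  (exists a, is_ordinal a /\ C a) ->
  exists a, is_ordinal a /\ C a /\ forall b, b ∈ a -> ~ C b.
Proof.
  intros HC (a & Ha & Ca).
  destruct (@ZF_foundation _ hZF (sep (suc a) C)) as (b & Hb & K).
  - exists a. rewrite mem_sep, mem_suc by exact HC; auto.
  - rewrite mem_sep in Hb by exact HC. destruct Hb as [Hb Cb].
    exists b. split; [apply (ord_in (ord_suc Ha) Hb)|]. split; [exact Cb|].
    intros c Hc Cc. apply (K c Hc). rewrite mem_sep by exact HC.
    split; [|exact Cc]. apply (ord_trans (ord_suc Ha) Hb Hc).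
Qed.

Lemma ord_ind (C : M -> Prop) : PDef (fun e => C (e 0)) ->
  (forall a, is_ordinal a -> (forall b, b ∈ a -> C b) -> C a) ->
  forall a, is_ordinal a -> C a.
Proof.
  intros HC IH a Ha. apply NNPP; intros Na.
  destruct (@ord_least (fun x => ~ C x)) as (b & Hb & Nb & K).
  - solve_def.
  - eauto.
  - apply Nb, IH; [exact Hb|]. intros c Hc; apply NNPP, K, Hc.
Qed.

(** Take [c] least among the ordinals incomparable with some ordinal, and [d] least among those
    incomparable with [c]. By minimality both have the same members, so [c = d], a contradiction. *)
Lemma ord_trichotomy (a b : M) : is_ordinal a -> is_ordinal b -> a ∈ b \/ a = b \/ b ∈ a.
Proof.
  intros Ha Hb. apply NNPP; intros N.
  destruct (@ord_least (fun x => exists y, is_ordinal y /\ ~ (x ∈ y \/ x = y \/ y ∈ x)))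
    as (c & Hc & (y & Hy & Ny) & Kc).
  - solve_def.
  - eauto.
  - destruct (@ord_least (fun y => ~ (c ∈ y \/ c = y \/ y ∈ c))) as (d & Hd & Nd & Kd).
    + solve_def.
    + eauto.
    + apply Nd. right; left. apply ext; intros z; split; intros Hz.
      * destruct (classic (z ∈ d \/ z = d \/ d ∈ z)) as [[H|[H|H]]|H]; [exact H| | |].
        -- subst; tauto.
        -- exfalso; apply Nd; right; right. apply (ord_trans Hc Hz H).
        -- exfalso; apply (Kc z Hz); eauto.
      * destruct (NNPP _ (Kd z Hz)) as [H|[H|H]]; [|subst; tauto|exact H].
        exfalso; apply Nd; left. apply (ord_trans Hd Hz H).
Qed.

Lemma ord_incl (a b : M) : is_ordinal a -> is_ordinal b -> (incl a b <-> a ∈ b \/ a = b).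
Proof.
  intros Ha Hb; split.
  - intros H. destruct (ord_trichotomy Ha Hb) as [K|[K|K]]; auto.
    exfalso; apply (@mem_irrefl b), H, K.
  - intros [H| ->]; intros x Hx; [apply (ord_trans Hb H Hx)|exact Hx].
Qed.

Lemma ord_not_mem (a b : M) : is_ordinal a -> is_ordinal b -> ~ a ∈ b -> incl b a.
Proof.
  intros Ha Hb H. apply ord_incl; auto. destruct (ord_trichotomy Ha Hb) as [K|[K|K]]; auto.
  tauto.
Qed.

Lemma ord_emp : is_ordinal emp.
Proof. split; intros x Hx; apply mem_emp in Hx; tauto. Qed.

Lemma ord_un (a : M) : (forall x, x ∈ a -> is_ordinal x) -> is_ordinal (un a).
Proof.
  intros H; split.
  - intros x Hx y Hy. rewrite mem_un in *. destruct Hx as (z & Hz & Hx).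
    exists z; split; [exact Hz|]. apply (ord_trans (H z Hz) Hx Hy).
  - intros x Hx. rewrite mem_un in Hx. destruct Hx as (z & Hz & Hx).
    exact (proj1 (ord_in (H z Hz) Hx)).
Qed.

Lemma ord_bound (a : M) : (forall x, x ∈ a -> is_ordinal x) ->
  exists b, is_ordinal b /\ forall x, x ∈ a -> x ∈ b.
Proof.
  intros H. exists (suc (un a)); split; [apply ord_suc, ord_un, H|].
  intros x Hx. rewrite mem_suc. apply ord_incl; auto using ord_un.
  intros y Hy; rewrite mem_un; eauto.
Qed.

Lemma ord_suc_mem (a b : M) : is_ordinal a -> is_ordinal b -> a ∈ b -> suc a ∈ b \/ suc a = b.
Proof.
  intros Ha Hb H. apply ord_incl; auto using ord_suc.
  intros x Hx; rewrite mem_suc in Hx. destruct Hx as [Hx| ->]; [|exact H].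
  apply (ord_trans Hb H Hx).
Qed.

Lemma ord_max (a b : M) : is_ordinal a -> is_ordinal b ->
  exists c, is_ordinal c /\ (c = a \/ c = b) /\ incl a c /\ incl b c.
Proof.
  intros Ha Hb. destruct (ord_trichotomy Ha Hb) as [K|[K|K]].
  - exists b; split; [exact Hb|split; [auto|split; [apply ord_incl; auto|intros x; auto]]].
  - subst; exists b; split; [exact Hb|split; [auto|split; intros x; auto]].
  - exists a; split; [exact Ha|split; [auto|split; [intros x; auto|apply ord_incl; auto]]].
Qed.

(** * The natural numbers of the model *)

Lemma omega_ex : exists w : M, is_omega w.
Proof.
  destruct (ZF_infinity hZF) as [w Hw].
  set (w0 := sep w (fun x => forall w', inductive w' -> x ∈ w')).
  assert (H0 : forall x, x ∈ w0 <-> x ∈ w /\ forall w', inductive w' -> x ∈ w').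
  { intros x; apply mem_sep. solve_def. }
  exists w0; split; [split|].
  - exists emp; split; [apply emp_empty|]. rewrite H0.
    assert (K : forall w', inductive w' -> emp ∈ w').
    { intros w' [(z & Hz & K) _]. apply is_emptyE in Hz; subst; exact K. }
    auto.
  - intros x Hx. exists (suc x); split; [apply is_succE; reflexivity|]. rewrite H0 in *.
    assert (K : forall w', inductive w' -> x ∈ w' -> suc x ∈ w').
    { intros w' [_ K] Hw'. destruct (K x Hw') as (s & Hs & K').
      apply is_succE in Hs; subst; exact K'. }
    split; [apply K; tauto|]. intros w' Hw'; apply K; [exact Hw'|apply Hx, Hw'].
  - intros w' Hw' x Hx. rewrite H0 in Hx. apply Hx, Hw'.
Qed.

Definition om : M := choose (@is_omega M).

Lemma is_omega_om : is_omega om.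
Proof. apply (chooseP (P := @is_omega M)), omega_ex. Qed.

Lemma is_omegaE w : is_omega w <-> w = om.
Proof.
  split; [|intros ->; apply is_omega_om]. intros [H1 H2]. destruct is_omega_om as [H3 H4].
  apply ext; intros x; split; [apply H2, H3|apply H4, H1].
Qed.

Lemma D_om : Def (fun e : nat -> M => e 0 = om).
Proof. eapply d_ext; [intros; symmetry; apply is_omegaE|]. solve_def. Qed.

Lemma is_natE n : is_nat n <-> n ∈ om.
Proof.
  unfold is_nat. setoid_rewrite is_omegaE. split; [intros (w & -> & H); exact H|eauto].
Qed.

Lemma om_emp : emp ∈ om.
Proof.
  destruct is_omega_om as [[(z & Hz & K) _] _]. apply is_emptyE in Hz; subst; exact K.
Qed.

Lemma om_suc n : n ∈ om -> suc n ∈ om.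
Proof.
  intros H. destruct is_omega_om as [[_ K] _]. destruct (K n H) as (s & Hs & K').
  apply is_succE in Hs; subst; exact K'.
Qed.

Lemma om_num k : num k ∈ om.
Proof. induction k; simpl; auto using om_emp, om_suc. Qed.

Lemma om_ind (C : M -> Prop) : PDef (fun e => C (e 0)) -> C emp ->
  (forall n, n ∈ om -> C n -> C (suc n)) -> forall n, n ∈ om -> C n.
Proof.
  intros HC H0 HS n Hn. destruct is_omega_om as [_ K].
  assert (Hm : n ∈ sep om C); [|rewrite mem_sep in Hm by exact HC; tauto].
  apply K; [|exact Hn]. split.
  - exists emp; split; [apply emp_empty|]. rewrite mem_sep by exact HC. auto using om_emp.
  - intros x Hx. exists (suc x); split; [apply is_succE; reflexivity|].
    rewrite mem_sep in * by exact HC. destruct Hx; split; auto using om_suc.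
Qed.

Lemma ord_om : is_ordinal om.
Proof.
  assert (H : forall n, n ∈ om -> is_ordinal n /\ incl n om).
  { apply om_ind; [solve_def| |].
    - split; [apply ord_emp|]. intros x Hx; apply mem_emp in Hx; tauto.
    - intros n Hn [H1 H2]; split; [apply ord_suc, H1|].
      intros x Hx; rewrite mem_suc in Hx. destruct Hx as [Hx| ->]; auto. }
  split; [intros n Hn; apply H, Hn|]. intros n Hn; exact (proj1 (proj1 (H n Hn))).
Qed.

Definition is_limit (a : M) : Prop :=
  is_ordinal a /\ emp ∈ a /\ forall b, b ∈ a -> suc b ∈ a.

Lemma limit_om_le a : is_limit a -> om ∈ a \/ om = a.
Proof.
  intros (H & H0 & HS). apply ord_incl; [apply ord_om|exact H|].
  intros n; revert n; apply om_ind; [solve_def| |]; auto.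
Qed.

Lemma ord_cases a : is_ordinal a -> a = emp \/ (exists b, is_ordinal b /\ a = suc b) \/ is_limit a.
Proof.
  intros Ha. destruct (classic (a = emp)) as [|N0]; [auto|right].
  destruct (classic (exists b, is_ordinal b /\ a = suc b)) as [|NS]; [auto|right].
  split; [exact Ha|split].
  - destruct (ord_trichotomy ord_emp Ha) as [H|[H|H]]; [exact H|congruence|].
    apply mem_emp in H; tauto.
  - intros b Hb. pose proof (ord_in Ha Hb) as Ob.
    destruct (ord_suc_mem Ob Ha Hb); [assumption|]. exfalso; eauto.
Qed.

End Ordinals.
#[global] Hint Resolve D_om : defdb.
Lemma D_is_limit (M : set_model) (hZF : ZF M) : Def (fun e : nat -> M => is_limit (e 0)).
Proof. unfold is_limit. solve_def. Qed.
#[global] Hint Resolve D_is_limit : defdb.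

Ltac ord_induct :=
  match goal with |- forall a, is_ordinal a -> @?C a => apply (@ord_ind _ _ C); cbn beta end.

Ltac om_induct :=
  match goal with |- forall n, n ∈ om -> @?C n => apply (@om_ind _ _ C); cbn beta end.

(** * Functions, transfinite recursion and the cumulative hierarchy *)

Section Functions.
Context {M : set_model} {hZF : ZF M}.

(** The element satisfying [P] if there is exactly one; written as the union of
    the elements satisfying [P] so that its graph is definable. *)
Definition iot (P : M -> Prop) : M := choose (fun z => forall t, t ∈ z <-> exists y, P y /\ t ∈ y).

Lemma mem_iot (P : M -> Prop) : (forall y y', P y -> P y' -> y = y') ->
  forall t, t ∈ iot P <-> exists y, P y /\ t ∈ y.
Proof.
  intros U. apply (chooseP (P := fun z => forall t, t ∈ z <-> exists y, P y /\ t ∈ y)).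
  destruct (classic (exists y, P y)) as [[y Hy]|N].
  - exists y; intros t; split; [eauto|]. intros (y' & H & K). rewrite (U y y'); auto.
  - exists emp; intros t; rewrite mem_emp. split; [tauto|].
    intros (y & Hy & _); eauto.
Qed.

Lemma iot_eq (P : M -> Prop) y : (forall y y', P y -> P y' -> y = y') -> P y -> iot P = y.
Proof.
  intros U Hy. apply ext; intros t; rewrite (mem_iot U). split; [|eauto].
  intros (y' & H & K). rewrite (U y y'); auto.
Qed.

Lemma dt_iot (D : ((nat -> M) -> Prop) -> Prop) {HD : definability D}
  (P : M -> (nat -> M) -> Prop) :
  (forall e y y', P y e -> P y' e -> y = y') ->
  D (fun e => P (e 0) (fun n => e (S n))) -> DT D (fun e => iot (fun y => P y e)).
Proof.
  intros U H. unfold DT.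
  apply (d_ext (Q := fun e => forall t, t ∈ e 0 <-> exists y, P y (fun n => e (S n)) /\ t ∈ y)).
  - intros e; split.
    + intros ->. apply mem_iot, U.
    + intros K. apply ext; intros t. rewrite K, mem_iot; [tauto|apply U].
  - apply d_all, d_iff; [solve_def|]. apply d_ex, d_and; [|solve_def].
    exact (d_ren (fun n => match n with 0 => 0 | S n' => S (S (S n')) end) H).
Qed.

(** The second conjunct makes the property hold of at most one [y] for every [f], function or not,
    so that [app] is total with a definable graph. *)
Definition app (f x : M) : M :=
  iot (fun y => pr x y ∈ f /\ forall y', pr x y' ∈ f -> y' = y).

Lemma D_app : Def (fun e : nat -> M => e 0 = app (e 1) (e 2)).
Proof.
  apply (@dt_iot _ _ (fun y e => pr (e 1) y ∈ e 0 /\ forall y', pr (e 1) y' ∈ e 0 -> y' = y)).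
  - intros e y y' [H H1] [H2 H3]; auto.
  - solve_def.
Qed.

Lemma app_val (f x y : M) : pr x y ∈ f -> (forall y', pr x y' ∈ f -> y' = y) -> app f x = y.
Proof.
  intros H1 H2. apply iot_eq; [|auto]. intros z z' [H H'] [K K']; auto.
Qed.

Lemma fun_app (f a x y : M) : is_function_on f a -> x ∈ a -> (pr x y ∈ f <-> y = app f x).
Proof.
  intros [_ H] Hx. destruct (H x Hx) as (z & Hz & U). rewrite pair_inE in Hz.
  assert (E : app f x = z).
  { apply app_val; [exact Hz|]. intros y' H'; symmetry; apply U, pair_inE, H'. }
  rewrite E; split; [|intros ->; exact Hz].
  intros H'; symmetry; apply U, pair_inE, H'.
Qed.

Lemma fun_dom (f a x y : M) : is_function_on f a -> pr x y ∈ f -> x ∈ a.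
Proof.
  intros [H _] K. destruct (H _ K) as (x' & y' & Hx & Hp). apply is_opairE, pr_inj in Hp.
  destruct Hp; subst; exact Hx.
Qed.

Lemma fun_pair (f a x y : M) : is_function_on f a -> (pr x y ∈ f <-> x ∈ a /\ y = app f x).
Proof.
  intros H; split.
  - intros K. pose proof (fun_dom H K) as Hx. split; [exact Hx|]. apply (fun_app _ H Hx), K.
  - intros [Hx Hy]. apply (fun_app _ H Hx), Hy.
Qed.

Lemma fun_mem (f a p : M) : is_function_on f a -> (p ∈ f <-> exists x, x ∈ a /\ p = pr x (app f x)).
Proof.
  intros H; split.
  - intros K. destruct (proj1 H _ K) as (x & y & Hx & Hp). apply is_opairE in Hp; subst.
    exists x; split; [exact Hx|]. f_equal. apply (fun_app _ H Hx), K.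
  - intros (x & Hx & ->). apply (fun_app _ H Hx); reflexivity.
Qed.

Lemma fun_ext (f g a : M) : is_function_on f a -> is_function_on g a ->
  (forall x, x ∈ a -> app f x = app g x) -> f = g.
Proof.
  intros Hf Hg E. apply ext; intros p. rewrite (fun_mem _ Hf), (fun_mem _ Hg).
  split; intros (x & Hx & ->); exists x; split; auto; rewrite E; auto.
Qed.

Lemma fun_dom_eq (f a b : M) : is_function_on f a -> is_function_on f b -> a = b.
Proof.
  intros Ha Hb. apply ext; intros x; split; intros Hx.
  - apply (fun_dom Hb (y := app f x)), (fun_app _ Ha Hx); reflexivity.
  - apply (fun_dom Ha (y := app f x)), (fun_app _ Hb Hx); reflexivity.
Qed.

Lemma is_mapE (f a b : M) : is_map f a b <-> is_function_on f a /\ forall x, x ∈ a -> app f x ∈ b.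
Proof.
  split.
  - intros [H K]; split; [exact H|]. intros x Hx. apply (K x), pair_inE, (fun_app _ H Hx).
    reflexivity.
  - intros [H K]; split; [exact H|]. intros x y Hxy. apply pair_inE in Hxy.
    apply (fun_pair _ _ H) in Hxy. destruct Hxy; subst; auto.
Qed.

Definition lam (a : M) (G : M -> M) : M :=
  choose (fun f => forall p, p ∈ f <-> exists x, x ∈ a /\ p = pr x (G x)).

Lemma mem_lam (a : M) (G : M -> M) : definable_map G ->
  forall p, p ∈ lam a G <-> exists x, x ∈ a /\ p = pr x (G x).
Proof.
  intros HG. apply (chooseP (P := fun f => forall p, p ∈ f <-> exists x, x ∈ a /\ p = pr x (G x))).
  apply (rep_ex (R := fun x p => p = pr x (G x))); [solve_def|].
  intros x _. exists (pr x (G x)); split; auto.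
Qed.

Lemma lam_pr (a x y : M) (G : M -> M) : definable_map G ->
  (pr x y ∈ lam a G <-> x ∈ a /\ y = G x).
Proof.
  intros HG. rewrite (mem_lam a HG). setoid_rewrite pr_inj. split.
  - intros (z & Hz & -> & ->); auto.
  - intros [H ->]; eauto.
Qed.

Lemma lam_fun (a : M) (G : M -> M) : definable_map G -> is_function_on (lam a G) a.
Proof.
  intros HG; split.
  - intros p Hp. apply (mem_lam a HG) in Hp. destruct Hp as (x & Hx & ->).
    exists x, (G x); split; [exact Hx|]. apply is_opairE; reflexivity.
  - intros x Hx. exists (G x). split; [apply pair_inE, lam_pr; auto|].
    intros y Hy. apply pair_inE, lam_pr in Hy; [|exact HG]. symmetry; tauto.
Qed.

Lemma app_lam (a x : M) (G : M -> M) : definable_map G -> x ∈ a -> app (lam a G) x = G x.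
Proof.
  intros HG Hx. symmetry. apply (fun_app _ (lam_fun a HG) Hx), lam_pr; auto.
Qed.

Lemma lam_ext (a : M) (G H : M -> M) : (forall x, x ∈ a -> G x = H x) -> lam a G = lam a H.
Proof.
  intros E. unfold lam. f_equal. apply functional_extensionality; intros f.
  apply propositional_extensionality. split; intros K p; rewrite K;
    split; intros (x & Hx & ->); exists x; split; auto; rewrite E; auto.
Qed.

(** It equals [lam b (app g)]; the form with [iot] makes it definable in [g] and [b] jointly, as the
    recursion below requires. *)
Definition res (g b : M) : M := iot (fun r => forall p, p ∈ r <-> exists x, x ∈ b /\ p = pr x (app g x)).

End Functions.
#[global] Hint Resolve D_app : defdb.

(** * Transfinite recursion along the ordinals *)

Section Recursion.
Context {M : set_model} {hZF : ZF M}.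

Lemma res_unique (g b : M) r r' : (forall p, p ∈ r <-> exists x, x ∈ b /\ p = pr x (app g x)) ->
  (forall p, p ∈ r' <-> exists x, x ∈ b /\ p = pr x (app g x)) -> r = r'.
Proof. intros H H'; apply ext; intros p; rewrite H, H'; tauto. Qed.

Lemma D_res : Def (fun e : nat -> M => e 0 = res (e 1) (e 2)).
Proof.
  apply (@dt_iot _ _ _ _ (fun r e => forall p, p ∈ r <-> exists x, x ∈ e 1 /\ p = pr x (app (e 0) x))).
  - intros e y y'; apply res_unique.
  - solve_def.
Qed.

Lemma PDef_app (g : M) : PDef (fun e : nat -> M => e 0 = app g (e 1)).
Proof. solve_def. Qed.

Lemma res_lam (g b : M) : res g b = lam b (app g).
Proof.
  apply iot_eq; [apply res_unique|]. apply mem_lam, PDef_app.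
Qed.

Variable F : M -> M.
Hypothesis HF : definable_map F.

Definition attempt (a g : M) : Prop :=
  is_function_on g a /\ forall b, b ∈ a -> app g b = F (res g b).

Definition rec (b : M) : M :=
  iot (fun y => exists a g, is_ordinal a /\ b ∈ a /\ attempt a g /\ y = app g b).

#[local] Hint Resolve D_res HF : defdb.

Lemma PDef_attempt : PDef (fun e => attempt (e 0) (e 1)).
Proof. unfold attempt. solve_def. Qed.
#[local] Hint Resolve PDef_attempt : defdb.

Lemma attempt_agree (a g a' g' : M) : is_ordinal a -> is_ordinal a' -> attempt a g -> attempt a' g' ->
  forall b, is_ordinal b -> b ∈ a -> b ∈ a' -> app g b = app g' b.
Proof.
  intros Ha Ha' [Hg Eg] [Hg' Eg']. ord_induct; [solve_def|].
  intros b Hb IH H H'. rewrite Eg, Eg' by assumption. f_equal. rewrite !res_lam.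
  apply lam_ext. intros c Hc. apply IH; [exact Hc| |]; eauto using ord_trans.
Qed.

Lemma rec_unique (b y y' : M) :
  (exists a g, is_ordinal a /\ b ∈ a /\ attempt a g /\ y = app g b) ->
  (exists a g, is_ordinal a /\ b ∈ a /\ attempt a g /\ y' = app g b) -> y = y'.
Proof.
  intros (a & g & Ha & Hb & Hg & ->) (a' & g' & Ha' & Hb' & Hg' & ->).
  eapply (attempt_agree Ha Ha'); eauto using ord_in.
Qed.

Lemma PDef_rec : definable_map rec.
Proof.
  apply (@dt_iot _ _ _ _ (fun y e => exists a g, is_ordinal a /\ e 0 ∈ a /\ attempt a g /\ y = app g (e 0))).
  - intros e; apply rec_unique.
  - solve_def.
Qed.
#[local] Hint Resolve PDef_rec : defdb.

Lemma rec_attempt (a g b : M) : is_ordinal a -> attempt a g -> b ∈ a -> rec b = app g b.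
Proof.
  intros Ha Hg Hb. apply iot_eq; [apply rec_unique|]. exists a, g; auto.
Qed.

(** By induction: below [a] the function [rec] already obeys the recursion, and its value at [b]
    comes from extending [lam b rec] by one point. *)
Lemma attempt_ex (a : M) : is_ordinal a -> attempt a (lam a rec).
Proof.
  revert a; ord_induct.
  (* The term [lam (e 0) rec] has no definability hint, so the induction predicate is restated
     through a set [g] described by its members. *)
  { apply (d_ext (Q := fun e => exists g, g = lam (e 0) rec /\ attempt (e 0) g)).
    - intros e; split; [eauto|intros (g & -> & H); exact H].
    - apply (d_ext (Q := fun e => exists g, (forall p, p ∈ g <-> exists x, x ∈ e 0 /\ p = pr x (rec x))
        /\ attempt (e 0) g)); [|solve_def].
      intros e; split; intros (g & H & K); exists g; (split; [|exact K]).
      + rewrite H. apply mem_lam, PDef_rec.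
      + apply ext; intros p; rewrite H, mem_lam; [tauto|apply PDef_rec]. }
  intros a Ha IH.
  assert (E : forall b, b ∈ a -> rec b = F (lam b rec)).
  { intros b Hb. pose proof (ord_in Ha Hb) as Ob. pose proof (IH b Hb) as [Hf Hrec].
    (* [lam b rec] extended by the value [F (lam b rec)] at [b]. It is an attempt on [suc b], so it
       computes [rec b]. *)
    set (g := lam (suc b) (fun c => iot (fun y => (c ∈ b /\ y = rec c) \/ (c = b /\ y = F (lam b rec))))).
    assert (U : forall c y y', (c ∈ b /\ y = rec c) \/ (c = b /\ y = F (lam b rec)) ->
      (c ∈ b /\ y' = rec c) \/ (c = b /\ y' = F (lam b rec)) -> y = y').
    { intros c y y' [[H1 H2]|[H1 H2]] [[H3 H4]|[H3 H4]]; subst; auto;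
        exfalso; eapply mem_irrefl; eauto. }
    assert (HG : PDef (fun e : nat -> M => e 0 = iot (fun y => (e 1 ∈ b /\ y = rec (e 1)) \/
      (e 1 = b /\ y = F (lam b rec))))).
    { apply (@dt_iot _ _ _ _ (fun y e => (e 0 ∈ b /\ y = rec (e 0)) \/
        (e 0 = b /\ y = F (lam b rec)))); [intros e; apply U|solve_def]. }
    assert (G1 : forall c, c ∈ b -> app g c = rec c).
    { intros c Hc. unfold g. rewrite app_lam; [|exact HG|apply mem_suc; auto].
      apply iot_eq; [apply U|auto]. }
    assert (G2 : app g b = F (lam b rec)).
    { unfold g. rewrite app_lam; [|exact HG|apply mem_suc; auto].
      apply iot_eq; [apply U|auto]. }
    rewrite <- G2. apply (rec_attempt (a := suc b)); [apply ord_suc, Ob| |apply mem_suc; auto].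
    split; [apply lam_fun, HG|]. intros c Hc. rewrite res_lam. apply mem_suc in Hc.
    destruct Hc as [Hc| ->].
    - rewrite G1 by exact Hc. rewrite <- (@app_lam _ _ b c rec PDef_rec Hc), Hrec by exact Hc.
      f_equal. rewrite res_lam. apply lam_ext. intros d Hd.
      assert (d ∈ b) by (eapply ord_trans; eauto).
      rewrite G1, app_lam; auto using PDef_rec.
    - rewrite G2. f_equal. apply lam_ext. intros d Hd. symmetry; apply G1, Hd. }
  split; [apply lam_fun, PDef_rec|]. intros b Hb.
  rewrite app_lam, E by (auto using PDef_rec). f_equal. rewrite res_lam.
  apply lam_ext. intros c Hc. rewrite app_lam; auto using PDef_rec. eapply ord_trans; eauto.
Qed.

Lemma rec_eq (a : M) : is_ordinal a -> rec a = F (lam a rec).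
Proof.
  intros Ha. pose proof (attempt_ex (ord_suc Ha)) as H.
  assert (K : a ∈ suc a) by (apply mem_suc; auto).
  rewrite (rec_attempt (ord_suc Ha) H K), (proj2 H a K). f_equal.
  rewrite res_lam. apply lam_ext. intros c Hc. apply app_lam; [apply PDef_rec|].
  apply mem_suc; auto.
Qed.

End Recursion.
#[global] Hint Resolve D_res : defdb.

(** * The cumulative hierarchy, ranks and closure of limit stages *)

Section Hierarchy.
Context {M : set_model} {hZF : ZF M}.

Definition stage_step (f : M) : M :=
  iot (fun v => forall x, x ∈ v <-> exists c u, pr c u ∈ f /\ incl x u).

Lemma pr_un (f x y : M) : pr x y ∈ f -> x ∈ un (un f) /\ y ∈ un (un f).
Proof.
  intros H. assert (K : upair x y ∈ un f).
  { apply mem_un. exists (pr x y); split; [exact H|]. apply mem_upair; auto. }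
  split; apply mem_un; exists (upair x y); split; auto; apply mem_upair; auto.
Qed.

Lemma mem_stage_step (f x : M) : x ∈ stage_step f <-> exists c u, pr c u ∈ f /\ incl x u.
Proof.
  revert x. set (P := fun v : M => forall x, x ∈ v <-> exists c u, pr c u ∈ f /\ incl x u).
  assert (U : forall v v', P v -> P v' -> v = v').
  { intros v v' H H'; apply ext; intros x. rewrite (H x), (H' x); tauto. }
  (* Kuratowski pairs put the values of [f] in [un (un f)], so every subset of a value is a subset
     of [un (un (un f))]. *)
  assert (HP : P (sep (pow (un (un (un f)))) (fun x => exists c u, pr c u ∈ f /\ incl x u))).
  { intros x. rewrite mem_sep by solve_def. split; [tauto|]. intros (c & u & H & K).
    split; [|eauto]. apply mem_pow. intros z Hz. apply mem_un. exists u.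
    split; [apply (pr_un H)|auto]. }
  change (P (stage_step f)). unfold stage_step. fold P. rewrite (iot_eq U HP). exact HP.
Qed.

Lemma D_stage_step : Def (fun e : nat -> M => e 0 = stage_step (e 1)).
Proof.
  apply (d_ext (Q := fun e => forall x, x ∈ e 0 <-> exists c u, pr c u ∈ e 1 /\ incl x u)); [|solve_def].
  intros e; split; [intros ->; apply mem_stage_step|].
  intros H; apply ext; intros x. rewrite H, mem_stage_step; tauto.
Qed.
#[local] Hint Resolve D_stage_step : defdb.

(** Meaningful only when [a] is an ordinal. *)
Definition Vs (a : M) : M := rec stage_step a.

Lemma PDef_Vs : definable_map Vs.
Proof. apply PDef_rec. solve_def. Qed.
#[local] Hint Resolve PDef_Vs : defdb.

Lemma mem_Vs (a x : M) : is_ordinal a -> (x ∈ Vs a <-> exists c, c ∈ a /\ incl x (Vs c)).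
Proof.
  intros Ha. unfold Vs at 1. rewrite rec_eq; [|solve_def|exact Ha]. rewrite mem_stage_step.
  split.
  - intros (c & u & H & K). apply lam_pr in H; [|apply PDef_Vs]. destruct H as [H ->]. eauto.
  - intros (c & H & K). exists c, (Vs c). split; [|exact K].
    apply lam_pr; [apply PDef_Vs|]. auto.
Qed.

Lemma Vs_mono (a b : M) : is_ordinal a -> is_ordinal b -> incl a b -> incl (Vs a) (Vs b).
Proof.
  intros Ha Hb H x. rewrite !mem_Vs by assumption. intros (c & Hc & K); eauto.
Qed.

Lemma Vs_trans (a : M) : is_ordinal a -> is_transitive (Vs a).
Proof.
  revert a; ord_induct; [solve_def|]. intros a Ha IH x Hx y Hy.
  apply (mem_Vs x Ha) in Hx. destruct Hx as (c & Hc & K).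
  apply mem_Vs; [exact Ha|]. exists c; split; [exact Hc|]. apply (IH c Hc), K, Hy.
Qed.

Lemma Vs_sub (a x y : M) : is_ordinal a -> y ∈ Vs a -> incl x y -> x ∈ Vs a.
Proof.
  intros Ha. rewrite !mem_Vs by exact Ha. intros (c & Hc & K) H.
  exists c; split; [exact Hc|]. intros z Hz; auto.
Qed.

Lemma Vs_suc (a x : M) : is_ordinal a -> (x ∈ Vs (suc a) <-> incl x (Vs a)).
Proof.
  intros Ha. rewrite mem_Vs by (apply ord_suc, Ha). split.
  - intros (c & Hc & K). apply mem_suc in Hc. destruct Hc as [Hc| ->]; [|exact K].
    intros z Hz. apply (@Vs_mono c a); eauto using ord_in. apply ord_incl; eauto using ord_in.
  - intros K. exists a; split; [apply mem_suc; auto|exact K].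
Qed.

Lemma Vs_mem (a b : M) : is_ordinal b -> a ∈ b -> Vs a ∈ Vs b.
Proof.
  intros Hb H. apply mem_Vs; [exact Hb|]. exists a; split; [exact H|]. intros z; auto.
Qed.

Lemma ord_sub_Vs (a : M) : is_ordinal a -> incl a (Vs a).
Proof.
  revert a; ord_induct; [solve_def|]. intros a Ha IH b Hb.
  apply mem_Vs; [exact Ha|]. exists b; auto.
Qed.

Lemma is_VE (v a : M) : is_ordinal a -> (is_V v a <-> v = Vs a).
Proof.
  intros Ha. unfold is_V. split.
  - intros (f & s & Hs & Hf & H & Hv). apply is_succE in Hs; subst s.
    rewrite pair_inE in Hv. apply (fun_pair _ _ Hf) in Hv. destruct Hv as [_ ->].
    assert (K : forall b, is_ordinal b -> b ∈ suc a -> app f b = Vs b).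
    { ord_induct; [solve_def|]. intros b Hb IH Hba. apply ext; intros x.
      rewrite (H b (app f b)) by (apply pair_inE, (fun_app _ Hf Hba); reflexivity).
      rewrite mem_Vs by exact Hb. split.
      - intros (c & u & Hc & Hu & K). exists c; split; [exact Hc|].
        apply pair_inE, (fun_pair _ _ Hf) in Hu. destruct Hu as [Hca ->].
        rewrite <- IH; auto.
      - intros (c & Hc & K). exists c, (app f c).
        assert (Hca : c ∈ suc a) by exact (ord_trans (ord_suc Ha) Hba Hc).
        split; [exact Hc|]. split; [|rewrite IH; auto].
        apply pair_inE, (fun_app _ Hf Hca); reflexivity. }
    apply K; [exact Ha|apply mem_suc; auto].
  - intros ->. exists (lam (suc a) Vs), (suc a).
    split; [apply is_succE; reflexivity|]. split; [apply lam_fun, PDef_Vs|]. split.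
    + intros b u Hu x. apply pair_inE, lam_pr in Hu; [|apply PDef_Vs]. destruct Hu as [Hb ->].
      rewrite mem_Vs by exact (ord_in (ord_suc Ha) Hb).
      setoid_rewrite pair_inE. setoid_rewrite (fun c y => @lam_pr _ _ (suc a) c y Vs PDef_Vs).
      split.
      * intros (c & Hc & K). exists c, (Vs c). repeat split; auto.
        exact (ord_trans (ord_suc Ha) Hb Hc).
      * intros (c & y & Hc & [_ ->] & K); eauto.
    + apply pair_inE, lam_pr; [apply PDef_Vs|]. split; [apply mem_suc; auto|reflexivity].
Qed.

Lemma in_VE (a x : M) : is_ordinal a -> (in_V a x <-> x ∈ Vs a).
Proof.
  intros Ha. unfold in_V. setoid_rewrite (fun v => @is_VE v a Ha). split; [|eauto].
  intros (v & -> & H); exact H.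
Qed.

(** The transitive closure of [{x}]: [T n] consists of [x] and of the members of elements of earlier
    [T m], and the values at the natural numbers are united. *)
Lemma transitive_superset (x : M) : exists T, is_transitive T /\ x ∈ T.
Proof.
  set (P := fun (f z : M) => forall t, t ∈ z <-> t = x \/ exists c u w, pr c u ∈ f /\ w ∈ u /\ t ∈ w).
  assert (U : forall f z z', P f z -> P f z' -> z = z').
  { intros f z z' H H'; apply ext; intros t; rewrite (H t), (H' t); tauto. }
  assert (Ex : forall f, P f (iot (P f))).
  { intros f. assert (K : P f (cup (upair x x) (sep (un (un (un (un f))))
      (fun t => exists c u w, pr c u ∈ f /\ w ∈ u /\ t ∈ w)))).
    { intros t. rewrite mem_cup, mem_upair, mem_sep by solve_def.
      split; [tauto|]. intros [->|(c & u & w & H1 & H2 & H3)]; [auto|]. right.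
      split; [|exists c, u, w; auto]. apply mem_un; exists w; split; [|exact H3].
      apply mem_un; exists u; split; [apply (pr_un H1)|exact H2]. }
    rewrite (iot_eq (@U f) K); exact K. }
  assert (HF : PDef (fun e : nat -> M => e 0 = iot (P (e 1)))).
  { apply (@dt_iot _ _ _ _ (fun z e => P (e 0) z)); [intros e; apply U|unfold P; solve_def]. }
  set (T := rec (fun f => iot (P f))).
  assert (HT : forall n, n ∈ om -> P (lam n T) (T n)).
  { intros n Hn. unfold T at 2. rewrite rec_eq; [apply Ex|exact HF|].
    apply (ord_in ord_om Hn). }
  assert (DTT : definable_map T) by (apply PDef_rec, HF).
  exists (un (sep (un (un (lam om T))) (fun z => exists n, n ∈ om /\ z = T n))).
  assert (K : forall t, t ∈ un (sep (un (un (lam om T))) (fun z => exists n, n ∈ om /\ z = T n))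
    <-> exists n, n ∈ om /\ t ∈ T n).
  { intros t. rewrite mem_un. setoid_rewrite mem_sep; [|solve_def]. split.
    - intros (z & (_ & n & Hn & ->) & Ht); eauto.
    - intros (n & Hn & Ht). exists (T n); split; [|exact Ht]. split; [|eauto].
      apply (@pr_un _ n). apply lam_pr; auto. }
  split.
  - intros w Hw t Ht. rewrite K in *. destruct Hw as (n & Hn & Hw).
    exists (suc n); split; [apply om_suc, Hn|]. apply (HT _ (om_suc Hn)). right.
    exists n, (T n), w. split; [apply lam_pr; [exact DTT|]|auto].
    split; [apply mem_suc; auto|reflexivity].
  - rewrite K. exists emp; split; [apply om_emp|]. apply (HT _ om_emp). auto.
Qed.

(** The least stage containing a member is a single-valued function of it, so replacement bounds
    these stages. *)
Lemma stage_of_members (x : M) :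
  (forall y, y ∈ x -> exists a, is_ordinal a /\ y ∈ Vs a) -> exists a, is_ordinal a /\ x ∈ Vs a.
Proof.
  intros H.
  destruct (@rep_ex _ _ (fun y a => is_ordinal a /\ y ∈ Vs a /\ forall b, b ∈ a -> ~ y ∈ Vs b))
    with (a := x) as (s & Hs).
  - solve_def.
  - intros y Hy. destruct (@ord_least _ _ (fun a => y ∈ Vs a)) as (a & Ha & K & L);
      [solve_def|apply H, Hy|].
    exists a; split; [auto|]. intros b (Hb & Kb & Lb).
    destruct (ord_trichotomy Ha Hb) as [E|[E|E]]; [|exact E|].
    + exfalso; apply (Lb a E K).
    + exfalso; apply (L b E Kb).
  - destruct (@ord_bound _ _ s) as (b & Hb & K).
    { intros a Ha. apply Hs in Ha. destruct Ha as (y & _ & Ha & _); exact Ha. }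
    exists (suc b); split; [apply ord_suc, Hb|]. apply Vs_suc; [exact Hb|].
    intros y Hy. destruct (@ord_least _ _ (fun a => y ∈ Vs a)) as (a & Ha & Ka & L);
      [solve_def|apply H, Hy|].
    assert (a ∈ b) by (apply K, Hs; exists y; auto).
    apply (@Vs_mono a b); auto. apply ord_incl; auto.
Qed.

(** A membership-minimal set without a stage, found inside a transitive set, has only members with
    stages. *)
Lemma stage_ex (x : M) : exists a, is_ordinal a /\ x ∈ Vs a.
Proof.
  destruct (transitive_superset x) as (T & HT & Hx). apply NNPP; intros N.
  destruct (@ZF_foundation _ hZF (sep T (fun y => ~ exists a, is_ordinal a /\ y ∈ Vs a)))
    as (y & Hy & K).
  - exists x. rewrite mem_sep by solve_def. auto.
  - rewrite mem_sep in Hy by solve_def. destruct Hy as [Hy Ny]. apply Ny.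
    apply stage_of_members. intros z Hz. apply NNPP; intros Nz.
    apply (K z Hz). rewrite mem_sep by solve_def. split; [apply (HT y Hy z Hz)|exact Nz].
Qed.

(** Scott's trick: replacement needs one value for each [x], so it is given the least stage holding
    a suitable [y], not [y] itself. *)
Lemma collection (R : M -> M -> Prop) : PDef (fun e => R (e 0) (e 1)) ->
  forall a, (forall x, x ∈ a -> exists y, R x y) ->
  exists b, is_ordinal b /\ forall x, x ∈ a -> exists y, y ∈ Vs b /\ R x y.
Proof.
  intros HR a H.
  set (Q := fun x c => is_ordinal c /\ (exists y, y ∈ Vs c /\ R x y) /\
    forall b, b ∈ c -> ~ exists y, y ∈ Vs b /\ R x y).
  assert (Ex : forall x, x ∈ a -> exists c, Q x c).
  { intros x Hx. apply (@ord_least _ _ (fun c => exists y, y ∈ Vs c /\ R x y)); [solve_def|].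
    destruct (H x Hx) as (y & Hy). destruct (stage_ex y) as (c & Hc & K). eauto. }
  destruct (@rep_ex _ _ Q) with (a := a) as (s & Hs).
  - unfold Q; solve_def.
  - intros x Hx. destruct (Ex x Hx) as (c & Hc). exists c; split; [exact Hc|].
    intros d Hd. destruct Hc as (Oc & Kc & Lc), Hd as (Od & Kd & Ld).
    destruct (ord_trichotomy Oc Od) as [E|[E|E]]; [|exact E|]; exfalso; [apply (Ld c E Kc)|apply (Lc d E Kd)].
  - destruct (@ord_bound _ _ s) as (b & Hb & K).
    { intros c Hc. apply Hs in Hc. destruct Hc as (y & _ & Hc & _); exact Hc. }
    exists b; split; [exact Hb|]. intros x Hx. destruct (Ex x Hx) as (c & Hc).
    assert (Hcb : c ∈ b) by (apply K, Hs; eauto).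
    destruct Hc as (Oc & (y & Hy & Ry) & _). exists y; split; [|exact Ry].
    apply (@Vs_mono c b); auto. apply ord_incl; auto.
Qed.

Lemma limit_pr (l x y : M) : is_limit l -> x ∈ Vs l -> y ∈ Vs l -> pr x y ∈ Vs l.
Proof.
  intros (Hl & _ & HS).
  assert (K : forall x y, x ∈ Vs l -> y ∈ Vs l -> upair x y ∈ Vs l).
  { clear x y; intros x y Hx Hy. apply (mem_Vs _ Hl) in Hx; apply (mem_Vs _ Hl) in Hy.
    destruct Hx as (c & Hc & Hx), Hy as (d & Hd & Hy).
    pose proof (ord_in Hl Hc) as Oc; pose proof (ord_in Hl Hd) as Od.
    destruct (ord_max Oc Od) as (m & Om & Em & Ic & Id).
    assert (Hm : m ∈ l) by (destruct Em; subst; assumption).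
    apply mem_Vs; [exact Hl|]. exists (suc m); split; [auto|].
    intros z Hz; apply mem_upair in Hz. apply Vs_suc; [exact Om|].
    destruct Hz as [->| ->]; intros w Hw.
    - apply (@Vs_mono c m); auto.
    - apply (@Vs_mono d m); auto. }
  intros; unfold pr; auto.
Qed.

Lemma limit_pow (l x : M) : is_limit l -> x ∈ Vs l -> pow x ∈ Vs l.
Proof.
  intros (Hl & _ & HS) Hx. apply (mem_Vs _ Hl) in Hx. destruct Hx as (c & Hc & Hx).
  apply mem_Vs; [exact Hl|]. exists (suc c); split; [auto|].
  intros z Hz. apply mem_pow in Hz. apply Vs_suc; [apply (ord_in Hl Hc)|]. intros w Hw; auto.
Qed.

Lemma limit_Vs (l x : M) : is_limit l -> (x ∈ Vs l <-> exists c, c ∈ l /\ x ∈ Vs c).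
Proof.
  intros (Hl & _ & HS). split.
  - intros Hx. apply (mem_Vs _ Hl) in Hx. destruct Hx as (c & Hc & Hx).
    exists (suc c); split; [auto|]. apply Vs_suc; [apply (ord_in Hl Hc)|exact Hx].
  - intros (c & Hc & Hx). apply (@Vs_mono c l); eauto using ord_in.
    apply ord_incl; eauto using ord_in.
Qed.

Lemma limit_bound (l x y : M) : is_limit l -> x ∈ Vs l -> y ∈ Vs l ->
  exists c, c ∈ l /\ x ∈ Vs c /\ y ∈ Vs c.
Proof.
  intros Hl Hx Hy. pose proof (proj1 Hl) as Ol.
  apply (limit_Vs _ Hl) in Hx; apply (limit_Vs _ Hl) in Hy.
  destruct Hx as (c & Hc & Hx), Hy as (d & Hd & Hy).
  pose proof (ord_in Ol Hc) as Oc; pose proof (ord_in Ol Hd) as Od.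
  destruct (ord_max Oc Od) as (m & Om & Em & Ic & Id).
  exists m; split; [destruct Em; subst; assumption|].
  split; [apply (@Vs_mono c m)|apply (@Vs_mono d m)]; auto.
Qed.

End Hierarchy.
#[global] Hint Resolve PDef_Vs : defdb.

(** * The reflection theorem *)

Section Relativization.
Context {M : set_model}.

(** Domain and relation are arbitrary so that one definition covers relativization to a stage and
    truth in the reduct of a structure to one binary symbol. *)
Fixpoint tru (D : M -> Prop) (E : M -> M -> Prop) (e : nat -> M) (p : fm) : Prop :=
  match p with
  | FMem i j => E (e i) (e j)
  | FEq i j => e i = e j
  | FNeg p => ~ tru D E e p
  | FAnd p q => tru D E e p /\ tru D E e q
  | FOr p q => tru D E e p \/ tru D E e q
  | FImp p q => tru D E e p -> tru D E e q
  | FAll p => forall x, D x -> tru D E (scons x e) p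
  | FEx p => exists x, D x /\ tru D E (scons x e) p
  end.

Definition holds_in (v : M) : (nat -> M) -> fm -> Prop := tru (fun x => x ∈ v) (@mem M).

Definition reflects (v : M) (p : fm) : Prop :=
  forall e : nat -> M, (forall n, e n ∈ v) -> (holds_in v e p <-> holds e p).

Lemma tru_free_below D E (p : fm) : forall k (e e' : nat -> M),
  free_below k p -> (forall n, n < k -> e n = e' n) -> (tru D E e p <-> tru D E e' p).
Proof.
  induction p; simpl; intros k e e' H Eq.
  1-2: rewrite !Eq by tauto; tauto.
  1: rewrite (IHp k e e'); tauto.
  1-3: rewrite (IHp1 k e e'), (IHp2 k e e'); tauto.
  all: assert (K : forall x, tru D E (scons x e) p <-> tru D E (scons x e') p);
    [intros x; apply (IHp (S k)); [assumption|]; intros [|n] Hn; simpl; [reflexivity|];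
     apply Eq; lia|].
  - split; intros J x Hx; apply K; auto.
  - split; intros (x & Hx & J); exists x; split; auto; apply K; auto.
Qed.

Lemma d_holds_in (D : ((nat -> M) -> Prop) -> Prop) {HD : definability D} p :
  D (fun e => holds_in (e 0) (fun n => e (S n)) p).
Proof.
  unfold holds_in.
  (* The index [i] of the stage and the renaming [r] are generalized because each quantifier pushes
     the stage one place further. *)
  assert (K : forall p i (r : nat -> nat),
    D (fun e => tru (fun x => x ∈ e i) (@mem M) (fun n => e (r n)) p)).
  { clear p; induction p; simpl; intros u r.
    - solve_def.
    - solve_def.
    - apply d_not, IHp.
    - apply d_and; auto.
    - apply d_or; auto.
    - apply d_imp; auto.
    - apply d_all, d_imp; [solve_def|].
      refine (d_ext _ (IHp (S u) (fun n => match n with 0 => 0 | S n' => S (r n') end))).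
      intros e. rewrite <- (scons_ren (e 0) (fun n => e (S n)) r).
      same_env; intros [|n]; reflexivity.
    - apply d_ex, d_and; [solve_def|].
      refine (d_ext _ (IHp (S u) (fun n => match n with 0 => 0 | S n' => S (r n') end))).
      intros e. rewrite <- (scons_ren (e 0) (fun n => e (S n)) r).
      same_env; intros [|n]; reflexivity. }
  apply K.
Qed.

(** A formula cannot quantify over a whole environment; only the finitely many entries that matter
    are quantified. *)
Fixpoint allk (k : nat) (v : M) (P : (nat -> M) -> Prop) (e : nat -> M) : Prop :=
  match k with
  | O => P e
  | S k' => forall x, x ∈ v -> allk k' v P (scons x e)
  end.

Definition patch (k : nat) (f e : nat -> M) (n : nat) : M :=
  if Nat.ltb n k then f n else e (n - k).

Lemma patch_scons k (f e : nat -> M) : patch k f (scons (f k) e) = patch (S k) f e.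
Proof.
  apply functional_extensionality; intros n; unfold patch.
  destruct (Nat.ltb_spec n k), (Nat.ltb_spec n (S k)); try lia; try reflexivity.
  - replace n with k by lia. rewrite Nat.sub_diag; reflexivity.
  - replace (n - k) with (S (n - S k)) by lia. reflexivity.
Qed.

Lemma patch_ext k (f g e : nat -> M) : (forall n, n < k -> f n = g n) -> patch k f e = patch k g e.
Proof.
  intros H; apply functional_extensionality; intros n; unfold patch.
  destruct (Nat.ltb_spec n k); auto.
Qed.

Lemma allkE k v P (e : nat -> M) : allk k v P e <->
  forall f, (forall n, n < k -> f n ∈ v) -> P (patch k f e).
Proof.
  revert e; induction k; intros e; simpl.
  - assert (K : forall f, patch 0 f e = e).
    { intros f; apply functional_extensionality; intros n; unfold patch; simpl.
      rewrite Nat.sub_0_r; reflexivity. }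
    split; [intros H f _; rewrite K; exact H|].
    intros H. rewrite <- (K e). apply H; lia.
  - split.
    + intros H f Hf. rewrite <- patch_scons. apply IHk; auto.
    + intros H x Hx. apply IHk. intros f Hf.
      set (g := fun n => if Nat.ltb n k then f n else x).
      assert (E : g k = x) by (unfold g; rewrite Nat.ltb_irrefl; reflexivity).
      rewrite (patch_ext (g := g)).
      * rewrite <- E, patch_scons. apply H. intros n Hn. unfold g.
        destruct (Nat.ltb_spec n k); auto.
      * intros n Hn. unfold g. destruct (Nat.ltb_spec n k); [reflexivity|lia].
Qed.

Lemma d_allk (D : ((nat -> M) -> Prop) -> Prop) {HD : definability D} k P :
  D (fun e => P (e 0) (fun n => e (S n))) ->
  D (fun e => allk k (e 0) (P (e 1)) (fun n => e (S (S n)))).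
Proof.
  intros HP. induction k; simpl.
  - apply (d_ren S HP).
  - apply d_all, d_imp; [solve_def|].
    refine (d_ext _ (@d_ren _ _ _ _
      (fun n => match n with 0 => 1 | 1 => 2 | 2 => 0 | n => n end) IHk)).
    intros e; simpl.
    same_env; intros [|n]; reflexivity.
Qed.

Lemma d_holds (D : ((nat -> M) -> Prop) -> Prop) {HD : definability D} p :
  D (fun e : nat -> M => holds e p).
Proof.
  induction p; simpl; try solve_def.
  - apply d_not; auto.
  - apply d_and; auto.
  - apply d_or; auto.
  - apply d_imp; auto.
  - apply d_all. refine (d_ext _ IHp). intros e; rewrite scons_eta; tauto.
  - apply d_ex. refine (d_ext _ IHp). intros e; rewrite scons_eta; tauto.
Qed.

(** The right-hand side is expressible by one formula, which the definition of [reflects] does not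
    show. The tail of the environment is constantly [v], so the stage itself is read at index [k],
    just behind the [k] quantified values. *)
Lemma reflects_allk v p k : free_below k p ->
  (reflects v p <-> ((exists a, a ∈ v) ->
    allk k v (fun e => holds_in (e k) e p <-> holds e p) (fun _ => v))).
Proof.
  intros Hk. rewrite allkE.
  assert (Ev : forall f, patch k f (fun _ => v) k = v).
  { intros f; unfold patch. rewrite Nat.ltb_irrefl; reflexivity. }
  assert (K : forall f a n, n < k -> (if Nat.ltb n k then f n else a) = patch k f (fun _ => v) n).
  { intros f a n Hn; unfold patch. destruct (Nat.ltb_spec n k); [reflexivity|lia]. }
  split.
  - intros H [a Ha] f Hf. rewrite Ev.
    (* An element of [v] fills the positions from [k] on, as [reflects] wants every entry in [v]. *)
    set (g := fun n => if Nat.ltb n k then f n else a).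
    unfold holds_in. rewrite <- (tru_free_below _ _ Hk (K f a)).
    rewrite <- (holds_free_below Hk (K f a)).
    apply H. intros n; destruct (Nat.ltb_spec n k); auto.
  - intros H e He. specialize (H (ex_intro _ (e 0) (He 0)) e (fun n _ => He n)).
    rewrite Ev in H. unfold holds_in in *.
    assert (J : forall n, n < k -> e n = patch k e (fun _ => v) n).
    { intros n Hn; unfold patch. destruct (Nat.ltb_spec n k); [reflexivity|lia]. }
    rewrite (tru_free_below _ _ Hk J), (holds_free_below Hk J). exact H.
Qed.

Lemma d_reflects (D : ((nat -> M) -> Prop) -> Prop) {HD : definability D} p :
  D (fun e => reflects (e 0) p).
Proof.
  destruct (free_below_ex p) as [k Hk].
  apply (d_ext (fun e => reflects_allk (e 0) Hk)). apply d_imp; [solve_def|].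
  set (P := fun (_ : M) e => holds_in (e k) e p <-> holds e p).
  apply (@d_ren _ _ _ (fun e => allk k (e 0) (P (e 1)) (fun n => e (S (S n)))) (fun _ => 0)).
  apply (@d_allk D HD k P). unfold P. cbn beta. apply d_iff.
  - exact (d_ren (fun n => match n with 0 => S k | n => n end) (d_holds_in p)).
  - exact (d_ren S (d_holds p)).
Qed.

Lemma D_reflects p : Def (fun e => reflects (e 0) p).
Proof. apply (d_reflects (D := @Def M) p). Qed.

End Relativization.
#[global] Hint Resolve D_reflects : defdb.

(** * Reflection of finitely many formulas at a limit stage *)

Section Reflection.
Context {M : set_model} {hZF : ZF M}.

Lemma ord_mem_Vs (a b : M) : is_ordinal a -> is_ordinal b -> a ∈ Vs b -> a ∈ b.
Proof.
  intros Ha Hb; revert a Ha.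
  assert (N : forall c : M, is_ordinal c -> ~ c ∈ Vs c).
  { ord_induct; [solve_def|]. intros c Hc IH K. apply (mem_Vs _ Hc) in K.
    destruct K as (d & Hd & K). apply (IH d Hd), K, Hd. }
  intros a Ha K. destruct (ord_trichotomy Ha Hb) as [H|[->|H]]; [exact H| |].
  - destruct (N b Hb K).
  - destruct (N b Hb). apply (Vs_trans Hb K H).
Qed.

Lemma collection_ord (R : M -> M -> Prop) : PDef (fun e => R (e 0) (e 1)) ->
  forall a, (forall x, x ∈ a -> exists y, is_ordinal y /\ R x y) ->
  exists b, is_ordinal b /\ forall x, x ∈ a -> exists y, y ∈ b /\ R x y.
Proof.
  intros HR a H. destruct (@collection _ _ (fun x y => is_ordinal y /\ R x y)) with (a := a)
    as (b & Hb & K); [solve_def|exact H|].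
  exists b; split; [exact Hb|]. intros x Hx. destruct (K x Hx) as (y & Hy & Oy & Ry).
  exists y; split; [|exact Ry]. apply ord_mem_Vs; assumption.
Qed.

Lemma Def_PDef2 F (e' : nat -> M) : Def F -> PDef (fun e => F (scons (e 0) (scons (e 1) e'))).
Proof.
  intros [p Hp]. refine (d_ext _ (PDef_holds p e' 2)). intros e. rewrite <- Hp.
  same_env; intros [|[|n]]; simpl; rewrite ?Nat.sub_0_r; reflexivity.
Qed.

Lemma Def_PDef3 F (e' : nat -> M) : Def F ->
  PDef (fun e => F (scons (e 0) (scons (e 1) (scons (e 2) e')))).
Proof.
  intros [p Hp]. refine (d_ext _ (PDef_holds p e' 3)). intros e. rewrite <- Hp.
  same_env; intros [|[|[|n]]]; simpl; rewrite ?Nat.sub_0_r; reflexivity.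
Qed.

Definition witnessed (p : fm) (w : M) (f : nat -> M) : Prop :=
  (exists y, holds (scons y f) p) -> exists y, y ∈ w /\ holds (scons y f) p.

Lemma Def_allk_witnessed k p :
  Def (fun e : nat -> M => allk k (e 0) (witnessed p (e 1)) (fun n => e (S (S n)))).
Proof.
  apply (d_allk (D := @Def M) k (P := witnessed p)). unfold witnessed. cbn beta. apply d_imp.
  - apply d_ex. refine (d_ext _ (d_ren (fun n => match n with 0 => 0 | n => S n end) (d_holds p))).
    intros e; simpl.
    same_env; intros [|n]; reflexivity.
  - apply d_ex, d_and; [solve_def|].
    refine (d_ext _ (d_ren (fun n => match n with 0 => 0 | n => S n end) (d_holds p))).
    intros e; simpl.
    same_env; intros [|n]; reflexivity.
Qed.

(** One variable is collected at a time: for each value of the outermost one the induction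
    hypothesis gives a bound, and a bound of these bounds works since [witnessed] survives enlarging
    the stage. *)
Lemma collection_allk p k (a : M) :
  forall e, exists b, is_ordinal b /\ allk k a (witnessed p (Vs b)) e.
Proof.
  assert (Mono : forall b c f, is_ordinal c -> b ∈ c -> witnessed p (Vs b) f ->
    witnessed p (Vs c) f).
  { intros b c f Hc Hbc H Hf. destruct (H Hf) as (y & Hy & K).
    exists y; split; [|exact K]. apply (@Vs_mono _ _ b c); eauto using ord_in.
    apply ord_incl; eauto using ord_in. }
  induction k; intros e; simpl.
  - unfold witnessed. destruct (classic (exists y, holds (scons y e) p)) as [[y Hy]|N].
    + destruct (stage_ex y) as (b & Hb & K). exists b; split; [exact Hb|eauto].
    + exists emp; split; [apply ord_emp|tauto].
  - set (R := fun v w x => allk k v (witnessed p w) (scons x e)).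
    assert (DR : PDef (fun e : nat -> M => R (e 0) (e 1) (e 2))).
    { exact (@Def_PDef3 (fun e => allk k (e 0) (witnessed p (e 1)) (fun n => e (S (S n)))) e
        (Def_allk_witnessed k p)). }
    destruct (@collection_ord (fun x b => R a (Vs b) x)) with (a := a) as (b & Hb & K).
    + apply (@d_app3 _ _ _ R); [exact DR|dterm|dterm|dterm].
    + intros x _. apply IHk.
    + exists b; split; [exact Hb|]. intros x Hx. destruct (K x Hx) as (c & Hc & Hxc).
      unfold R in Hxc. rewrite allkE in *. intros f Hf. apply (@Mono c); auto.
Qed.

(** Below, [R a b] says that [V_b] contains the witnesses needed for parameters in [V_a]. *)
Definition closed_under (R : M -> M -> Prop) (l : M) : Prop :=
  forall a, a ∈ l -> exists b, b ∈ l /\ R a b.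

Lemma env_bound l (e : nat -> M) : is_limit l -> (forall n, e n ∈ Vs l) ->
  forall k, exists a, a ∈ l /\ forall n, n < k -> e n ∈ Vs a.
Proof.
  intros Hl He k. pose proof (proj1 Hl) as Ol. induction k as [|k (a & Ha & K)].
  - exists emp; split; [apply Hl|lia].
  - destruct (proj1 (limit_Vs _ Hl) (He k)) as (b & Hb & Kb).
    destruct (ord_max (ord_in Ol Ha) (ord_in Ol Hb)) as (m & Om & Em & Ia & Ib).
    exists m; split; [destruct Em; subst; assumption|].
    intros n Hn. destruct (Nat.eq_dec n k) as [->|].
    + apply (@Vs_mono _ _ b m); eauto using ord_in.
    + apply (@Vs_mono _ _ a m); eauto using ord_in. apply K; lia.
Qed.

Definition bounding (R : M -> M -> Prop) : Prop :=
  PDef (fun e => R (e 0) (e 1)) /\ forall a, is_ordinal a -> exists b, is_ordinal b /\ R a b.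

(** Both witnesses are only asked to be at most [b], so closure under [T] gives closure under [R]
    and under [S] although the two witnesses may differ. *)
Lemma bounding_and R S : bounding R -> bounding S ->
  exists T, bounding T /\
    forall l, is_ordinal l -> closed_under T l -> closed_under R l /\ closed_under S l.
Proof.
  intros [DR HR] [DS HS].
  exists (fun a b => exists c d, c ∈ suc b /\ d ∈ suc b /\ R a c /\ S a d). split; [split|].
  - solve_def.
  - intros a Ha. destruct (HR a Ha) as (c & Hc & Kc), (HS a Ha) as (d & Hd & Kd).
    destruct (ord_max Hc Hd) as (b & Hb & _ & Ic & Id). exists b; split; [exact Hb|].
    exists c, d. rewrite !mem_suc. repeat split; auto; apply ord_incl; auto.
  - intros l Hl H.
    assert (K : forall b c, b ∈ l -> c ∈ suc b -> c ∈ l).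
    { intros b c Hb Hc. apply mem_suc in Hc. destruct Hc as [Hc| ->]; [|exact Hb].
      apply (ord_trans Hl Hb Hc). }
    split; intros a Ha; destruct (H a Ha) as (b & Hb & c & d & Hc & Hd & H1 & H2); eauto.
Qed.

Lemma bounding_witness p : exists R, bounding R /\
  forall l, is_limit l -> closed_under R l -> forall e : nat -> M, (forall n, e n ∈ Vs l) ->
    (exists y, holds (scons y e) p) -> exists y, y ∈ Vs l /\ holds (scons y e) p.
Proof.
  destruct (free_below_ex p) as [k Hk].
  set (R := fun v w => allk k v (witnessed p w) (fun _ => emp)).
  exists (fun a b => R (Vs a) (Vs b)). split; [split|].
  - assert (DR : PDef (fun e => R (e 0) (e 1))).
    { exact (@Def_PDef2 (fun e => allk k (e 0) (witnessed p (e 1)) (fun n => e (S (S n))))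
        (fun _ => emp) (Def_allk_witnessed k p)). }
    solve_def.
  - intros a _. apply collection_allk.
  - intros l Hl HR e He (y & Hy). destruct (env_bound Hl He k) as (a & Ha & Ka).
    destruct (HR a Ha) as (b & Hb & Kb). unfold R in Kb. rewrite allkE in Kb.
    specialize (Kb e Ka).
    assert (E : forall y n, n < k -> scons y e n = scons y (patch k e (fun _ => emp)) n).
    { intros z [|n] Hn; simpl; [reflexivity|]. unfold patch.
      destruct (Nat.ltb_spec n k); [reflexivity|lia]. }
    destruct Kb as (z & Hz & Kz).
    { exists y. rewrite <- (holds_free_below Hk (E y)). exact Hy. }
    exists z; split.
    + apply (limit_Vs _ Hl). eauto.
    + rewrite (holds_free_below Hk (E z)). exact Kz.
Qed.

(** Induction on the formula in the manner of Tarski and Vaught: a quantifier adds the demand that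
    witnesses, or counterexamples for [FAll], occur in [V_l]. *)
Lemma bounding_reflects p : exists R, bounding R /\
  forall l : M, is_limit l -> closed_under R l -> reflects (Vs l) p.
Proof.
  assert (B0 : bounding (fun a b : M => True)).
  { split; [solve_def|]. intros a Ha; exists a; auto. }
  unfold reflects, holds_in. induction p; simpl.
  1,2: exists (fun _ _ => True); split; [exact B0|tauto].
  1: destruct IHp as (R & HR & K); exists R; split; [exact HR|]; intros l Hl Cl e He;
    rewrite K by auto; tauto.
  1-3: destruct IHp1 as (R1 & HR1 & K1), IHp2 as (R2 & HR2 & K2);
    destruct (bounding_and HR1 HR2) as (T & HT & J); exists T; split; [exact HT|];
    intros l Hl Cl e He; destruct (J l (proj1 Hl) Cl); rewrite K1, K2 by auto; tauto.
  - destruct IHp as (R1 & HR1 & K1), (bounding_witness (FNeg p)) as (R2 & HR2 & K2).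
    destruct (bounding_and HR1 HR2) as (T & HT & J). exists T; split; [exact HT|].
    intros l Hl Cl e He. destruct (J l (proj1 Hl) Cl) as [C1 C2].
    assert (He' : forall x, x ∈ Vs l -> forall n, scons x e n ∈ Vs l).
    { intros x Hx [|n]; simpl; auto. }
    split.
    + intros H x. apply NNPP; intros N. destruct (K2 l Hl C2 e He) as (y & Hy & Ny); [eauto|].
      apply Ny, (K1 l Hl C1); auto.
    + intros H x Hx. apply (K1 l Hl C1); auto.
  - destruct IHp as (R1 & HR1 & K1), (bounding_witness p) as (R2 & HR2 & K2).
    destruct (bounding_and HR1 HR2) as (T & HT & J). exists T; split; [exact HT|].
    intros l Hl Cl e He. destruct (J l (proj1 Hl) Cl) as [C1 C2].
    assert (He' : forall x, x ∈ Vs l -> forall n, scons x e n ∈ Vs l).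
    { intros x Hx [|n]; simpl; auto. }
    split.
    + intros (x & Hx & H). exists x. apply (K1 l Hl C1); auto.
    + intros H. destruct (K2 l Hl C2 e He H) as (y & Hy & Ky). exists y; split; [exact Hy|].
      apply (K1 l Hl C1); auto.
Qed.

Lemma limit_closed_under R a0 : bounding R -> is_ordinal a0 ->
  exists l, is_limit l /\ a0 ∈ l /\ closed_under R l.
Proof.
  intros [DR HR] H0.
  (* [B f z]: the ordinal [z] exceeds [a0] and every value of [f], and contains an [R]-witness for
     each ordinal up to such a value. [T n] is the least such [z] for the values before [n]; the
     supremum over the natural numbers is the desired limit. *)
  set (B := fun f z => is_ordinal z /\ a0 ∈ z /\ forall c u, pr c u ∈ f ->
    u ∈ z /\ forall a, a ∈ suc u -> exists b, b ∈ z /\ R a b).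
  assert (DB : PDef (fun e => B (e 0) (e 1))) by (unfold B; solve_def).
  set (F := fun f => iot (fun z => B f z /\ forall z', z' ∈ z -> ~ B f z')).
  assert (U : forall f z z', (B f z /\ forall z', z' ∈ z -> ~ B f z') ->
    (B f z' /\ forall z'', z'' ∈ z' -> ~ B f z'') -> z = z').
  { intros f z z' [H1 H2] [H3 H4].
    destruct (ord_trichotomy (proj1 H1) (proj1 H3)) as [E|[E|E]]; [|exact E|]; exfalso.
    - exact (H4 z E H1).
    - exact (H2 z' E H3). }
  assert (HF : definable_map F).
  { apply (@dt_iot _ _ _ _ (fun z e => B (e 0) z /\ forall z', z' ∈ z -> ~ B (e 0) z'));
      [intros e; apply U|solve_def]. }
  set (T := rec F).
  assert (DTT : definable_map T) by (apply PDef_rec, HF).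
  assert (HB : forall f, (forall c u, pr c u ∈ f -> is_ordinal u) -> B f (F f)).
  { intros f Hf.
    set (X := sep (cup (un (un (un f))) (un (un f))) (fun a => exists c u, pr c u ∈ f /\ a ∈ suc u)).
    assert (HX : forall a, a ∈ X <-> exists c u, pr c u ∈ f /\ a ∈ suc u).
    { intros a. unfold X. rewrite mem_sep by solve_def. split; [tauto|]. intros (c & u & Hu & Ha).
      split; [|eauto]. apply mem_cup. destruct (pr_un Hu) as [_ K]. apply mem_suc in Ha.
      destruct Ha as [Ha| ->]; [left|right; exact K]. apply mem_un; eauto. }
    assert (OX : forall a, a ∈ X -> is_ordinal a).
    { intros a Ha. apply HX in Ha. destruct Ha as (c & u & Hu & Ha).
      apply (ord_in (ord_suc (Hf c u Hu)) Ha). }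
    destruct (@collection_ord R DR X) as (b & Hb & K); [auto|].
    destruct (ord_bound OX) as (d & Hd & L).
    destruct (ord_max Hb Hd) as (m & Om & _ & Ib & Id).
    destruct (ord_max Om (ord_suc H0)) as (z & Oz & _ & Im & I0).
    assert (Bz : B f z).
    { split; [exact Oz|]. split; [apply I0, mem_suc; auto|]. intros c u Hu. split.
      - apply Im, Id, L, HX. exists c, u; rewrite mem_suc; auto.
      - intros a Ha. destruct (K a) as (y & Hy & Ry); [apply HX; eauto|]. eauto. }
    destruct (@ord_least _ _ (B f)) as (y & Oy & By & Ly); [solve_def|eauto|].
    unfold F. rewrite (iot_eq (y := y)); [exact By|apply U|auto]. }
  assert (HT : forall n, is_ordinal n -> B (lam n T) (T n)).
  { apply (@ord_ind _ _ (fun n => B (lam n T) (T n))).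
    - apply (d_ext (Q := fun e => exists f, (forall p, p ∈ f <-> exists x, x ∈ e 0 /\ p = pr x (T x))
        /\ B f (T (e 0)))); [|solve_def].
      intros e; split.
      + intros H; exists (lam (e 0) T); split; [apply mem_lam, DTT|exact H].
      + intros (f & Hf & H). replace (lam (e 0) T) with f; [exact H|].
        apply ext; intros p; rewrite Hf, (mem_lam _ DTT); tauto.
    - intros n Hn IH. unfold T at 2. rewrite rec_eq by assumption. apply HB.
      intros c u Hu. apply lam_pr in Hu; [|exact DTT]. destruct Hu as [Hc ->]. exact (proj1 (IH c Hc)). }
  assert (HS : forall n, n ∈ om -> T n ∈ T (suc n) /\
    forall a, a ∈ suc (T n) -> exists b, b ∈ T (suc n) /\ R a b).
  { intros n Hn. apply (HT (suc n) (ord_suc (ord_in ord_om Hn))) with (c := n).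
    apply lam_pr; [exact DTT|]. split; [apply mem_suc; auto|reflexivity]. }
  assert (OT : forall n, n ∈ om -> is_ordinal (T n)).
  { intros n Hn. apply (HT n), (ord_in ord_om Hn). }
  set (S := sep (un (un (lam om T))) (fun z => exists n, n ∈ om /\ z = T n)).
  assert (K : forall z, z ∈ S <-> exists n, n ∈ om /\ z = T n).
  { intros z. unfold S. rewrite mem_sep by solve_def. split; [tauto|]. intros (n & Hn & ->).
    split; [|eauto]. apply (@pr_un _ _ _ n). apply lam_pr; auto. }
  assert (Kl : forall a, a ∈ un S <-> exists n, n ∈ om /\ a ∈ T n).
  { intros a. rewrite mem_un. setoid_rewrite K. split.
    - intros (z & (n & Hn & ->) & Ha); eauto.
    - intros (n & Hn & Ha); eauto. }
  exists (un S). split; [split; [|split]|split].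
  - apply ord_un. intros z Hz. apply K in Hz. destruct Hz as (n & Hn & ->); auto.
  - apply Kl. exists (suc emp); split; [apply om_suc, om_emp|].
    apply (ord_not_mem (a := T (suc emp)) (b := suc emp)); try apply mem_suc; auto.
    all: auto using ord_suc, ord_emp, om_suc, om_emp.
    intros H. apply mem_suc in H. rewrite mem_emp in H. destruct H as [[]|H].
    destruct (HS emp om_emp) as [J _]. rewrite H in J. apply mem_emp in J. exact J.
  - intros a Ha. apply Kl in Ha. destruct Ha as (n & Hn & Ha). apply Kl.
    exists (suc n); split; [auto using om_suc|]. destruct (HS n Hn) as [J _].
    destruct (ord_suc_mem (ord_in (OT n Hn) Ha) (OT n Hn) Ha) as [E|E].
    + apply (ord_trans (OT _ (om_suc Hn)) J E).
    + rewrite E; exact J.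
  - apply Kl. exists emp; split; [apply om_emp|]. apply (HT emp ord_emp).
  - intros a Ha. apply Kl in Ha. destruct Ha as (n & Hn & Ha).
    destruct (proj2 (HS n Hn) a) as (b & Hb & Rb); [apply mem_suc; auto|].
    exists b; split; [|exact Rb]. apply Kl. eauto using om_suc.
Qed.

Theorem reflection (ps : list fm) (x : M) :
  exists l, is_limit l /\ om ∈ l /\ x ∈ Vs l /\ Forall (reflects (Vs l)) ps.
Proof.
  assert (K : exists R, bounding R /\
    forall l, is_limit l -> closed_under R l -> Forall (reflects (Vs l)) ps).
  { induction ps as [|p ps (R & HR & K)].
    - exists (fun _ _ => True). split; [split; [solve_def|intros a Ha; exists a; auto]|auto].
    - destruct (bounding_reflects p) as (S & HS & J).
      destruct (bounding_and HR HS) as (T & HT & L). exists T; split; [exact HT|].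
      intros l Hl Cl. destruct (L l (proj1 Hl) Cl). constructor; auto. }
  destruct K as (R & HR & K). destruct (stage_ex x) as (a & Ha & Hx).
  destruct (ord_max Ha ord_om) as (b & Hb & _ & Ia & Io).
  destruct (limit_closed_under HR Hb) as (l & Hl & Hbl & Cl).
  exists l. split; [exact Hl|]. split; [|split; [|apply K; assumption]].
  - destruct (proj1 (ord_incl ord_om Hb) Io) as [E| ->]; [|exact Hbl].
    apply (ord_trans (proj1 Hl) Hbl E).
  - apply (limit_Vs _ Hl). exists b; split; [exact Hbl|]. apply (@Vs_mono _ _ a b); auto.
Qed.

End Reflection.

(** * Terms and formulas of the model *)

Section Syntax.
Context {M : set_model} {hZF : ZF M}.

Lemma om_sub_limit (l : M) : is_limit l -> incl om (Vs l).
Proof.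
  intros Hl n Hn. apply (ord_sub_Vs (proj1 Hl)). destruct (limit_om_le Hl) as [H|H].
  - apply (ord_trans (proj1 Hl) H Hn).
  - rewrite <- H; exact Hn.
Qed.

Lemma pr_pow (w x y : M) : x ∈ w -> y ∈ w -> pr x y ∈ pow (pow w).
Proof.
  intros Hx Hy. apply mem_pow. intros z Hz. apply mem_pow. intros t Ht.
  unfold pr in Hz. apply mem_upair in Hz.
  destruct Hz as [->| ->]; apply mem_upair in Ht; destruct Ht; subst; assumption.
Qed.

Lemma pr_trans (w x y : M) : is_transitive w -> pr x y ∈ w -> x ∈ w /\ y ∈ w.
Proof.
  intros Hw H. assert (K : upair x y ∈ w) by (apply (Hw _ H), mem_upair; auto).
  split; apply (Hw _ K), mem_upair; auto.
Qed.

Lemma limit_fun (l f a b : M) : is_limit l -> is_map f a b -> a ∈ Vs l -> b ∈ Vs l -> f ∈ Vs l.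
Proof.
  intros Hl Hf Ha Hb. apply is_mapE in Hf. destruct Hf as [Hf Kf].
  destruct (limit_bound Hl Ha Hb) as (c & Hc & Ka & Kb).
  pose proof (ord_in (proj1 Hl) Hc) as Oc.
  apply (Vs_sub (proj1 Hl) (y := pow (pow (Vs c)))).
  - do 2 apply (limit_pow Hl). apply Vs_mem; [apply Hl|exact Hc].
  - intros p Hp. apply (fun_mem _ Hf) in Hp. destruct Hp as (x & Hx & ->).
    apply pr_pow; [apply (Vs_trans Oc Ka Hx)|apply (Vs_trans Oc Kb (Kf x Hx))].
Qed.

(** Induction on the length inside [M]: finitely many ranks below a limit have a bound below it,
    whatever its cofinality. *)
Lemma limit_finite_seq (l ts n : M) : is_limit l -> n ∈ om -> is_map ts n (Vs l) -> ts ∈ Vs l.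
Proof.
  intros Hl Hn H. apply is_mapE in H. destruct H as [Hf K].
  assert (B : forall n, n ∈ om -> (forall i, i ∈ n -> app ts i ∈ Vs l) ->
    exists c, c ∈ l /\ forall i, i ∈ n -> app ts i ∈ Vs c).
  { om_induct; [solve_def| |].
    - intros _. exists emp; split; [apply Hl|]. intros i Hi; apply mem_emp in Hi; tauto.
    - clear n Hn K Hf. intros n Hn IH K. destruct IH as (c & Hc & Kc).
      { intros i Hi; apply K, mem_suc; auto. }
      destruct (proj1 (limit_Vs _ Hl) (K n (proj2 (mem_suc n n) (or_intror eq_refl))))
        as (d & Hd & Kd).
      destruct (ord_max (ord_in (proj1 Hl) Hc) (ord_in (proj1 Hl) Hd)) as (m & Om & Em & Ic & Id).
      exists m; split; [destruct Em; subst; assumption|].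
      intros i Hi; apply mem_suc in Hi. destruct Hi as [Hi| ->].
      + apply (@Vs_mono _ _ c m); eauto using ord_in. exact (ord_in (proj1 Hl) Hc).
      + apply (@Vs_mono _ _ d m); eauto using ord_in. exact (ord_in (proj1 Hl) Hd). }
  destruct (B n Hn K) as (c & Hc & Kc).
  apply (@limit_fun l ts n (Vs c) Hl).
  - apply is_mapE; auto.
  - apply (om_sub_limit Hl), Hn.
  - apply Vs_mem; [apply Hl|exact Hc].
Qed.

Definition tvar (n : M) : M := pr (num 0) n.
Definition tapp (f ts : M) : M := pr (num 1) (pr f ts).
Definition feq (t u : M) : M := pr (num 0) (pr t u).
Definition frel (r ts : M) : M := pr (num 1) (pr r ts).
Definition fneg (p : M) : M := pr (num 2) p.
Definition fand (p q : M) : M := pr (num 3) (pr p q).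
Definition fex (n p : M) : M := pr (num 4) (pr n p).

Variable tau : M.

Lemma rel_symbolE s n : rel_symbol tau s n <-> n ∈ om /\ pr s (pr (num 0) n) ∈ tau.
Proof.
  unfold rel_symbol. rewrite is_natE. setoid_rewrite pair_inE. setoid_rewrite is_taggedE.
  split; [intros (H & v & K & ->); auto|intros [H K]; eauto].
Qed.

Lemma fun_symbolE s n : fun_symbol tau s n <-> n ∈ om /\ pr s (pr (num 1) n) ∈ tau.
Proof.
  unfold fun_symbol. rewrite is_natE. setoid_rewrite pair_inE. setoid_rewrite is_taggedE.
  split; [intros (H & v & K & ->); auto|intros [H K]; eauto].
Qed.

Lemma terms_closedE T : terms_closed tau T <->
  (forall n, n ∈ om -> tvar n ∈ T) /\
  (forall s n ts, fun_symbol tau s n -> is_map ts n T -> tapp s ts ∈ T).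
Proof.
  unfold terms_closed. setoid_rewrite is_natE. setoid_rewrite is_taggedE.
  setoid_rewrite is_tagged2E. split; intros [H K]; split.
  - intros n Hn; eapply H; eauto; reflexivity.
  - intros s n ts Hs Hts; eapply K; eauto; reflexivity.
  - intros n x Hn ->; apply H, Hn.
  - intros s n ts x Hs Hts ->; apply (K s n ts Hs Hts).
Qed.

Lemma formulas_closedE F : formulas_closed tau F <->
  (forall t u, is_term tau t -> is_term tau u -> feq t u ∈ F) /\
  (forall s n ts, rel_symbol tau s n -> is_term_seq tau ts n -> frel s ts ∈ F) /\
  (forall p, p ∈ F -> fneg p ∈ F) /\
  (forall p q, p ∈ F -> q ∈ F -> fand p q ∈ F) /\
  (forall n p, n ∈ om -> p ∈ F -> fex n p ∈ F).
Proof.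
  unfold formulas_closed. setoid_rewrite is_natE. setoid_rewrite is_taggedE.
  setoid_rewrite is_tagged2E. split; intros (H1 & H2 & H3 & H4 & H5).
  - split; [|split; [|split; [|split]]]; intros.
    + apply (H1 t u); auto.
    + apply (H2 s n ts); auto.
    + apply (H3 p); auto.
    + apply (H4 p q); auto.
    + apply (H5 n p); auto.
  - split; [|split; [|split; [|split]]]; intros; subst.
    + apply H1; auto.
    + apply (H2 s n ts); auto.
    + apply H3; auto.
    + apply H4; auto.
    + apply H5; auto.
Qed.

Lemma is_term_seqE ts n : is_term_seq tau ts n <->
  is_function_on ts n /\ forall i, i ∈ n -> is_term tau (app ts i).
Proof.
  unfold is_term_seq. setoid_rewrite pair_inE. split; intros [H K]; split; auto.
  - intros i Hi. apply (K i), (fun_app _ H Hi); reflexivity.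
  - intros i t Hit. apply (fun_pair _ _ H) in Hit. destruct Hit as [Hi ->]; auto.
Qed.

Lemma term_var n : n ∈ om -> is_term tau (tvar n).
Proof. intros Hn T HT. apply (proj1 (proj1 (terms_closedE T) HT)), Hn. Qed.

Lemma term_app s n ts : fun_symbol tau s n -> is_term_seq tau ts n -> is_term tau (tapp s ts).
Proof.
  intros Hs Hts T HT. pose proof HT as HT'. apply terms_closedE in HT'.
  apply (proj2 HT' s n); [exact Hs|].
  apply is_term_seqE in Hts. apply is_mapE. split; [apply Hts|].
  intros i Hi. apply (proj2 Hts i Hi), HT.
Qed.

Lemma formula_eq t u : is_term tau t -> is_term tau u -> is_formula tau (feq t u).
Proof. intros Ht Hu F HF. apply (proj1 (proj1 (formulas_closedE F) HF)); assumption. Qed.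

Lemma formula_rel s n ts : rel_symbol tau s n -> is_term_seq tau ts n -> is_formula tau (frel s ts).
Proof. intros Hs Hts F HF. apply (proj1 (proj2 (proj1 (formulas_closedE F) HF)) s n); assumption. Qed.

Lemma formula_neg p : is_formula tau p -> is_formula tau (fneg p).
Proof. intros Hp F HF. destruct (proj1 (formulas_closedE F) HF) as (_ & _ & K & _). apply K, Hp, HF. Qed.

Lemma formula_and p q : is_formula tau p -> is_formula tau q -> is_formula tau (fand p q).
Proof.
  intros Hp Hq F HF. destruct (proj1 (formulas_closedE F) HF) as (_ & _ & _ & K & _).
  apply K; [apply Hp|apply Hq]; exact HF.
Qed.

Lemma formula_ex n p : n ∈ om -> is_formula tau p -> is_formula tau (fex n p).
Proof.
  intros Hn Hp F HF. destruct (proj1 (formulas_closedE F) HF) as (_ & _ & _ & _ & K).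
  apply K; [exact Hn|apply Hp, HF].
Qed.

Lemma symbol_mem w s v : is_transitive w -> tau ∈ w -> pr s v ∈ tau -> s ∈ w.
Proof. intros Hw Ht H. apply (pr_trans (y := v) Hw (Hw _ Ht _ H)). Qed.

(** [is_term] means membership in all closed sets, so it has content only if a closed set exists; a
    limit stage is one. *)
Lemma limit_terms_closed l : is_limit l -> tau ∈ Vs l -> terms_closed tau (Vs l).
Proof.
  intros Hl Ht. pose proof (Vs_trans (proj1 Hl)) as Tr. apply terms_closedE. split.
  - intros n Hn. apply (limit_pr Hl); apply (om_sub_limit Hl); [apply om_num|exact Hn].
  - intros s n ts Hs Hts. apply fun_symbolE in Hs. apply (limit_pr Hl).
    + apply (om_sub_limit Hl), om_num.
    + apply (limit_pr Hl); [apply (symbol_mem Tr Ht (proj2 Hs))|].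
      apply (@limit_finite_seq l ts n); tauto.
Qed.

Lemma limit_term l t : is_limit l -> tau ∈ Vs l -> is_term tau t -> t ∈ Vs l.
Proof. intros Hl Ht H. apply H, limit_terms_closed; assumption. Qed.

Lemma limit_formulas_closed l : is_limit l -> tau ∈ Vs l -> formulas_closed tau (Vs l).
Proof.
  intros Hl Ht. pose proof (Vs_trans (proj1 Hl)) as Tr.
  assert (N : forall k, num k ∈ Vs l) by (intros k; apply (om_sub_limit Hl), om_num).
  apply formulas_closedE. split; [|split; [|split; [|split]]]; intros.
  - apply (limit_pr Hl); [apply N|]. apply (limit_pr Hl); apply (limit_term Hl Ht); assumption.
  - apply rel_symbolE in H. apply (limit_pr Hl); [apply N|].
    apply (limit_pr Hl); [apply (symbol_mem Tr Ht (proj2 H))|].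
    apply (@limit_finite_seq l ts n); [exact Hl|tauto|]. apply is_term_seqE in H0.
    apply is_mapE. split; [tauto|]. intros i Hi. apply (limit_term Hl Ht), H0, Hi.
  - apply (limit_pr Hl); [apply N|assumption].
  - apply (limit_pr Hl); [apply N|]. apply (limit_pr Hl); assumption.
  - apply (limit_pr Hl); [apply N|]. apply (limit_pr Hl); [|assumption].
    apply (om_sub_limit Hl); assumption.
Qed.

Lemma limit_formula l p : is_limit l -> tau ∈ Vs l -> is_formula tau p -> p ∈ Vs l.
Proof. intros Hl Ht H. apply H, limit_formulas_closed; assumption. Qed.

Lemma limit_ex (x : M) : exists l, is_limit l /\ om ∈ l /\ x ∈ Vs l.
Proof. destruct (reflection nil x) as (l & H1 & H2 & H3 & _); eauto. Qed.

(** The terms satisfying [C] form a set by separation from a limit stage, and this set is closed. *)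
Lemma term_ind (C : M -> Prop) : PDef (fun e => C (e 0)) ->
  (forall n, n ∈ om -> C (tvar n)) ->
  (forall s n ts, fun_symbol tau s n -> is_term_seq tau ts n ->
    (forall i, i ∈ n -> C (app ts i)) -> C (tapp s ts)) ->
  forall t, is_term tau t -> C t.
Proof.
  intros HC Hv Ha t Ht. destruct (limit_ex tau) as (l & Hl & _ & Hlt).
  set (T := sep (Vs l) (fun t => is_term tau t /\ C t)).
  assert (HT : forall t, t ∈ T <-> t ∈ Vs l /\ is_term tau t /\ C t).
  { intros u; unfold T. rewrite mem_sep by solve_def. tauto. }
  assert (K : t ∈ T); [|apply HT in K; tauto].
  apply Ht, terms_closedE. split.
  - intros n Hn. pose proof (term_var Hn). apply HT; auto using limit_term.
  - intros s n ts Hs Hts. apply is_mapE in Hts. destruct Hts as [Hf Hts].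
    setoid_rewrite HT in Hts.
    assert (Hseq : is_term_seq tau ts n) by (apply is_term_seqE; split; auto; apply Hts).
    pose proof (term_app Hs Hseq). apply HT; split; [auto using limit_term|]. split; [auto|].
    apply (Ha s n ts); auto; apply Hts.
Qed.

Lemma formula_ind (C : M -> Prop) : PDef (fun e => C (e 0)) ->
  (forall t u, is_term tau t -> is_term tau u -> C (feq t u)) ->
  (forall s n ts, rel_symbol tau s n -> is_term_seq tau ts n -> C (frel s ts)) ->
  (forall p, is_formula tau p -> C p -> C (fneg p)) ->
  (forall p q, is_formula tau p -> is_formula tau q -> C p -> C q -> C (fand p q)) ->
  (forall n p, n ∈ om -> is_formula tau p -> C p -> C (fex n p)) ->
  forall p, is_formula tau p -> C p.
Proof.
  intros HC H1 H2 H3 H4 H5 p Hp. destruct (limit_ex tau) as (l & Hl & _ & Hlt).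
  set (T := sep (Vs l) (fun t => is_formula tau t /\ C t)).
  assert (HT : forall t, t ∈ T <-> is_formula tau t /\ C t).
  { intros u; unfold T. rewrite mem_sep by solve_def. split; [tauto|]. intros [H K].
    split; [apply limit_formula|]; auto. }
  assert (K : p ∈ T); [|apply HT in K; tauto].
  apply Hp, formulas_closedE. setoid_rewrite HT.
  split; [|split; [|split; [|split]]]; intros.
  - split; [apply formula_eq|]; auto.
  - split; [apply (formula_rel (n := n))|apply (H2 s n)]; auto.
  - split; [apply formula_neg|apply H3]; tauto.
  - split; [apply formula_and|apply H4]; tauto.
  - split; [apply formula_ex|apply H5]; tauto.
Qed.

(** * Existence and uniqueness of satisfaction *)

Variables D I : M.

Lemma is_assignmentE s : is_assignment D s <-> is_map s om D.
Proof.
  unfold is_assignment. setoid_rewrite is_omegaE. split; [intros (w & -> & H); exact H|eauto].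
Qed.

Definition true_eq (s t u : M) : Prop :=
  exists d, term_value tau D I s t d /\ term_value tau D I s u d.

Definition true_rel (s n r ts : M) : Prop :=
  exists vs R, is_map vs n D /\
    (forall i v, pair_in vs i v <-> exists t, pair_in ts i t /\ term_value tau D I s t v) /\
    pair_in I r R /\ vs ∈ R.

Definition variant (n s s' : M) : Prop :=
  is_assignment D s' /\ forall m d, m <> n -> (pair_in s' m d <-> pair_in s m d).

Lemma is_satisfactionE S : is_satisfaction tau D I S <->
  forall s, is_assignment D s ->
  (forall t u, is_term tau t -> is_term tau u -> (pr (feq t u) s ∈ S <-> true_eq s t u)) /\
  (forall r n ts, rel_symbol tau r n -> is_term_seq tau ts n ->
     (pr (frel r ts) s ∈ S <-> true_rel s n r ts)) /\
  (forall p, is_formula tau p -> (pr (fneg p) s ∈ S <-> ~ pr p s ∈ S)) /\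
  (forall p q, is_formula tau p -> is_formula tau q ->
     (pr (fand p q) s ∈ S <-> pr p s ∈ S /\ pr q s ∈ S)) /\
  (forall n p, n ∈ om -> is_formula tau p ->
     (pr (fex n p) s ∈ S <-> exists s', variant n s s' /\ pr p s' ∈ S)).
Proof.
  unfold is_satisfaction, variant.
  split; intros H s Hs; specialize (H s Hs); destruct H as (H1 & H2 & H3 & H4 & H5).
  - split; [|split; [|split; [|split]]]; intros.
    + rewrite <- pair_inE. apply H1; auto. apply is_tagged2E; reflexivity.
    + rewrite <- pair_inE. apply H2; auto. apply is_tagged2E; reflexivity.
    + rewrite <- !pair_inE. apply H3; auto. apply is_taggedE; reflexivity.
    + rewrite <- !pair_inE. apply H4; auto. apply is_tagged2E; reflexivity.
    + rewrite <- pair_inE. rewrite (H5 n p); [|apply is_natE; auto|auto|apply is_tagged2E; reflexivity].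
      setoid_rewrite pair_inE. split; intros (s' & K); exists s'; tauto.
  - split; [|split; [|split; [|split]]]; intros.
    + apply is_tagged2E in H6; subst x. rewrite pair_inE. apply H1; auto.
    + apply is_tagged2E in H6; subst x. rewrite pair_inE. apply H2; auto.
    + apply is_taggedE in H0; subst x. rewrite !pair_inE. apply H3; auto.
    + apply is_tagged2E in H6; subst x. rewrite !pair_inE. apply H4; auto.
    + apply is_tagged2E in H6; subst x. apply is_natE in H. rewrite pair_inE.
      etransitivity; [apply (H5 n p H H0)|].
      setoid_rewrite pair_inE. split; intros (s' & K); exists s'; tauto.
Qed.

Lemma satisfaction_unique S S' p : is_satisfaction tau D I S -> is_satisfaction tau D I S' ->
  is_formula tau p -> forall s, is_assignment D s -> (pr p s ∈ S <-> pr p s ∈ S').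
Proof.
  intros HS HS'. pose proof (proj1 (is_satisfactionE S) HS) as K.
  pose proof (proj1 (is_satisfactionE S') HS') as K'. revert p.
  apply (formula_ind (C := fun p => forall s, is_assignment D s -> (pr p s ∈ S <-> pr p s ∈ S'))).
  - solve_def.
  - intros t u Ht Hu s Hs. destruct (K s Hs) as [J _], (K' s Hs) as [J' _].
    rewrite J, J' by assumption; tauto.
  - intros r n ts Hr Hts s Hs. destruct (K s Hs) as (_ & J & _), (K' s Hs) as (_ & J' & _).
    rewrite (J r n ts), (J' r n ts) by assumption; tauto.
  - intros p Hp IH s Hs. destruct (K s Hs) as (_ & _ & J & _), (K' s Hs) as (_ & _ & J' & _).
    rewrite J, J', IH by assumption; tauto.
  - intros p q Hp Hq IHp IHq s Hs.
    destruct (K s Hs) as (_ & _ & _ & J & _), (K' s Hs) as (_ & _ & _ & J' & _).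
    rewrite J, J', IHp, IHq by assumption; tauto.
  - intros n p Hn Hp IH s Hs.
    destruct (K s Hs) as (_ & _ & _ & _ & J), (K' s Hs) as (_ & _ & _ & _ & J').
    rewrite J, J' by assumption.
    split; intros (s' & Hs' & H); exists s'; split; auto; apply IH; auto; apply Hs'.
Qed.

(** [Sp] is the satisfaction relation for the immediate subformulas of [x]. *)
Definition tarski (x s : M) (Sp : M -> M -> Prop) : Prop :=
  (exists t u, x = feq t u /\ true_eq s t u) \/
  (exists r n ts, rel_symbol tau r n /\ is_term_seq tau ts n /\ x = frel r ts /\ true_rel s n r ts) \/
  (exists p, x = fneg p /\ ~ Sp p s) \/
  (exists p q, x = fand p q /\ Sp p s /\ Sp q s) \/
  (exists n p, x = fex n p /\ exists s', variant n s s' /\ Sp p s').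

(** The immediate subformulas of a code lie in every transitive set of which the code is a subset,
    by the shape of ordered pairs; so the truth of [x] depends only on [Sp] there. *)
Lemma tarski_local x s a Sp Sp' : is_transitive a -> incl x a ->
  (forall p s, p ∈ a -> (Sp p s <-> Sp' p s)) -> (tarski x s Sp -> tarski x s Sp').
Proof.
  intros Ha Hx E.
  assert (K2 : forall k y, x = pr k y -> y ∈ a).
  { intros k y ->. assert (J : upair k y ∈ a) by (apply Hx, mem_upair; auto).
    apply (Ha _ J), mem_upair; auto. }
  intros [H|[H|[(p & Hp & H)|[(p & q & Hp & H)|(n & p & Hp & s' & Hs' & H)]]]].
  - left; exact H.
  - right; left; exact H.
  - do 2 right; left. exists p; split; [exact Hp|]. rewrite <- E; [exact H|eauto].
  - do 3 right; left. pose proof (pr_trans Ha (K2 _ _ Hp)). exists p, q; split; [exact Hp|].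
    rewrite <- !E by tauto; exact H.
  - do 4 right. pose proof (pr_trans Ha (K2 _ _ Hp)). exists n, p; split; [exact Hp|].
    exists s'; split; [exact Hs'|]. rewrite <- E by tauto; exact H.
Qed.

(** Unfolds satisfaction at a coded formula; the four cases with another tag die by injectivity of
    [num]. *)
Ltac tarski_case main HFl K Hsl N :=
  rewrite (main _ _ (HFl _ K) Hsl); unfold tarski, feq, frel, fneg, fand, fex;
  repeat setoid_rewrite pr_inj; split;
  [intros [(? & ? & [? E] & J)|[(? & ? & ? & ? & ? & [? E] & J)|[(? & [? E] & J)
    |[(? & ? & [? E] & J)|(? & ? & [? E] & J)]]]];
    try (match goal with H : num _ = num _ |- _ => discriminate (N _ _ H) end)
  |intros J].

(** Satisfaction is built by recursion on the rank of the code, which exceeds the ranks of its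
    subformulas, all within a stage holding the codes and the assignments. *)
Lemma satisfaction_ex : exists S, is_satisfaction tau D I S.
Proof.
  destruct (limit_ex (pr tau D)) as (l & Hl & Hom & Hx).
  destruct (pr_trans (Vs_trans (proj1 Hl)) Hx) as [Hlt HlD].
  assert (Oom : om ∈ Vs l) by (apply (ord_sub_Vs (proj1 Hl)), Hom).
  assert (Has : forall s, is_assignment D s -> s ∈ Vs l).
  { intros s Hs. apply is_assignmentE in Hs. apply (limit_fun Hl Hs); auto. }
  set (rk := fun x a => incl x (Vs a) /\ ~ x ∈ Vs a).
  set (U := Vs l).
  (* The step function must recover the current rank from [f] alone; it reads [a] off as the domain
     of [f]. *)
  set (C := fun f z => exists x s a, z = pr x s /\ is_function_on f a /\ rk x a /\
    tarski x s (fun p s => exists c u, pr c u ∈ f /\ pr p s ∈ u)).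
  assert (DC : PDef (fun e => C (e 0) (e 1))).
  { unfold C, tarski, rk, true_eq, true_rel, variant, feq, frel, fneg, fand, fex. solve_def. }
  set (F := fun f => sep U (C f)).
  assert (HF : definable_map F).
  { apply (d_ext (Q := fun e => forall z, z ∈ e 0 <-> z ∈ U /\ C (e 1) z)); [|solve_def].
    intros e; split.
    - intros -> z. unfold F. rewrite mem_sep by solve_def. tauto.
    - intros H; apply ext; intros z. unfold F. rewrite mem_sep by solve_def. apply H. }
  (* [T a] is satisfaction for the formulas of rank exactly [a]. *)
  set (T := rec F).
  assert (DTT : definable_map T) by (apply PDef_rec, HF).
  assert (HT : forall a x s, is_ordinal a -> pr x s ∈ U -> (pr x s ∈ T a <-> rk x a /\
    tarski x s (fun p s => exists b, b ∈ a /\ pr p s ∈ T b))).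
  { intros a x s Ha HU. unfold T at 1. rewrite rec_eq by assumption. unfold F at 1.
    rewrite mem_sep by solve_def. unfold C.
    assert (L : forall p s, (exists c u, pr c u ∈ lam a (rec F) /\ pr p s ∈ u) <->
      exists b, b ∈ a /\ pr p s ∈ T b).
    { intros p s'. setoid_rewrite (fun c y => @lam_pr _ _ a c y (rec F) DTT). split.
      - intros (c & u & [Hc ->] & K); eauto.
      - intros (c & Hc & K); eauto. }
    split.
    - intros (_ & x' & s' & a' & E & Hf & Hr & K). apply pr_inj in E. destruct E; subst x' s'.
      rewrite (fun_dom_eq Hf (lam_fun a DTT)) in *. split; [exact Hr|].
      apply (tarski_local (Vs_trans Ha) (proj1 Hr) (fun p s _ => L p s)), K.
    - intros [Hr K]. split; [exact HU|]. exists x, s, a. split; [reflexivity|].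
      split; [apply lam_fun, DTT|]. split; [exact Hr|].
      apply (tarski_local (Vs_trans Ha) (proj1 Hr) (fun p s _ => iff_sym (L p s))), K. }
  assert (HTU : forall a x s, is_ordinal a -> pr x s ∈ T a -> pr x s ∈ U).
  { intros a x s Ha K. unfold T in K. rewrite rec_eq in K by assumption.
    unfold F at 1 in K. rewrite mem_sep in K by solve_def. tauto. }
  set (S := sep U (fun z => exists b, b ∈ l /\ z ∈ T b)).
  assert (HS : forall z, z ∈ S <-> z ∈ U /\ exists b, b ∈ l /\ z ∈ T b).
  { intros z; unfold S. rewrite mem_sep by solve_def. tauto. }
  assert (Kl : forall b, b ∈ l -> is_ordinal b) by (intros b; apply ord_in, Hl).
  assert (main : forall x s, x ∈ Vs l -> s ∈ Vs l ->
    (pr x s ∈ S <-> tarski x s (fun p s => pr p s ∈ S))).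
  { intros x s Hx' Hs.
    assert (HU : pr x s ∈ U) by (apply (limit_pr Hl); assumption).
    destruct (@ord_least _ _ (fun a => incl x (Vs a))) as (a & Oa & Ra & La); [solve_def| |].
    { exists l; split; [apply Hl|]. apply (Vs_trans (proj1 Hl)), Hx'. }
    assert (Hr : rk x a).
    { split; [exact Ra|]. intros K. apply (mem_Vs _ Oa) in K. destruct K as (c & Hc & K).
      apply (La c Hc K). }
    assert (Hal : a ∈ l).
    { apply (mem_Vs _ (proj1 Hl)) in Hx'. destruct Hx' as (c & Hc & K).
      destruct (ord_trichotomy Oa (Kl c Hc)) as [E|[->|E]].
      - apply (ord_trans (proj1 Hl) Hc E).
      - exact Hc.
      - destruct (La c E K). }
    (* A code of rank exactly [b] lying in [V_c] has [b] below [c]; hence for subformulas the values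
       of [T] below [a] see as much as all of [S]. *)
    assert (Ur : forall y b c, is_ordinal b -> is_ordinal c -> rk y b -> y ∈ Vs c -> b ∈ c).
    { intros y b c Hb Hc [R1 R2] K. destruct (ord_trichotomy Hb Hc) as [E|[->|E]]; [exact E|tauto|].
      destruct R2. apply (@Vs_mono _ _ c b); auto. apply ord_incl; auto. }
    assert (E : forall p s', p ∈ Vs a ->
      ((exists b, b ∈ a /\ pr p s' ∈ T b) <-> pr p s' ∈ S)).
    { intros p s' Hp. rewrite HS. split.
      - intros (b & Hb & K). split; [apply (HTU b); eauto using ord_in|].
        exists b; split; [|exact K]. apply (ord_trans (proj1 Hl) Hal Hb).
      - intros (KU & b & Hb & K). exists b; split; [|exact K].
        apply (Ur p b a); auto. apply (HT b p s'); auto. }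
    assert (E2 : pr x s ∈ S <-> pr x s ∈ T a).
    { rewrite HS. split; [|eauto]. intros (_ & b & Hb & K).
      pose proof (proj1 (proj1 (HT b x s (Kl b Hb) HU) K)) as Rb.
      replace a with b; [exact K|]. destruct (ord_trichotomy (Kl b Hb) Oa) as [J|[J|J]]; [|exact J|].
      - destruct (La b J (proj1 Rb)).
      - destruct (proj2 Rb). apply mem_Vs; [auto|]. exists a; auto. }
    rewrite E2, (HT a x s Oa HU). split.
    - intros [_ K]. apply (tarski_local (Vs_trans Oa) Ra E), K.
    - intros K. split; [exact Hr|].
      apply (tarski_local (Vs_trans Oa) Ra (fun p s Hp => iff_sym (E p s Hp))), K. }
  exists S. apply is_satisfactionE. intros s Hs.
  assert (Hsl : s ∈ Vs l) by auto.
  assert (N : forall i j, num i = num j :> M -> i = j) by apply num_inj.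
  assert (HFl : forall p, is_formula tau p -> p ∈ Vs l) by (intros p; apply (limit_formula Hl Hlt)).
  split; [|split; [|split; [|split]]]; intros.
  - tarski_case main HFl (formula_eq H H0) Hsl N.
    + destruct E; subst; exact J.
    + left; exists t, u; auto 8.
  - tarski_case main HFl (formula_rel H H0) Hsl N.
    + destruct E; subst. apply is_term_seqE in H0.
      match goal with H' : is_term_seq _ _ ?m |- _ => apply is_term_seqE in H';
        rewrite (fun_dom_eq (proj1 H0) (proj1 H')); exact J end.
    + right; left; exists r, n, ts; auto 8.
  - tarski_case main HFl (formula_neg H) Hsl N.
    + subst; exact J.
    + do 2 right; left; exists p; auto.
  - tarski_case main HFl (formula_and H H0) Hsl N.
    + destruct E; subst; exact J.
    + do 3 right; left; exists p, q; auto 8.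
  - tarski_case main HFl (formula_ex H H0) Hsl N.
    + destruct E; subst; exact J.
    + do 4 right; exists n, p; auto 8.
Qed.

(** By uniqueness, the existential quantifier over satisfaction relations in [satisfies] may be
    replaced by any fixed one. *)
Lemma satisfiesE S p s : is_satisfaction tau D I S -> is_formula tau p -> is_assignment D s ->
  (satisfies tau (pr D I) p s <-> pr p s ∈ S).
Proof.
  intros HS Hp Hs. unfold satisfies. setoid_rewrite is_opairE. setoid_rewrite pr_inj.
  setoid_rewrite pair_inE. split.
  - intros (D' & I' & S' & [<- <-] & HS' & K). apply (satisfaction_unique HS' HS Hp Hs), K.
  - intros K. exists D, I, S; auto.
Qed.

Let sat := satisfies tau (pr D I).

Lemma sat_eq t u s : is_assignment D s -> is_term tau t -> is_term tau u ->
  (sat (feq t u) s <-> true_eq s t u).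
Proof.
  intros Hs Ht Hu. destruct satisfaction_ex as [S HS]. unfold sat.
  rewrite (satisfiesE HS (formula_eq Ht Hu) Hs). rewrite is_satisfactionE in HS.
  destruct (HS s Hs) as (K & _). apply K; assumption.
Qed.

Lemma sat_rel r n ts s : is_assignment D s -> rel_symbol tau r n -> is_term_seq tau ts n ->
  (sat (frel r ts) s <-> true_rel s n r ts).
Proof.
  intros Hs Hr Hts. destruct satisfaction_ex as [S HS]. unfold sat.
  rewrite (satisfiesE HS (formula_rel Hr Hts) Hs). rewrite is_satisfactionE in HS.
  destruct (HS s Hs) as (_ & K & _). apply (K r n ts); assumption.
Qed.

Lemma sat_neg p s : is_assignment D s -> is_formula tau p -> (sat (fneg p) s <-> ~ sat p s).
Proof.
  intros Hs Hp. destruct satisfaction_ex as [S HS]. unfold sat.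
  rewrite (satisfiesE HS (formula_neg Hp) Hs), (satisfiesE HS Hp Hs).
  rewrite is_satisfactionE in HS. destruct (HS s Hs) as (_ & _ & K & _). apply K; assumption.
Qed.

Lemma sat_and p q s : is_assignment D s -> is_formula tau p -> is_formula tau q ->
  (sat (fand p q) s <-> sat p s /\ sat q s).
Proof.
  intros Hs Hp Hq. destruct satisfaction_ex as [S HS]. unfold sat.
  rewrite (satisfiesE HS (formula_and Hp Hq) Hs), (satisfiesE HS Hp Hs), (satisfiesE HS Hq Hs).
  rewrite is_satisfactionE in HS. destruct (HS s Hs) as (_ & _ & _ & K & _). apply K; assumption.
Qed.

Lemma sat_ex n p s : is_assignment D s -> n ∈ om -> is_formula tau p ->
  (sat (fex n p) s <-> exists s', variant n s s' /\ sat p s').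
Proof.
  intros Hs Hn Hp. destruct satisfaction_ex as [S HS]. unfold sat.
  rewrite (satisfiesE HS (formula_ex Hn Hp) Hs).
  assert (K : forall s', variant n s s' -> (satisfies tau (pr D I) p s' <-> pr p s' ∈ S)).
  { intros s' [Hs' _]. apply (satisfiesE HS Hp Hs'). }
  rewrite is_satisfactionE in HS. destruct (HS s Hs) as (_ & _ & _ & _ & J).
  rewrite (J n p Hn Hp).
  split; intros (s' & Hs' & H); exists s'; split; auto; apply K; auto.
Qed.

End Syntax.

(** * Signatures of binary relation symbols *)

Section Binary.
Context {M : set_model} {hZF : ZF M}.

Lemma mem_num2 (x : M) : x ∈ num 2 <-> x = num 0 \/ x = num 1.
Proof. simpl. rewrite !mem_suc, mem_emp. tauto. Qed.

Lemma num01 : num 0 <> num 1 :> M.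
Proof. intros H. discriminate (num_inj H). Qed.

Definition tup2 (x y : M) : M := upair (pr (num 0) x) (pr (num 1) y).

Lemma tup2_pr x y i z : pr i z ∈ tup2 x y <-> (i = num 0 /\ z = x) \/ (i = num 1 /\ z = y).
Proof. unfold tup2. rewrite mem_upair, !pr_inj. tauto. Qed.

Lemma tup2_fun x y : is_function_on (tup2 x y) (num 2).
Proof.
  pose proof num01 as N. split.
  - intros p Hp. unfold tup2 in Hp. apply mem_upair in Hp. setoid_rewrite mem_num2.
    destruct Hp as [->| ->]; [exists (num 0), x|exists (num 1), y];
      (split; [auto|apply is_opairE; reflexivity]).
  - intros i Hi. apply mem_num2 in Hi. unfold unique. setoid_rewrite pair_inE.
    setoid_rewrite tup2_pr. destruct Hi as [->| ->]; [exists x|exists y];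
      (split; [auto|]); intros z; intuition congruence.
Qed.

Lemma num2_mem : num 0 ∈ num 2 /\ num 1 ∈ (num 2 : M).
Proof. rewrite !mem_num2; auto. Qed.

Lemma tup2_app x y : app (tup2 x y) (num 0) = x /\ app (tup2 x y) (num 1) = y.
Proof.
  split; symmetry; apply (fun_app _ (tup2_fun x y)); try apply num2_mem; apply tup2_pr; auto.
Qed.

Lemma tup2_map x y D : is_map (tup2 x y) (num 2) D <-> x ∈ D /\ y ∈ D.
Proof.
  destruct (tup2_app x y) as [E0 E1]. rewrite is_mapE. split.
  - intros [_ H]. rewrite <- E0 at 1. rewrite <- E1 at 2. split; apply H, num2_mem.
  - intros [Hx Hy]. split; [apply tup2_fun|]. intros i Hi. apply mem_num2 in Hi.
    destruct Hi as [->| ->]; [rewrite E0|rewrite E1]; assumption.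
Qed.

Lemma fun_tup2 f : is_function_on f (num 2) -> f = tup2 (app f (num 0)) (app f (num 1)).
Proof.
  intros H. apply (fun_ext H (tup2_fun _ _)). intros i Hi. apply mem_num2 in Hi.
  destruct (tup2_app (app f (num 0)) (app f (num 1))).
  destruct Hi as [->| ->]; congruence.
Qed.

Lemma tup2_inj x y x' y' : tup2 x y = tup2 x' y' -> x = x' /\ y = y'.
Proof.
  intros H. destruct (tup2_app x y) as [E0 E1], (tup2_app x' y') as [E2 E3].
  rewrite H in *. split; congruence.
Qed.

Variable X : M.

Definition bsig : M := lam X (fun _ => pr (num 0) (num 2)).

Lemma bsig_pr s v : pr s v ∈ bsig <-> s ∈ X /\ v = pr (num 0) (num 2).
Proof. unfold bsig. rewrite lam_pr by solve_def. tauto. Qed.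

Lemma bsig_fun : is_function_on bsig X.
Proof. unfold bsig. refine (lam_fun X (G := fun _ => pr (num 0) (num 2)) _). solve_def. Qed.

Lemma bsig_rel s n : rel_symbol bsig s n <-> s ∈ X /\ n = num 2.
Proof.
  rewrite rel_symbolE, bsig_pr, pr_inj. split; [tauto|]. intros [H ->].
  repeat split; auto. apply om_num.
Qed.

Lemma bsig_no_fun s n : ~ fun_symbol bsig s n.
Proof.
  rewrite fun_symbolE, bsig_pr, pr_inj. intros (_ & _ & H & _). discriminate (num_inj H).
Qed.

Lemma bsig_signature : is_signature bsig.
Proof.
  exists X; split; [apply bsig_fun|]. intros s v H. apply pair_inE, bsig_pr in H.
  destruct H as [_ ->]. exists (num 2). rewrite is_natE, !is_taggedE. split; [apply om_num|auto].
Qed.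

Lemma bsig_term t : is_term bsig t <-> exists n, n ∈ om /\ t = tvar n.
Proof.
  split; [|intros (n & Hn & ->); apply term_var, Hn].
  revert t. apply (term_ind (C := fun t => exists n, n ∈ om /\ t = tvar n)).
  - unfold tvar; solve_def.
  - eauto.
  - intros s n ts H. destruct (bsig_no_fun H).
Qed.

Section Structure.
Variables D I : M.
Hypothesis HI : is_function_on I X.

Lemma bsig_value s n d : is_assignment D s -> n ∈ om ->
  (term_value bsig D I s (tvar n) d <-> d = app s n).
Proof.
  intros Hs Hn. pose proof (proj1 (is_assignmentE D s) Hs) as Hm. apply is_mapE in Hm.
  destruct Hm as [Hf Hm]. unfold term_value. split.
  - intros (e & (_ & He & _) & K). apply (He n) in K.
    + apply pair_inE, (fun_app _ Hf Hn) in K. exact K.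
    + apply is_natE, Hn.
    + apply is_taggedE; reflexivity.
  - intros ->.
    destruct (@rep_ex _ _ (fun n z => z = pr (tvar n) (app s n))) with (a := om : M) as (e & He).
    { unfold tvar; solve_def. }
    { intros m _. exists (pr (tvar m) (app s m)). split; auto. }
    destruct (@rep_ex _ _ (fun n z => z = tvar n)) with (a := om : M) as (T & HT).
    { unfold tvar; solve_def. }
    { intros m _. exists (tvar m). split; auto. }
    assert (Kp : forall m d, pr (tvar m) d ∈ e <-> m ∈ om /\ d = app s m).
    { intros m d. rewrite He. split.
      - intros (k & Hk & E). apply pr_inj in E. destruct E as [E ->].
        apply pr_inj in E. destruct E as [_ ->]. auto.
      - intros [Hk ->]; eauto. }
    exists e. rewrite pair_inE, Kp. split; [|auto]. split; [|split].
    + exists T. split; [intros t; rewrite HT, bsig_term; reflexivity|]. split; [split|].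
      * intros p Hp. apply He in Hp. destruct Hp as (m & Hk & ->).
        exists (tvar m), (app s m). rewrite is_opairE, HT. eauto.
      * intros t Ht. apply HT in Ht. destruct Ht as (m & Hk & ->). exists (app s m).
        unfold unique. setoid_rewrite pair_inE. setoid_rewrite Kp. split; [auto|].
        intros y [_ ->]; reflexivity.
      * intros t y K. apply pair_inE in K. pose proof K as K'. apply He in K.
        destruct K as (m & Hk & E). apply pr_inj in E. destruct E as [-> ->]. auto.
    + intros m x d. rewrite is_natE, is_taggedE. intros Hk ->. rewrite !pair_inE.
      change (pr (num 0) m) with (tvar m). rewrite Kp, (fun_pair _ _ Hf). reflexivity.
    + intros f m ts x d H. destruct (bsig_no_fun H).
Qed.

Lemma bsig_sat_eq m n s : is_assignment D s -> m ∈ om -> n ∈ om ->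
  (satisfies bsig (pr D I) (feq (tvar m) (tvar n)) s <-> app s m = app s n).
Proof.
  intros Hs Hm Hn. rewrite sat_eq; [|exact Hs|apply term_var, Hm|apply term_var, Hn].
  unfold true_eq. setoid_rewrite bsig_value; auto. split.
  - intros (d & -> & E); exact E.
  - intros E; eauto.
Qed.

Lemma bsig_seq m n : m ∈ om -> n ∈ om -> is_term_seq bsig (tup2 (tvar m) (tvar n)) (num 2).
Proof.
  intros Hm Hn. apply is_term_seqE. split; [apply tup2_fun|]. intros i Hi. apply mem_num2 in Hi.
  destruct (tup2_app (tvar m) (tvar n)) as [E0 E1].
  destruct Hi as [->| ->]; [rewrite E0|rewrite E1]; apply term_var; assumption.
Qed.

Lemma bsig_sat_rel r m n s : r ∈ X -> is_assignment D s -> m ∈ om -> n ∈ om ->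
  (satisfies bsig (pr D I) (frel r (tup2 (tvar m) (tvar n))) s <->
    tup2 (app s m) (app s n) ∈ app I r).
Proof.
  intros Hr Hs Hm Hn. rewrite (sat_rel (n := num 2) I Hs).
  2: apply bsig_rel; auto. 2: apply bsig_seq; auto.
  pose proof (proj1 (is_assignmentE D s) Hs) as K. apply is_mapE in K. destruct K as [Hf K].
  assert (V : forall vs, is_function_on vs (num 2) ->
    ((forall i v, pair_in vs i v <-> exists t, pair_in (tup2 (tvar m) (tvar n)) i t /\
      term_value bsig D I s t v) <-> vs = tup2 (app s m) (app s n))).
  { intros vs Hvs. setoid_rewrite pair_inE. setoid_rewrite tup2_pr. split.
    - intros J. rewrite (fun_tup2 Hvs). f_equal; symmetry.
      + apply (fun_app _ Hvs); [apply num2_mem|]. apply J. exists (tvar m).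
        rewrite bsig_value; auto.
      + apply (fun_app _ Hvs); [apply num2_mem|]. apply J. exists (tvar n).
        rewrite bsig_value; auto.
    - intros -> i v. rewrite tup2_pr. split.
      + intros [[-> ->]|[-> ->]]; [exists (tvar m)|exists (tvar n)]; rewrite bsig_value; auto.
      + intros (t & [[-> ->]|[-> ->]] & J); apply bsig_value in J; auto. }
  unfold true_rel. setoid_rewrite pair_inE. split.
  - intros (vs & R & Hvs & J & HR & HvR). setoid_rewrite <- pair_inE in J.
    apply (V vs (proj1 Hvs)) in J. subst vs. apply (fun_app _ HI Hr) in HR. subst R. exact HvR.
  - intros J. exists (tup2 (app s m) (app s n)), (app I r).
    split; [apply tup2_map; auto|]. split; [|split; [apply (fun_app _ HI Hr); reflexivity|exact J]].
    setoid_rewrite <- pair_inE. apply (V _ (tup2_fun _ _)). reflexivity.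
Qed.

Lemma update s n x : is_assignment D s -> x ∈ D -> n ∈ om -> exists s', is_assignment D s' /\
  app s' n = x /\ forall m, m ∈ om -> m <> n -> app s' m = app s m.
Proof.
  intros Hs Hx Hn. setoid_rewrite is_assignmentE in Hs. apply is_mapE in Hs. destruct Hs as [Hf Hs].
  set (P := fun m y : M => (m = n /\ y = x) \/ (m <> n /\ y = app s m)).
  assert (U : forall m y y', P m y -> P m y' -> y = y').
  { intros m y y' [[? ?]|[? ?]] [[? ?]|[? ?]]; congruence. }
  assert (HG : PDef (fun e : nat -> M => e 0 = iot (P (e 1)))).
  { apply (@dt_iot _ _ _ _ (fun y e => P (e 0) y)); [intros e; apply U|unfold P; solve_def]. }
  assert (En : app (lam om (fun m => iot (P m))) n = x).
  { rewrite app_lam by auto. apply iot_eq; [apply U|unfold P; auto]. }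
  assert (Em : forall m, m ∈ om -> m <> n -> app (lam om (fun m => iot (P m))) m = app s m).
  { intros m Hm N. rewrite app_lam by auto. apply iot_eq; [apply U|unfold P; auto]. }
  exists (lam om (fun m => iot (P m))). split; [|auto]. apply is_assignmentE, is_mapE.
  split; [apply lam_fun, HG|]. intros m Hm.
  destruct (classic (m = n)) as [->|N]; [rewrite En; exact Hx|rewrite Em by assumption; auto].
Qed.

(** Names run against the de Bruijn order, so that a new binder takes the fresh name [k] and renames
    no earlier variable. *)
Lemma assignment_ex k (e : nat -> M) : (forall i, e i ∈ D) -> exists s, is_assignment D s /\
  forall i, i < k -> app s (num (k - 1 - i)) = e i.
Proof.
  revert e; induction k; intros e He.
  - exists (lam om (fun _ => e 0)). split; [|lia]. apply is_assignmentE, is_mapE.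
    split; [apply lam_fun; solve_def|]. intros n Hn. rewrite app_lam; auto. solve_def.
  - destruct (IHk (fun i => e (S i))) as (s & Hs & K); [auto|].
    destruct (update Hs (He 0) (om_num k)) as (s' & Hs' & E & F).
    exists s'. split; [exact Hs'|]. intros [|i] Hi.
    + replace (S k - 1 - 0) with k by lia. exact E.
    + replace (S k - 1 - S i) with (k - 1 - i) by lia. rewrite F; [apply K; lia|apply om_num|].
      intros J. apply num_inj in J. lia.
Qed.

End Structure.

(** The variable with de Bruijn index [i] below [k] binders is named [k - 1 - i]. *)
Definition codes (k : nat) (c : M) (Q : M -> M -> (nat -> M) -> Prop) : Prop :=
  is_formula bsig c /\
  forall D I s e, is_function_on I X -> is_assignment D s ->
    (forall i, i < k -> app s (num (k - 1 - i)) = e i) ->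
    (satisfies bsig (pr D I) c s <-> Q D I e).

Lemma codes_ext k c Q Q' : (forall D I e, Q D I e <-> Q' D I e) -> codes k c Q -> codes k c Q'.
Proof.
  intros E [H K]. split; [exact H|]. intros D I s e HI Hs He. rewrite <- E. apply (K D I s e); auto.
Qed.

Lemma codes_neg k c Q : codes k c Q -> codes k (fneg c) (fun D I e => ~ Q D I e).
Proof.
  intros [H K]. split; [apply formula_neg, H|]. intros D I s e HI Hs He.
  rewrite (sat_neg I Hs H), (K D I s e) by assumption. tauto.
Qed.

Lemma codes_and k c d Q R : codes k c Q -> codes k d R ->
  codes k (fand c d) (fun D I e => Q D I e /\ R D I e).
Proof.
  intros [H K] [H' K']. split; [apply formula_and; assumption|]. intros D I s e HI Hs He.
  rewrite (sat_and I Hs H H'), (K D I s e), (K' D I s e) by assumption. tauto.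
Qed.

Lemma codes_ex k c Q : codes (S k) c Q ->
  codes k (fex (num k) c) (fun D I e => exists x, x ∈ D /\ Q D I (scons x e)).
Proof.
  intros [H K]. split; [apply formula_ex; [apply om_num|exact H]|]. intros D I s e HI Hs He.
  rewrite (sat_ex I Hs (om_num k) H).
  assert (J : forall s' x, is_assignment D s' -> app s' (num k) = x ->
    (forall i, i < k -> app s' (num i) = app s (num i)) ->
    forall i, i < S k -> app s' (num (S k - 1 - i)) = scons x e i).
  { intros s' x Hs' Hx E [|i] Hi; simpl scons.
    - replace (S k - 1 - 0) with k by lia. exact Hx.
    - replace (S k - 1 - S i) with (k - 1 - i) by lia. rewrite E by lia. apply He; lia. }
  pose proof (proj1 (is_assignmentE D s) Hs) as Hm. apply is_mapE in Hm. destruct Hm as [Hf Hm].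
  split.
  - intros (s' & [Hs' V] & Hc).
    pose proof (proj1 (is_assignmentE D s') Hs') as Hm'. apply is_mapE in Hm'.
    destruct Hm' as [Hf' Hm'].
    exists (app s' (num k)). split; [apply Hm', om_num|].
    apply (K D I s'); auto. apply J; auto. intros i Hi.
    apply (fun_app _ Hf (om_num i)), pair_inE, V.
    + intros E; apply num_inj in E; lia.
    + apply pair_inE, (fun_app _ Hf' (om_num i)); reflexivity.
  - intros (x & Hx & HQ). destruct (update Hs Hx (om_num k)) as (s' & Hs' & E & F).
    exists s'. split; [split; [exact Hs'|]|].
    + intros m d N. rewrite !pair_inE.
      pose proof (proj1 (is_assignmentE D s') Hs') as Hm'. apply is_mapE in Hm'.
      rewrite (fun_pair _ _ Hf), (fun_pair _ _ (proj1 Hm')).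
      split; intros [Ho ->]; (split; [exact Ho|]); [apply F; auto|symmetry; apply F; auto].
    + apply (K D I s' (scons x e)); auto. apply J; auto. intros i Hi. apply F; [apply om_num|].
      intros G; apply num_inj in G; lia.
Qed.

(** Codes have only negation, conjunction and existential quantification, so the other connectives
    are translated classically. The recursion is on the external formula, so only standard codes
    arise. *)
Lemma fm_code r p : r ∈ X -> forall k, free_below k p -> exists c, codes k c
  (fun D I e => tru (fun x => x ∈ D) (fun x y => tup2 x y ∈ app I r) e p).
Proof.
  intros Hr. induction p; intros k Hk; simpl in Hk; simpl tru.
  - exists (frel r (tup2 (tvar (num (k - 1 - i))) (tvar (num (k - 1 - j))))). split.
    + apply (formula_rel (n := num 2)); [apply bsig_rel; auto|apply bsig_seq; apply om_num].
    + intros D I s e HI Hs He. rewrite (bsig_sat_rel HI) by (auto using om_num).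
      rewrite !He by lia. tauto.
  - exists (feq (tvar (num (k - 1 - i))) (tvar (num (k - 1 - j)))). split.
    + apply formula_eq; apply term_var, om_num.
    + intros D I s e HI Hs He. rewrite (bsig_sat_eq I) by (auto using om_num).
      rewrite !He by lia. tauto.
  - destruct (IHp k Hk) as [c Hc]. exists (fneg c). apply codes_neg, Hc.
  - destruct (IHp1 k) as [c Hc], (IHp2 k) as [d Hd]; try tauto.
    exists (fand c d). apply codes_and; assumption.
  - destruct (IHp1 k) as [c Hc], (IHp2 k) as [d Hd]; try tauto.
    eexists. refine (codes_ext _ (codes_neg (codes_and (codes_neg Hc) (codes_neg Hd)))).
    intros D I e; cbn beta. tauto.
  - destruct (IHp1 k) as [c Hc], (IHp2 k) as [d Hd]; try tauto.
    eexists. refine (codes_ext _ (codes_neg (codes_and Hc (codes_neg Hd)))).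
    intros D I e; cbn beta. tauto.
  - destruct (IHp (S k) Hk) as [c Hc].
    eexists. refine (codes_ext _ (codes_neg (codes_ex (codes_neg Hc)))).
    intros D I e; cbn beta. split.
    + intros H x Hx. apply NNPP; intros N. apply H; eauto.
    + intros H (x & Hx & N). apply N, H, Hx.
  - destruct (IHp (S k) Hk) as [c Hc]. eexists. apply (codes_ex Hc).
Qed.

(** Internal elementarity, applied to the code of [p], yields preservation of the external formula.
    One symbol [r] is considered at a time. *)
Theorem elementary_tru D I D' I' f r p e :
  is_function_on I X -> is_function_on I' X -> r ∈ X ->
  elementary_embedding bsig (pr D I) (pr D' I') f -> (forall i, e i ∈ D) ->
  (tru (fun x => x ∈ D) (fun x y => tup2 x y ∈ app I r) e p <->
   tru (fun x => x ∈ D') (fun x y => tup2 x y ∈ app I' r) (fun i => app f (e i)) p).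
Proof.
  intros HI HI' Hr (D0 & I0 & D1 & I1 & E & E' & Hf & H) He.
  apply is_opairE, pr_inj in E. apply is_opairE, pr_inj in E'.
  destruct E as [<- <-], E' as [<- <-]. apply is_mapE in Hf. destruct Hf as [Hf Kf].
  destruct (free_below_ex p) as [k Hk]. destruct (fm_code Hr Hk) as (c & Hc & Kc).
  destruct (assignment_ex k He) as (s & Hs & Es).
  pose proof (proj1 (is_assignmentE D s) Hs) as Hm. apply is_mapE in Hm. destruct Hm as [Hsf Hm].
  assert (DG : PDef (fun e : nat -> M => e 0 = app f (app s (e 1)))) by solve_def.
  set (s' := lam om (fun n => app f (app s n))).
  assert (Hs' : is_assignment D' s').
  { apply is_assignmentE, is_mapE. split; [apply lam_fun, DG|]. intros n Hn.
    unfold s'. rewrite app_lam; auto. }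
  rewrite <- (Kc D I s e) by assumption.
  rewrite <- (Kc D' I' s' (fun i => app f (e i))); auto.
  - apply H; auto. intros n y. rewrite pair_inE. setoid_rewrite pair_inE.
    unfold s'. rewrite (lam_pr _ _ _ DG). split.
    + intros [Hn ->]. exists (app s n). rewrite (fun_pair _ _ Hsf), (fun_pair _ _ Hf). auto.
    + intros (x & Hx & Hy). apply (fun_pair _ _ Hsf) in Hx. apply (fun_pair _ _ Hf) in Hy.
      destruct Hx as [Hn ->], Hy as [_ ->]. auto.
  - intros i Hi. unfold s'. rewrite app_lam; [|exact DG|apply om_num]. rewrite Es; auto.
Qed.

End Binary.

(** * Structures with binary relations *)

Section BinaryStructures.
Context {M : set_model} {hZF : ZF M}.

Definition is_bstr (X D I : M) (E : M -> M -> M -> Prop) : Prop :=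
  is_function_on I X /\
  forall s, s ∈ X -> forall t, t ∈ app I s <-> exists x y, x ∈ D /\ y ∈ D /\ t = tup2 x y /\ E s x y.

Lemma bstr_tup2 X D I E s x y : is_bstr X D I E -> s ∈ X -> x ∈ D -> y ∈ D ->
  (tup2 x y ∈ app I s <-> E s x y).
Proof.
  intros [_ H] Hs Hx Hy. rewrite (H s Hs). split.
  - intros (x' & y' & _ & _ & K & J). apply tup2_inj in K. destruct K; subst; exact J.
  - intros J; exists x, y; auto.
Qed.

Lemma bstr_unique X D I I' E : is_bstr X D I E -> is_bstr X D I' E -> I = I'.
Proof.
  intros [HI H] [HI' H']. apply (fun_ext HI HI'). intros s Hs.
  apply ext; intros t. rewrite (H s Hs), (H' s Hs). reflexivity.
Qed.

Lemma bstr_stage (l X D I : M) E : is_limit l -> X ∈ Vs l -> D ∈ Vs l ->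
  is_bstr X D I E -> I ∈ Vs l.
Proof.
  intros Hl HX HD [HI H].
  assert (H2 : num 2 ∈ Vs l) by (apply (om_sub_limit Hl), om_num).
  destruct (limit_bound Hl HD H2) as (c & Hc & Kc & K2).
  pose proof (ord_in (proj1 Hl) Hc) as Oc.
  (* Pairs over [V_c] lie in the second power set, tuples in the third, relations in the fourth. *)
  apply (@limit_fun _ _ l I X (pow (pow (pow (pow (Vs c))))) Hl); [|exact HX|].
  - apply is_mapE. split; [exact HI|]. intros s Hs. apply mem_pow. intros t Ht.
    apply (H s Hs) in Ht. destruct Ht as (x & y & Hx & Hy & -> & _).
    apply mem_pow. intros p Hp. apply (fun_mem _ (tup2_fun x y)) in Hp.
    destruct Hp as (i & Hi & ->).
    assert (Hm : is_map (tup2 x y) (num 2) D) by (apply tup2_map; auto).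
    apply is_mapE in Hm. apply pr_pow; [apply (Vs_trans Oc K2 Hi)|].
    apply (Vs_trans Oc Kc), Hm, Hi.
  - do 4 apply (limit_pow Hl). apply Vs_mem; [apply Hl|exact Hc].
Qed.

Lemma bstr_ex (X D : M) (E : M -> M -> M -> Prop) : PDef (fun e => E (e 0) (e 1) (e 2)) ->
  exists I, is_bstr X D I E.
Proof.
  intros HE. destruct (limit_ex (pr X D)) as (l & Hl & _ & Hx).
  destruct (pr_trans (Vs_trans (proj1 Hl)) Hx) as [HX HD].
  set (C := fun s t => exists x y, x ∈ D /\ y ∈ D /\ t = tup2 x y /\ E s x y).
  assert (DC : PDef (fun e => C (e 0) (e 1))).
  { unfold C, tup2. solve_def. }
  assert (HR : forall s t, t ∈ sep (Vs l) (C s) <-> C s t).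
  { intros s t. rewrite mem_sep by solve_def. split; [tauto|]. intros H; split; [|exact H].
    destruct H as (x & y & Hx' & Hy & -> & _).
    assert (Hm : is_map (tup2 x y) (num 2) D) by (apply tup2_map; auto).
    apply (limit_fun Hl Hm); [apply (om_sub_limit Hl), om_num|exact HD]. }
  assert (HG : PDef (fun e : nat -> M => e 0 = sep (Vs l) (C (e 1)))).
  { apply (d_ext (Q := fun e => forall t, t ∈ e 0 <-> C (e 1) t)); [|solve_def].
    intros e; split; [intros ->; apply HR|]. intros H; apply ext; intros t.
    rewrite H, HR; reflexivity. }
  exists (lam X (fun s => sep (Vs l) (C s))). split; [apply lam_fun, HG|].
  intros s Hs t. rewrite app_lam by assumption. apply HR.
Qed.

Lemma bstr_structure (X D I : M) E : (exists x, x ∈ D) -> is_bstr X D I E ->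
  is_structure (bsig X) (pr D I).
Proof.
  intros Hne [HI H]. exists D, I. split; [apply is_opairE; reflexivity|].
  split; [exact Hne|]. split; [exists X; split; [apply bsig_fun|exact HI]|]. split.
  - intros s n r Hs Hr t Ht. apply bsig_rel in Hs. destruct Hs as [Hs ->].
    apply pair_inE, (fun_pair _ _ HI) in Hr. destruct Hr as [_ ->].
    apply (H s Hs) in Ht. destruct Ht as (x & y & Hx & Hy & -> & _). apply tup2_map; auto.
  - intros s n g Hs. destruct (bsig_no_fun Hs).
Qed.

Lemma bsig_num1_stage (l : M) : is_limit l -> bsig (num 1) ∈ Vs l.
Proof.
  intros Hl. assert (K : forall k, num k ∈ Vs l) by (intros k; apply (om_sub_limit Hl), om_num).
  set (p := pr (num 0) (num 2) : M).
  apply (limit_fun Hl (a := num 1) (b := upair p p)); [|apply K|].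
  - apply is_mapE. split; [apply bsig_fun|]. intros s Hs. apply mem_upair. left. symmetry.
    apply (fun_app _ (bsig_fun _) Hs), bsig_pr; auto.
  - apply (Vs_trans (proj1 Hl) (x := pr p p)); [|apply mem_upair; auto].
    repeat apply (limit_pr Hl); apply K.
Qed.

(** [num 1] is [{0}], whose only member is the empty set, the symbol of the epsilon signature. *)
Lemma is_eps_signatureE (tau : M) : is_eps_signature tau <-> tau = bsig (num 1).
Proof.
  unfold is_eps_signature. setoid_rewrite is_numE. setoid_rewrite is_taggedE.
  setoid_rewrite is_opairE. setoid_rewrite is_upairE.
  assert (E : bsig (num 1) = upair (pr (num 0) (pr (num 0) (num 2)))
    (pr (num 0) (pr (num 0) (num 2))) :> M).
  { apply ext; intros p. rewrite mem_upair, (fun_mem _ (bsig_fun _)).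
    assert (K : num 0 ∈ (num 1 : M)) by (simpl; apply mem_suc; auto).
    assert (J : pr (num 0) (num 2) = app (bsig (num 1)) (num 0) :> M).
    { apply (fun_app _ (bsig_fun _) K), bsig_pr; auto. }
    split.
    - intros (x & Hx & ->). simpl in Hx. rewrite mem_suc, mem_emp in Hx.
      assert (x = num 0) by (simpl; tauto). subst x. rewrite <- J; auto.
    - intros Hp. assert (p = pr (num 0) (pr (num 0) (num 2))) by tauto. subst p.
      exists (num 0). split; [exact K|]. rewrite J at 1; reflexivity. }
  rewrite E. split.
  - intros (z & two & v & p & -> & -> & -> & -> & H); exact H.
  - intros ->. do 4 eexists. repeat split.
Qed.

Lemma is_eps_structureE (A N : M) : is_eps_structure A N <->
  exists I, is_bstr (num 1) N I (fun _ x y => x ∈ y) /\ A = pr N I.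
Proof.
  assert (K0 : num 0 ∈ (num 1 : M)) by (simpl; apply mem_suc; auto).
  assert (U1 : forall s, s ∈ (num 1 : M) -> s = num 0).
  { intros s Hs. simpl in Hs. rewrite mem_suc, mem_emp in Hs. simpl; tauto. }
  unfold is_eps_structure. setoid_rewrite is_numE. setoid_rewrite is_opairE.
  setoid_rewrite is_upairE. setoid_rewrite pair_inE.
  assert (Q : forall t, (is_map t (num 2) N /\ exists x y, pr (num 0) x ∈ t /\ pr (num 1) y ∈ t /\ x ∈ y)
    <-> exists x y, x ∈ N /\ y ∈ N /\ t = tup2 x y /\ x ∈ y).
  { intros t. split.
    - intros (Ht & x & y & Hx & Hy & Hxy). apply is_mapE in Ht. destruct Ht as [Hf Ht].
      apply (fun_pair _ _ Hf) in Hx. apply (fun_pair _ _ Hf) in Hy.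
      destruct Hx as [Hx ->], Hy as [Hy ->].
      exists (app t (num 0)), (app t (num 1)). split; [auto|]. split; [auto|].
      split; [apply (fun_tup2 Hf)|exact Hxy].
    - intros (x & y & Hx & Hy & -> & Hxy). split; [apply tup2_map; auto|].
      exists x, y. rewrite !tup2_pr. auto. }
  split.
  - intros (z & one & two & r & p & I & -> & -> & -> & Hr & -> & -> & ->).
    setoid_rewrite Q in Hr. exists (upair (pr (num 0) r) (pr (num 0) r)). split; [|reflexivity].
    assert (Hf : is_function_on (upair (pr (num 0) r) (pr (num 0) r)) (num 1)).
    { split.
      - intros p Hp. apply mem_upair in Hp. exists (num 0), r. split; [exact K0|].
        apply is_opairE; tauto.
      - intros s Hs. apply U1 in Hs; subst s. exists r. unfold unique.
        setoid_rewrite pair_inE. setoid_rewrite mem_upair. setoid_rewrite pr_inj.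
        split; [auto|]. intros y Hy; symmetry; tauto. }
    split; [exact Hf|]. intros s Hs. apply U1 in Hs; subst s. intros t. rewrite <- Hr.
    replace (app (upair (pr (num 0) r) (pr (num 0) r)) (num 0)) with r; [reflexivity|].
    apply (fun_app _ Hf K0), mem_upair; auto.
  - intros (I & [HI H] & ->). exists (num 0), (num 1), (num 2), (app I (num 0)),
      (pr (num 0) (app I (num 0))), I. do 3 (split; [reflexivity|]).
    split; [intros t; rewrite Q; apply (H _ K0)|]. split; [reflexivity|]. split; [|reflexivity].
    apply ext; intros p. rewrite mem_upair, (fun_mem _ HI). split.
    + intros (x & Hx & ->). apply U1 in Hx; subst x; auto.
    + intros Hp. exists (num 0). split; [exact K0|tauto].
Qed.

Lemma is_eps_structure_unique (A A' N : M) :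
  is_eps_structure A N -> is_eps_structure A' N -> A = A'.
Proof.
  rewrite !is_eps_structureE. intros (I & HI & ->) (I' & HI' & ->).
  rewrite (bstr_unique HI HI'); reflexivity.
Qed.

Lemma is_eps_structure_ex (N : M) : exists A, is_eps_structure A N.
Proof.
  destruct (@bstr_ex (num 1) N (fun _ x y => x ∈ y)) as (I & HI); [solve_def|].
  exists (pr N I). apply is_eps_structureE; eauto.
Qed.

Lemma is_eps_structure_stage (l A N : M) :
  is_limit l -> N ∈ Vs l -> is_eps_structure A N -> A ∈ Vs l.
Proof.
  intros Hl HN H. apply is_eps_structureE in H. destruct H as (I & HI & ->).
  apply (limit_pr Hl HN). refine (bstr_stage (X := num 1) Hl _ HN HI).
  apply (om_sub_limit Hl), om_num.
Qed.

Lemma tru_ext (D : M -> Prop) (E E' : M -> M -> Prop) (p : fm) :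
  (forall x y, D x -> D y -> (E x y <-> E' x y)) ->
  forall e, (forall n, D (e n)) -> (tru D E e p <-> tru D E' e p).
Proof.
  intros H. induction p; simpl; intros e He.
  - apply H; auto.
  - tauto.
  - rewrite IHp by assumption; tauto.
  - rewrite IHp1, IHp2 by assumption; tauto.
  - rewrite IHp1, IHp2 by assumption; tauto.
  - rewrite IHp1, IHp2 by assumption; tauto.
  - assert (K : forall x, D x -> forall n, D (scons x e n)) by (intros x Hx [|n]; simpl; auto).
    split; intros J x Hx; apply (IHp _ (K x Hx)), J, Hx.
  - assert (K : forall x, D x -> forall n, D (scons x e n)) by (intros x Hx [|n]; simpl; auto).
    split; intros (x & Hx & J); exists x; split; auto; apply (IHp _ (K x Hx)), J.
Qed.

End BinaryStructures.

(** * Elementary embeddings between stages of the hierarchy *)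

Section StageEmbeddings.
Context {M : set_model} {hZF : ZF M}.

Definition fcode (P : (nat -> M) -> Prop) : fm :=
  epsilon (inhabits (FEq 0 0)) (fun p => forall e, holds e p <-> P e).

Lemma holds_fcode P e : Def P -> (holds e (fcode P) <-> P e).
Proof. intros H. apply (epsilon_spec (inhabits (FEq 0 0)) (fun p => forall e, holds e p <-> P e) H). Qed.

(** Exactly the notions whose preservation by embeddings is used; both stages must agree with [M] on
    them. *)
Definition basic_formulas : list fm := map fcode (
  (fun e => is_opair (e 0) (e 1) (e 2)) :: (fun e => is_empty (e 0)) ::
  (fun e => is_succ (e 0) (e 1)) :: (fun e => is_omega (e 0)) ::
  (fun e => is_function_on (e 0) (e 1)) :: (fun e => is_ordinal (e 0)) ::
  (fun e => is_V (e 0) (e 1)) :: (fun e => is_eps_structure (e 0) (e 1)) ::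
  (fun e => satisfies (e 0) (e 1) (e 2) (e 3)) :: nil).

Definition good_stage (l : M) : Prop :=
  is_limit l /\ om ∈ l /\ Forall (reflects (Vs l)) basic_formulas.

(** Elementarity is stated for external formulas. The two stages may differ, since Vopěnka's
    Principle provides embeddings between different structures. *)
Record stage_embedding (l l' f : M) : Prop := {
  se_dom : good_stage l;
  se_cod : good_stage l';
  se_map : is_map f (Vs l) (Vs l');
  se_elementary : forall p e, (forall n, e n ∈ Vs l) ->
    (holds_in (Vs l) e p <-> holds_in (Vs l') (fun n => app f (e n)) p)
}.

Section Properties.
Variables l l' f : M.
Hypothesis Hf : stage_embedding l l' f.
Let j := app f.
Let v := Vs l.

Lemma se_mem x : x ∈ v -> j x ∈ Vs l'.
Proof. apply (proj1 (is_mapE f v (Vs l')) (se_map Hf)). Qed.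

Lemma se_trans : is_transitive v.
Proof. apply Vs_trans, (se_dom Hf). Qed.

Lemma se_holds p : reflects (Vs l) p -> reflects (Vs l') p -> forall e, (forall n, e n ∈ v) ->
  (holds e p <-> holds (fun n => j (e n)) p).
Proof.
  intros H H' e He. rewrite <- (H e He), (se_elementary Hf p He).
  apply H'. intros n; apply se_mem, He.
Qed.

Lemma se_basic P : Def P -> In (fcode P) basic_formulas -> forall e, (forall n, e n ∈ v) ->
  (P e <-> P (fun n => j (e n))).
Proof.
  intros HP Hin e He. rewrite <- !(holds_fcode _ HP). apply se_holds; [| |exact He].
  - apply (proj1 (Forall_forall _ _) (proj2 (proj2 (se_dom Hf))) _ Hin).
  - apply (proj1 (Forall_forall _ _) (proj2 (proj2 (se_cod Hf))) _ Hin).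
Qed.

Lemma se_in x y : x ∈ v -> y ∈ v -> (x ∈ y <-> j x ∈ j y).
Proof.
  intros Hx Hy. apply (se_elementary Hf (FMem 0 1) (e := scons x (fun _ => y))).
  intros [|n]; assumption.
Qed.

Lemma se_lim : is_limit l.
Proof. apply (se_dom Hf). Qed.

Lemma se_pr x y : x ∈ v -> y ∈ v -> j (pr x y) = pr (j x) (j y).
Proof.
  intros Hx Hy. apply is_opairE.
  refine (proj1 (@se_basic (fun e => is_opair (e 0) (e 1) (e 2)) _ _
    (scons (pr x y) (scons x (fun _ => y))) _) _).
  - eauto with defdb.
  - simpl; tauto.
  - intros [|[|n]]; simpl; auto. apply (limit_pr se_lim); assumption.
  - apply is_opairE; reflexivity.
Qed.

Lemma se_om_sub n : n ∈ om -> n ∈ v.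
Proof. apply (om_sub_limit se_lim). Qed.

Lemma se_om_in : om ∈ v.
Proof. apply (ord_sub_Vs (proj1 se_lim)), (se_dom Hf). Qed.

Lemma se_suc x : x ∈ v -> suc x ∈ v -> j (suc x) = suc (j x).
Proof.
  intros Hx Hs. apply is_succE.
  refine (proj1 (@se_basic (fun e => is_succ (e 0) (e 1)) _ _ (scons (suc x) (fun _ => x)) _) _).
  - eauto with defdb.
  - simpl; tauto.
  - intros [|i]; simpl; auto.
  - apply is_succE; reflexivity.
Qed.

Lemma se_nat n : n ∈ om -> j n = n.
Proof.
  revert n. apply (om_ind (C := fun n => j n = n)).
  - unfold j. solve_def.
  - apply is_emptyE.
    refine (proj1 (@se_basic (fun e => is_empty (e 0)) _ _ (fun _ => emp) _) _).
    + eauto with defdb.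
    + simpl; tauto.
    + intros _. apply se_om_sub, om_emp.
    + apply emp_empty.
  - intros n Hn IH. rewrite se_suc, IH; [reflexivity| |]; apply se_om_sub; auto using om_suc.
Qed.

Lemma se_om : j om = om.
Proof.
  apply is_omegaE.
  refine (proj1 (@se_basic (fun e => is_omega (e 0)) _ _ (fun _ => om) _) _).
  - eauto with defdb.
  - simpl; tauto.
  - intros _. apply se_om_in.
  - apply is_omega_om.
Qed.

Lemma se_function s a : s ∈ v -> a ∈ v -> is_function_on s a -> is_function_on (j s) (j a).
Proof.
  intros Hs Ha H.
  refine (proj1 (@se_basic (fun e => is_function_on (e 0) (e 1)) _ _ (scons s (fun _ => a)) _) H).
  - eauto with defdb.
  - simpl; tauto.
  - intros [|n]; assumption.
Qed.

Lemma se_ord a : a ∈ v -> is_ordinal a -> is_ordinal (j a).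
Proof.
  intros Ha H.
  refine (proj1 (@se_basic (fun e => is_ordinal (e 0)) _ _ (fun _ => a) _) H).
  - eauto with defdb.
  - simpl; tauto.
  - intros _; assumption.
Qed.

Lemma se_ord_in a : a ∈ v -> is_ordinal a -> a ∈ l.
Proof. intros Ha Oa. apply ord_mem_Vs; [exact Oa|apply se_lim|exact Ha]. Qed.

Lemma se_Vs a : a ∈ v -> is_ordinal a -> j (Vs a) = Vs (j a).
Proof.
  intros Ha Oa. apply is_VE; [apply se_ord; assumption|].
  refine (proj1 (@se_basic (fun e => is_V (e 0) (e 1)) _ _ (scons (Vs a) (fun _ => a)) _) _).
  - eauto with defdb.
  - simpl; tauto.
  - intros [|n]; [|assumption]. apply Vs_mem; [apply se_lim|apply se_ord_in; assumption].
  - apply is_VE; [assumption|reflexivity].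
Qed.

Lemma se_app s a x : s ∈ v -> a ∈ v -> is_function_on s a -> x ∈ a -> j (app s x) = app (j s) (j x).
Proof.
  intros Hs Ha H Hx. pose proof (se_function Hs Ha H) as H'.
  assert (Hp : pr x (app s x) ∈ s) by (apply (fun_app _ H Hx); reflexivity).
  assert (Hxv : x ∈ v) by apply (se_trans Ha Hx).
  assert (Hpv : pr x (app s x) ∈ v) by apply (se_trans Hs Hp).
  destruct (pr_trans se_trans Hpv) as [_ Hav].
  apply (fun_app _ H'); [apply (proj1 (se_in Hxv Ha)), Hx|].
  rewrite <- se_pr by assumption. apply (proj1 (se_in Hpv Hs)), Hp.
Qed.

Lemma se_fun_fix s a : s ∈ v -> a ∈ v -> is_function_on s a -> j a = a ->
  (forall x, x ∈ a -> j x = x) -> (forall x, x ∈ a -> j (app s x) = app s x) -> j s = s.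
Proof.
  intros Hs Ha H Ea Ex Es. pose proof (se_function Hs Ha H) as H'. rewrite Ea in H'.
  apply (fun_ext H' H). intros x Hx. rewrite <- Es by exact Hx.
  rewrite (se_app Hs Ha H Hx), (Ex x Hx). reflexivity.
Qed.

Section FixedSignature.
Variable tau : M.
Hypothesis Htau : tau ∈ v.
Hypothesis fix_tau : j tau = tau.
Hypothesis fix_symbols : forall s w, pr s w ∈ tau -> j s = s.

Lemma se_symbol s w : pr s w ∈ tau -> s ∈ v.
Proof. apply (symbol_mem se_trans Htau). Qed.

Lemma se_num k : num k ∈ v /\ j (num k) = num k.
Proof. split; [apply se_om_sub, om_num|apply se_nat, om_num]. Qed.

Lemma se_seq_fix ts n : n ∈ om -> is_function_on ts n ->
  (forall i, i ∈ n -> app ts i ∈ v /\ j (app ts i) = app ts i) -> ts ∈ v /\ j ts = ts.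
Proof.
  intros Hn Hts H. assert (Hv : ts ∈ v).
  { apply (@limit_finite_seq _ _ l ts n se_lim Hn). apply is_mapE. split; [exact Hts|apply H]. }
  split; [exact Hv|]. apply (se_fun_fix Hv (se_om_sub Hn) Hts (se_nat Hn)).
  - intros i Hi. apply se_nat, (ord_trans ord_om Hn Hi).
  - intros i Hi. apply H, Hi.
Qed.

Lemma se_pr_fix x y : x ∈ v /\ j x = x -> y ∈ v /\ j y = y -> pr x y ∈ v /\ j (pr x y) = pr x y.
Proof.
  intros [Hx Ex] [Hy Ey]. split; [apply (limit_pr se_lim); assumption|].
  rewrite se_pr, Ex, Ey by assumption. reflexivity.
Qed.

(** Terms are generated from natural numbers and symbols by pairs and finite sequences, all of which
    the embedding respects. *)
Lemma se_term_fix t : is_term tau t -> t ∈ v /\ j t = t.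
Proof.
  revert t. apply (term_ind (C := fun t => t ∈ v /\ j t = t)).
  - unfold j. solve_def.
  - intros n Hn. apply se_pr_fix; [apply se_num|]. split; [apply se_om_sub|apply se_nat]; exact Hn.
  - intros s n ts Hs Hts H. apply fun_symbolE in Hs. destruct Hs as [Hn Hs].
    apply is_term_seqE in Hts.
    apply se_pr_fix; [apply se_num|]. apply se_pr_fix.
    + split; [apply (se_symbol Hs)|apply (fix_symbols Hs)].
    + apply (@se_seq_fix ts n); tauto.
Qed.

Lemma se_formula_fix p : is_formula tau p -> p ∈ v /\ j p = p.
Proof.
  revert p. apply (formula_ind (C := fun p => p ∈ v /\ j p = p)).
  - unfold j. solve_def.
  - intros t u Ht Hu. apply se_pr_fix; [apply se_num|].
    apply se_pr_fix; apply se_term_fix; assumption.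
  - intros s n ts Hs Hts. apply rel_symbolE in Hs. destruct Hs as [Hn Hs].
    apply is_term_seqE in Hts. destruct Hts as [Hts K].
    apply se_pr_fix; [apply se_num|]. apply se_pr_fix.
    + split; [apply (se_symbol Hs)|apply (fix_symbols Hs)].
    + apply (@se_seq_fix ts n Hn Hts). intros i Hi. apply se_term_fix, K, Hi.
  - intros p _ Hp. apply se_pr_fix; [apply se_num|exact Hp].
  - intros p q _ _ Hp Hq. apply se_pr_fix; [apply se_num|]. apply se_pr_fix; assumption.
  - intros n p Hn _ Hp. apply se_pr_fix; [apply se_num|]. apply se_pr_fix; [|exact Hp].
    split; [apply se_om_sub|apply se_nat]; exact Hn.
Qed.

(** All formulas are fixed, and satisfaction is reflected by both stages. *)
Theorem se_structure D I : pr D I ∈ v ->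
  elementary_embedding tau (pr D I) (j (pr D I)) (lam D j).
Proof.
  intros HA. destruct (pr_trans se_trans HA) as [HD HI].
  assert (DG : definable_map j) by (unfold j; solve_def).
  assert (HDt : forall x, x ∈ D -> x ∈ v) by (intros x Hx; apply (se_trans HD Hx)).
  exists D, I, (j D), (j I). split; [apply is_opairE; reflexivity|].
  split; [apply is_opairE, se_pr; assumption|]. split.
  { apply is_mapE. split; [apply lam_fun, DG|]. intros x Hx. rewrite app_lam by assumption.
    apply (proj1 (se_in (HDt x Hx) HD)), Hx. }
  intros p s s' Hp Hs Hs' E.
  destruct (se_formula_fix Hp) as [Hpv Ep].
  apply is_assignmentE in Hs. apply is_assignmentE in Hs'.
  assert (Hsv : s ∈ v) by (apply (limit_fun se_lim Hs); [apply se_om_in|exact HD]).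
  apply is_mapE in Hs. apply is_mapE in Hs'. destruct Hs as [Hs Ks], Hs' as [Hs' Ks'].
  assert (Es : j s = s').
  { pose proof (se_function Hsv se_om_in Hs) as Hjs. rewrite se_om in Hjs.
    apply (fun_ext Hjs Hs'). intros n Hn.
    apply (fun_app _ Hs' Hn). apply pair_inE, E. exists (app s n).
    rewrite !pair_inE. split; [apply (fun_app _ Hs Hn); reflexivity|].
    apply (lam_pr _ _ _ DG). split; [auto|].
    rewrite (se_app Hsv se_om_in Hs Hn), (se_nat Hn). reflexivity. }
  (* The occurrences of [s'], [p] and [tau] on the right become images under [j], so that the claim
     is the preservation of the formula [satisfies]. *)
  rewrite <- Es. rewrite <- Ep at 2. rewrite <- fix_tau at 2.
  refine (@se_basic (fun e => satisfies (e 0) (e 1) (e 2) (e 3)) _ _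
    (scons tau (scons (pr D I) (scons p (fun _ => s)))) _).
  - eauto with defdb.
  - simpl; tauto.
  - intros [|[|[|n]]]; simpl; assumption.
Qed.

End FixedSignature.

(** The epsilon structure on [N] is unique, hence fixed with [N], and the epsilon signature has a
    natural number as its only symbol; so [se_structure] applies. *)
Theorem se_eps N : N ∈ v -> j N = N -> eps_elementary N (lam N j).
Proof.
  intros HN EN. destruct (is_eps_structure_ex N) as (A & HA).
  pose proof (is_eps_structure_stage se_lim HN HA) as HAv.
  assert (EA : j A = A).
  { apply (is_eps_structure_unique (N := N)); [|exact HA]. rewrite <- EN.
    refine (proj1 (@se_basic (fun e => is_eps_structure (e 0) (e 1)) _ _ (scons A (fun _ => N)) _) HA).
    - eauto with defdb.
    - simpl; tauto.
    - intros [|n]; assumption. }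
  exists (bsig (num 1)), A. split; [apply is_eps_signatureE; reflexivity|]. split; [exact HA|].
  rewrite <- EA at 2. apply is_eps_structureE in HA. destruct HA as (I & HI & ->).
  assert (H1 : forall s, s ∈ (num 1 : M) -> s ∈ om) by (intros s Hs; apply (ord_trans ord_om (om_num 1) Hs)).
  assert (Hb : bsig (num 1) ∈ v) by apply (bsig_num1_stage se_lim).
  apply se_structure; [exact Hb| | |exact HAv].
  - apply (se_fun_fix Hb (proj1 (se_num 1)) (bsig_fun _) (proj2 (se_num 1))).
    + intros s Hs. apply se_nat, H1, Hs.
    + intros s Hs. replace (app (bsig (num 1)) s) with (pr (num 0) (num 2) : M).
      * apply se_pr_fix; apply se_num.
      * apply (fun_app _ (bsig_fun _) Hs), bsig_pr; auto.
  - intros s w H. apply bsig_pr in H. apply se_nat, H1, H.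
Qed.

(** Let [y] be moved and a subset of [V_d], with [d] least. Then [V_d] is fixed together with all
    its members and includes [j y] too, so [y] and [j y] have the same members. *)
Lemma se_fix_stage a : is_ordinal a -> Vs a ∈ v -> (forall b, b ∈ a -> j b = b) ->
  forall x, x ∈ Vs a -> j x = x.
Proof.
  intros Oa Hav Hb x Hx. apply NNPP; intros Nx.
  assert (Hin : forall x, x ∈ Vs a -> x ∈ v) by (intros y; apply (se_trans Hav)).
  apply (mem_Vs _ Oa) in Hx. destruct Hx as (c & Hc & Hxc).
  destruct (@ord_least _ _ (fun c => c ∈ a /\ exists x, incl x (Vs c) /\ j x <> x))
    as (d & Od & (Hd & y & Hy & Ny) & Ld).
  { unfold j. solve_def. }
  { exists c. split; [apply (ord_in Oa Hc)|eauto]. }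
  apply Ny.
  assert (Hda : d ∈ Vs a) by (apply (ord_sub_Vs Oa), Hd).
  assert (Hya : y ∈ Vs a) by (apply (mem_Vs _ Oa); eauto).
  assert (HVd : Vs d ∈ v) by (apply Hin, (Vs_mem Oa Hd)).
  assert (Fd : forall z, z ∈ Vs d -> j z = z).
  { intros z Hz. apply NNPP; intros Nz. apply (mem_Vs _ Od) in Hz. destruct Hz as (b & Hb' & Hz).
    apply (Ld b Hb'). split; [apply (ord_trans Oa Hd Hb')|eauto]. }
  assert (EV : j (Vs d) = Vs d) by (rewrite se_Vs, Hb; auto).
  (* Inclusion in [V_d] is transferred as membership in [V_(d+1)]. *)
  assert (Hjy : incl (j y) (Vs d)).
  { rewrite <- EV. assert (K : y ∈ Vs (suc d)) by (apply Vs_suc; auto).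
    assert (Hsd : suc d ∈ v).
    { apply (ord_sub_Vs (proj1 se_lim)), se_lim. apply se_ord_in; auto. }
    assert (Esd : j (suc d) = suc d) by (rewrite se_suc, (Hb d Hd); auto).
    assert (HVsd : Vs (suc d) ∈ v).
    { apply Vs_mem; [apply se_lim|]. apply se_ord_in; auto using ord_suc. }
    apply (proj1 (se_in (Hin y Hya) HVsd)) in K. rewrite se_Vs, Esd in K by auto using ord_suc.
    apply Vs_suc in K; [|exact Od]. rewrite EV; exact K. }
  apply ext; intros z; split; intros Hz.
  - pose proof (Hjy z Hz) as Hzd. rewrite <- (Fd z Hzd) in Hz.
    apply (proj2 (se_in (se_trans HVd Hzd) (Hin y Hya))), Hz.
  - pose proof (Hy z Hz) as Hzd. rewrite <- (Fd z Hzd).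
    apply (proj1 (se_in (se_trans HVd Hzd) (Hin y Hya))), Hz.
Qed.

End Properties.

Lemma eps_elementary_stage l f : good_stage l -> eps_elementary (Vs l) f -> stage_embedding l l f.
Proof.
  intros Hl (tau & A & Ht & HA & He). apply is_eps_signatureE in Ht. subst tau.
  apply is_eps_structureE in HA. destruct HA as (I & HI & ->).
  assert (K0 : num 0 ∈ (num 1 : M)) by (simpl; apply mem_suc; auto).
  assert (Hm : is_map f (Vs l) (Vs l)).
  { destruct He as (D & I' & D' & I'' & E & E' & Hm & _).
    apply is_opairE, pr_inj in E. apply is_opairE, pr_inj in E'.
    destruct E as [<- _], E' as [<- _]. exact Hm. }
  split; auto. intros p e Hen.
  assert (K : forall e, (forall n, e n ∈ Vs l) -> (holds_in (Vs l) e p <->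
    tru (fun x => x ∈ Vs l) (fun x y => tup2 x y ∈ app I (num 0)) e p)).
  { intros e' He'. apply (tru_ext (D := fun x => x ∈ Vs l)); [|exact He'].
    intros x y Hx Hy. symmetry. apply (bstr_tup2 HI K0 Hx Hy). }
  rewrite K by assumption. rewrite K.
  - apply (elementary_tru (X := num 1)); auto; apply HI.
  - intros n. apply is_mapE in Hm. apply Hm, Hen.
Qed.

End StageEmbeddings.

(** * Embeddings moving the symbols of a signature *)

(** Membership is irreflexive, so from a relation that is membership plus some loops it is recovered
    by excluding equal arguments. *)
Fixpoint drop_loops (p : fm) : fm :=
  match p with
  | FMem i j => FAnd (FMem i j) (FNeg (FEq i j))
  | FEq i j => FEq i j
  | FNeg p => FNeg (drop_loops p)
  | FAnd p q => FAnd (drop_loops p) (drop_loops q)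
  | FOr p q => FOr (drop_loops p) (drop_loops q)
  | FImp p q => FImp (drop_loops p) (drop_loops q)
  | FAll p => FAll (drop_loops p)
  | FEx p => FEx (drop_loops p)
  end.

Lemma tru_drop_loops (M : set_model) (D : M -> Prop) (E : M -> M -> Prop) p : forall e,
  tru D E e (drop_loops p) <-> tru D (fun x y => E x y /\ x <> y) e p.
Proof.
  induction p; simpl; intros e; try tauto.
  - rewrite IHp; tauto.
  - rewrite IHp1, IHp2; tauto.
  - rewrite IHp1, IHp2; tauto.
  - rewrite IHp1, IHp2; tauto.
  - split; intros H x Hx; apply IHp, H, Hx.
  - split; intros (x & Hx & H); exists x; (split; [exact Hx|]); apply IHp, H.
Qed.

Section Movable.
Context {M : set_model} {hZF : ZF M}.

(** Packs a finite list of parameters into one set, as [movable_over] offers a single fixed [c]. *)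
Fixpoint enc (l : list M) : M :=
  match l with nil => emp | a :: l' => pr a (enc l') end.

Lemma good_stage_ex (ps : list fm) (x : M) :
  exists l, good_stage l /\ x ∈ Vs l /\ Forall (reflects (Vs l)) ps.
Proof.
  destruct (reflection (@basic_formulas M ++ ps) x) as (l & H1 & H2 & H3 & H4).
  apply Forall_app in H4. exists l. unfold good_stage. tauto.
Qed.

Lemma PDef_good_stage : PDef (fun e : nat -> M => good_stage (e 0)).
Proof.
  unfold good_stage. apply d_and; [solve_def|]. apply d_and; [solve_def|].
  induction (@basic_formulas M) as [|p ps IH].
  - apply (d_ext (Q := fun _ => True)); [intros e; split; auto|apply d_const].
  - apply (d_ext (Q := fun e => reflects (Vs (e 0)) p /\ Forall (reflects (Vs (e 0))) ps)).
    + intros e; apply Forall_cons_iff.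
    + apply d_and; [|exact IH].
      apply (@d_app1 _ _ _ (fun v => reflects v p)); [|dterm].
      apply Def_PDef, D_reflects.
Qed.
#[local] Hint Resolve PDef_good_stage : defdb.

Lemma se_pair_fix l l' f x y : stage_embedding l l' f -> pr x y ∈ Vs l ->
  (app f (pr x y) = pr x y <-> app f x = x /\ app f y = y).
Proof.
  intros Hf H. destruct (pr_trans (se_trans Hf) H) as [Hx Hy].
  rewrite (se_pr Hf Hx Hy). apply pr_inj.
Qed.

Lemma se_enc_fix l l' f ps : stage_embedding l l' f -> enc ps ∈ Vs l -> app f (enc ps) = enc ps ->
  forall a, In a ps -> a ∈ Vs l /\ app f a = a.
Proof.
  intros Hf. induction ps as [|b ps IH]; simpl; [tauto|]. intros H E a Ha.
  apply (se_pair_fix Hf H) in E. destruct (pr_trans (se_trans Hf) H) as [Hb Hps].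
  destruct Ha as [->|Ha]; [tauto|]. apply IH; tauto.
Qed.

Lemma se_env p ps l l' f : stage_embedding l l' f -> reflects (Vs l) p -> reflects (Vs l') p ->
  (forall a, In a ps -> a ∈ Vs l /\ app f a = a) ->
  forall e : nat -> M, (forall n, e n ∈ Vs l) ->
  (holds (pre ps e) p <-> holds (pre ps (fun n => app f (e n))) p).
Proof.
  intros Hf R R' Hps e He.
  assert (K : forall n, pre ps e n ∈ Vs l).
  { intros n; unfold pre. destruct (nth_in_or_default n ps (e (n - length ps))) as [H|H].
    - apply Hps, H.
    - rewrite H. apply He. }
  rewrite (se_holds Hf R R' K).
  same_env; intros n; unfold pre.
  destruct (Nat.lt_ge_cases n (length ps)) as [H|H].
  - rewrite (nth_indep ps (app f (e (n - length ps))) (e (n - length ps)) H).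
    apply Hps, nth_In, H.
  - rewrite !nth_overflow by exact H. reflexivity.
Qed.

Variables tau0 S0 : M.
Hypothesis tau0_fun : is_function_on tau0 S0.

(** The two inclusions put [X] and [S0] in the domain of [f], so that failure of [pair_in f x x]
    really means that [x] is moved. *)
Definition movable_over (X : M) : Prop :=
  forall N c, is_transitive N -> c ∈ N -> incl X N -> incl S0 N ->
  exists f, eps_elementary N f /\ pair_in f c c /\ (forall x, x ∈ X -> pair_in f x x) /\
    exists x, x ∈ S0 /\ ~ pair_in f x x.

Lemma PDef_movable_over : PDef (fun e => movable_over (e 0)).
Proof. unfold movable_over. solve_def. Qed.

Lemma movable_over_stage X : movable_over X -> forall (ps : list fm) c, exists l f, stage_embedding l l f /\
  Forall (reflects (Vs l)) ps /\ c ∈ Vs l /\ app f c = c /\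
  (forall x, x ∈ X -> app f x = x) /\ exists x, x ∈ S0 /\ x ∈ Vs l /\ app f x <> x.
Proof.
  intros H ps c. destruct (good_stage_ex ps (pr c (pr X S0))) as (l & Hl & Hx & Hps).
  pose proof (Vs_trans (proj1 (proj1 Hl))) as Tr.
  destruct (pr_trans Tr Hx) as [Hc Hx']. destruct (pr_trans Tr Hx') as [HX HS].
  destruct (H (Vs l) c Tr Hc (Tr _ HX) (Tr _ HS)) as (f & Hf & Ec & EX & x & HxS & Nx).
  pose proof (eps_elementary_stage Hl Hf) as Hse.
  destruct (proj1 (is_mapE f (Vs l) (Vs l)) (se_map Hse)) as [Hff _].
  assert (K : forall x, x ∈ Vs l -> (pair_in f x x <-> app f x = x)).
  { intros y Hy. rewrite pair_inE, (fun_app _ Hff Hy). split; auto. }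
  exists l, f. split; [exact Hse|]. split; [exact Hps|]. split; [exact Hc|].
  split; [apply K; assumption|]. split.
  - intros y Hy. apply K; [apply (Tr _ HX _ Hy)|auto].
  - exists x. pose proof (Tr _ HS _ HxS). split; [exact HxS|]. split; [assumption|].
    rewrite <- K by assumption. exact Nx.
Qed.

Lemma restrict_fix N j x : definable_map j -> x ∈ N ->
  (pair_in (lam N j) x x <-> j x = x).
Proof. intros HG Hx. rewrite pair_inE, (lam_pr _ _ _ HG). split; [intros [_ H]; auto|auto]. Qed.

(** Restrict to [N] an embedding that fixes [pr N c], hence both [N] and [c]. *)
Lemma stage_movable_over X : (forall c, exists l l' f, stage_embedding l l' f /\
  c ∈ Vs l /\ app f c = c /\ (forall x, x ∈ X -> app f x = x) /\
  exists x, x ∈ S0 /\ app f x <> x) -> movable_over X.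
Proof.
  intros H N c HN Hc HX HS. destruct (H (pr N c)) as (l & l' & f & Hf & Hx & E & EX & x & HxS & Nx).
  apply (se_pair_fix Hf Hx) in E. destruct E as [EN Ec].
  destruct (pr_trans (se_trans Hf) Hx) as [HNl _].
  exists (lam N (app f)). split; [apply (se_eps Hf HNl EN)|].
  split; [apply restrict_fix; [solve_def|exact Hc|exact Ec]|]. split.
  - intros y Hy. apply restrict_fix; [solve_def|auto|auto].
  - exists x. split; [exact HxS|]. rewrite restrict_fix; [exact Nx|solve_def|auto].
Qed.

(** * From Vopěnka's Principle to movable symbols *)

Section Counterexample.
Variable C0 : M -> Prop.
Hypothesis C0_def : PDef (fun e => C0 (e 0)).
Hypothesis C0_proper : proper_class C0.
Hypothesis C0_structure : forall A, C0 A -> is_structure tau0 A.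
Hypothesis C0_rigid : forall A B f, C0 A -> C0 B -> A <> B -> ~ elementary_embedding tau0 A B f.
#[local] Hint Resolve C0_def : defdb.

Lemma se_moves_symbol l l' f A : stage_embedding l l' f -> C0 A -> A ∈ Vs l ->
  C0 (app f A) -> app f A <> A -> tau0 ∈ Vs l -> app f tau0 = tau0 ->
  exists x, x ∈ S0 /\ app f x <> x.
Proof.
  intros Hf HA HAl HB N Ht Et. apply NNPP; intros Nx.
  destruct (C0_structure HA) as (D & I & E & _). apply is_opairE in E. subst A.
  refine (C0_rigid HA HB _ (f := lam D (app f)) _); [congruence|].
  apply (se_structure Hf Ht Et); [|exact HAl].
  intros s w Hs. apply NNPP; intros Ns. apply Nx. exists s. split; [|exact Ns].
  apply (fun_dom tau0_fun Hs).
Qed.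

(** The structures [(V_l, E_s)] for [s] in [X], where [E_s] is membership together
    with a loop at the point coding [A], the parameter [q] and [s], determine all
    of these from the interpretation of the symbols alone. *)
Theorem VP_movable_over X : (exists s, s ∈ X) ->
  (forall C, definable_class C -> proper_class C -> (forall A, C A -> is_structure (bsig X) A) ->
    exists A B f, C A /\ C B /\ A <> B /\ elementary_embedding (bsig X) A B f) -> movable_over X.
Proof.
  intros [s0 Hs0] HVP. apply stage_movable_over. intros c. set (q := pr c tau0).
  set (pt := fun A s : M => pr (pr A q) s).
  (* With binary symbols only, a point is marked by a loop; membership has no loops, so the mark and
     membership can be told apart. *)
  set (E := fun A s x y : M => x ∈ y \/ (x = y /\ x = pt A s)).
  set (G := fun A l => good_stage l /\ pr A (pr q X) ∈ Vs l).
  assert (DG : PDef (fun e => G (e 0) (e 1))) by (unfold G; solve_def).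
  (* Taking the least good stage attaches one structure to each [A] without choice. *)
  set (LS := fun A l => is_ordinal l /\ G A l /\ forall l', l' ∈ l -> ~ G A l').
  assert (DLS : PDef (fun e => LS (e 0) (e 1))) by (unfold LS; solve_def).
  assert (DE : PDef (fun e => E (e 0) (e 1) (e 2) (e 3))) by (unfold E, pt; solve_def).
  assert (LS_ex : forall A, exists l, LS A l).
  { intros A. apply (@ord_least _ _ (G A)); [solve_def|].
    destruct (good_stage_ex nil (pr A (pr q X))) as (l & Hl & Hx & _).
    exists l. split; [apply (proj1 (proj1 Hl))|split; assumption]. }
  assert (LS_unique : forall A l l', LS A l -> LS A l' -> l = l').
  { intros A l l' (O1 & G1 & L1) (O2 & G2 & L2).
    destruct (ord_trichotomy O1 O2) as [K|[K|K]]; [|exact K|].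
    - destruct (L2 l K G1).
    - destruct (L1 l' K G2). }
  set (C := fun z => exists A l I, C0 A /\ LS A l /\ is_bstr X (Vs l) I (E A) /\ z = pr (Vs l) I).
  assert (Cmem : forall A l, LS A l -> A ∈ Vs l /\ q ∈ Vs l /\ X ∈ Vs l /\ is_limit l).
  { intros A l (_ & [Hl Hx] & _). pose proof (Vs_trans (proj1 (proj1 Hl))) as Tr.
    destruct (pr_trans Tr Hx) as [HA Hx']. destruct (pr_trans Tr Hx') as [Hq HX].
    split; [exact HA|split; [exact Hq|split; [exact HX|apply Hl]]]. }
  destruct (HVP C) as (z & z' & f & Hz & Hz' & Nz & Hf).
  - apply PDef_class. unfold C, is_bstr, tup2. solve_def.
  (* Were this class a set [a], each [A] in [C0] would belong to some [V_l] in [un (un a)], making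
     [C0] a set. *)
  - intros [a Ha]. apply C0_proper.
    destruct (@sep_ex _ _ C0 C0_def (un (un (un a)))) as (b & Hb).
    exists b. intros A. rewrite Hb. split; [tauto|]. intros HA. split; [|exact HA].
    destruct (LS_ex A) as (l & Hl). destruct (@bstr_ex _ _ X (Vs l) (E A)) as (I & HI); [solve_def|].
    apply mem_un. exists (Vs l). split; [|apply (Cmem A l Hl)].
    apply (@pr_un _ _ a (Vs l) I). apply Ha. exists A, l, I. auto.
  - intros z (A & l & I & HA & Hl & HI & ->). apply (bstr_structure (E := E A)); [|exact HI].
    exists A. apply (Cmem A l Hl).
  - destruct Hz as (A & l & I & HA & Hl & HI & ->), Hz' as (A' & l' & I' & HA' & Hl' & HI' & ->).
    destruct (Cmem A l Hl) as (HAl & Hql & HXl & Lim).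
    destruct (Cmem A' l' Hl') as (HAl' & Hql' & HXl' & Lim').
    (* Different structures come from different [A], as the stage and the relations are determined
       by [A]. *)
    assert (NA : A' <> A).
    { intros ->. apply Nz. rewrite <- (LS_unique A l l' Hl Hl') in *.
      rewrite (bstr_unique HI HI'). reflexivity. }
    assert (Hm : is_map f (Vs l) (Vs l')).
    { destruct Hf as (D & J & D' & J' & E1 & E2 & Hm & _).
      apply is_opairE, pr_inj in E1. apply is_opairE, pr_inj in E2.
      destruct E1 as [<- _], E2 as [<- _]. exact Hm. }
    pose proof (proj2 (proj1 (is_mapE f _ _) Hm)) as Hj.
    assert (K : forall s p e, s ∈ X -> (forall n, e n ∈ Vs l) ->
      (tru (fun x => x ∈ Vs l) (E A s) e p <-> tru (fun x => x ∈ Vs l') (E A' s) (fun n => app f (e n)) p)).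
    { intros s p e Hs He.
      rewrite <- (tru_ext (D := fun x => x ∈ Vs l) p (fun x y => bstr_tup2 HI Hs (x := x) (y := y)) He).
      rewrite <- (tru_ext (D := fun x => x ∈ Vs l') p (fun x y => bstr_tup2 HI' Hs (x := x) (y := y))
        (e := fun n => app f (e n)) (fun n => Hj _ (He n))).
      apply (elementary_tru (X := X)); auto; [apply HI|apply HI']. }
    assert (Strip : forall B s x y, E B s x y /\ x <> y <-> x ∈ y).
    { intros B s x y. unfold E. split; [tauto|]. intros H; split; [auto|].
      intros ->. apply (mem_irrefl H). }
    (* The relation of any one symbol [s0] recovers membership through [drop_loops], so [f] is
       elementary between the stages. *)
    assert (Hse : stage_embedding l l' f).
    { split; [apply Hl|apply Hl'|exact Hm|]. intros p e He. unfold holds_in.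
      rewrite <- (tru_ext p (fun x y _ _ => Strip A s0 x y) He), <- tru_drop_loops.
      rewrite <- (tru_ext (D := fun x => x ∈ Vs l') p (fun x y _ _ => Strip A' s0 x y)
        (e := fun n => app f (e n)) (fun n => Hj _ (He n))), <- tru_drop_loops.
      apply K; assumption. }
    (* [FMem 0 0] says that the point is a loop, and [pt A' s] is the only loop of the target
       relation. *)
    assert (Hpt : forall s, s ∈ X -> app f (pt A s) = pt A' s).
    { intros s Hs.
      assert (Hv : pt A s ∈ Vs l).
      { exact (limit_pr Lim (limit_pr Lim HAl Hql) (se_trans Hse HXl Hs)). }
      pose proof (proj1 (K s (FMem 0 0) (fun _ => pt A s) Hs (fun _ => Hv))) as J.
      simpl in J. destruct J as [J|[_ J]]; [right; auto|destruct (mem_irrefl J)|exact J]. }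
    assert (Fix : forall s, s ∈ X -> app f A = A' /\ app f q = q /\ app f s = s).
    { intros s Hs. pose proof (Hpt s Hs) as J. unfold pt in J.
      assert (Hsl : s ∈ Vs l) by apply (se_trans Hse HXl Hs).
      rewrite (se_pr Hse (limit_pr Lim HAl Hql) Hsl), (se_pr Hse HAl Hql) in J.
      apply pr_inj in J. destruct J as [J Js]. apply pr_inj in J. tauto. }
    destruct (Fix s0 Hs0) as (EA & Eq & _).
    apply (se_pair_fix Hse Hql) in Eq. destruct Eq as [Ec Et].
    destruct (pr_trans (se_trans Hse) Hql) as [Hcl Htl].
    exists l, l', f. split; [exact Hse|]. split; [exact Hcl|]. split; [exact Ec|].
    split; [intros s Hs; apply (Fix s Hs)|].
    apply (se_moves_symbol Hse HA HAl); auto; rewrite EA; assumption.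
Qed.

End Counterexample.

(** * Ranks of a proper class, and from movable symbols to moved members *)

Section ClassEnumeration.
Variable C : M -> Prop.
Hypothesis C_def : PDef (fun e => C (e 0)).
Hypothesis C_proper : proper_class C.
#[local] Hint Resolve C_def : defdb.

Definition is_rank_in (a : M) : Prop :=
  is_ordinal a /\ exists A, C A /\ incl A (Vs a) /\ ~ A ∈ Vs a.

Lemma PDef_is_rank_in : PDef (fun e => is_rank_in (e 0)).
Proof. unfold is_rank_in. solve_def. Qed.
#[local] Hint Resolve PDef_is_rank_in : defdb.

(** If all ranks were below [b], the class would be part of [V_b], hence a set. *)
Lemma ranks_unbounded b : is_ordinal b -> exists a, is_rank_in a /\ ~ a ∈ b.
Proof.
  intros Hb. apply NNPP; intros N. apply C_proper.
  destruct (sep_ex C_def (Vs b)) as (x & Hx). exists x. intros A. rewrite Hx.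
  split; [tauto|]. intros HA. split; [|exact HA]. apply NNPP; intros NA.
  destruct (@ord_least _ _ (fun a => incl A (Vs a))) as (a & Oa & Ia & La); [solve_def| |].
  { destruct (stage_ex A) as (a & Oa & Ha). exists a. split; [exact Oa|].
    apply (Vs_trans Oa), Ha. }
  assert (Na : ~ A ∈ Vs a).
  { intros K. apply (mem_Vs _ Oa) in K. destruct K as (d & Hd & K). apply (La d Hd K). }
  apply N. exists a. split; [split; [exact Oa|eauto]|]. intros K.
  apply NA. apply (mem_Vs _ Hb). eauto.
Qed.

Definition next_rank (f a : M) : Prop := is_rank_in a /\ forall c u, pr c u ∈ f -> u ∈ a.

Definition least_next (f : M) : M :=
  iot (fun a => next_rank f a /\ forall b, b ∈ a -> ~ next_rank f b).

Lemma least_next_unique f a b : (next_rank f a /\ forall c, c ∈ a -> ~ next_rank f c) ->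
  (next_rank f b /\ forall c, c ∈ b -> ~ next_rank f c) -> a = b.
Proof.
  intros [H1 H2] [H3 H4].
  destruct (ord_trichotomy (proj1 (proj1 H1)) (proj1 (proj1 H3))) as [E|[E|E]]; [|exact E|].
  - destruct (H4 a E H1).
  - destruct (H2 b E H3).
Qed.

Lemma PDef_least_next : definable_map least_next.
Proof.
  apply (@dt_iot _ _ _ _ (fun a e => next_rank (e 0) a /\ forall b, b ∈ a -> ~ next_rank (e 0) b)).
  - intros e; apply least_next_unique.
  - unfold next_rank. solve_def.
Qed.

(** The increasing enumeration of the ranks of the members of [C]. *)
Definition theta (b : M) : M := rec least_next b.

Lemma PDef_theta : definable_map theta.
Proof. apply PDef_rec, PDef_least_next. Qed.
#[local] Hint Resolve PDef_theta : defdb.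

Lemma theta_spec b : is_ordinal b -> is_rank_in (theta b) /\ forall c, c ∈ b -> theta c ∈ theta b.
Proof.
  revert b. apply (@ord_ind _ _ (fun b => is_rank_in (theta b) /\ forall c, c ∈ b -> theta c ∈ theta b)).
  { solve_def. }
  intros b Hb IH.
  assert (K : next_rank (lam b theta) (theta b)).
  { unfold theta at 2. rewrite rec_eq; [|apply PDef_least_next|exact Hb]. fold theta.
    assert (Ex : exists a, is_ordinal a /\ next_rank (lam b theta) a).
    { destruct (@rep_ex _ _ (fun c u => u = theta c)) with (a := b) as (x & Hx).
      - solve_def.
      - intros c _. exists (theta c). split; auto.
      - destruct (@ord_bound _ _ x) as (d & Od & Hd).
        { intros u Hu. apply Hx in Hu. destruct Hu as (c & Hc & ->). apply (IH c Hc). }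
        destruct (ranks_unbounded Od) as (a & Ra & Na). exists a. split; [apply Ra|].
        split; [exact Ra|]. intros c u Hu. apply lam_pr in Hu; [|apply PDef_theta].
        destruct Hu as [Hc ->]. apply (ord_not_mem (proj1 Ra) Od Na), Hd, Hx. eauto. }
    destruct (@ord_least _ _ (next_rank (lam b theta))) as (a & Oa & Ha & La).
    - unfold next_rank. solve_def.
    - exact Ex.
    - change (rec least_next) with theta. unfold least_next.
      rewrite (iot_eq (@least_next_unique _) (conj Ha La)). exact Ha. }
  split; [apply K|]. intros c Hc. apply (proj2 K c). apply lam_pr; [apply PDef_theta|]. auto.
Qed.

Lemma theta_inj a b : is_ordinal a -> is_ordinal b -> theta a = theta b -> a = b.
Proof.
  intros Ha Hb E. destruct (ord_trichotomy Ha Hb) as [H|[H|H]]; [|exact H|].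
  - pose proof (proj2 (theta_spec Hb) a H) as K. rewrite E in K. destruct (mem_irrefl K).
  - pose proof (proj2 (theta_spec Ha) b H) as K. rewrite E in K. destruct (mem_irrefl K).
Qed.

(** The rank of [A] is the only ordinal [a] such that [A] is a subset of [V_a] but not a member;
    both properties pass to [app f a]. *)
Lemma se_rank l f A a : stage_embedding l l f -> is_ordinal a -> a ∈ l -> incl A (Vs a) ->
  ~ A ∈ Vs a -> app f A = A -> app f a = a.
Proof.
  intros Hf Oa Hal HA NA EA. pose proof (se_lim Hf) as Lim.
  assert (Hin : forall b, b ∈ l -> b ∈ Vs l) by (intros b; apply (ord_sub_Vs (proj1 Lim))).
  assert (Hsl : suc a ∈ l) by (apply Lim, Hal).
  assert (Hsa : A ∈ Vs (suc a)) by (apply Vs_suc; assumption).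
  assert (HVs : forall b, b ∈ l -> Vs b ∈ Vs l) by (intros b; apply Vs_mem, Lim).
  assert (HAl : A ∈ Vs l) by apply (se_trans Hf (HVs _ Hsl) Hsa).
  pose proof (se_ord Hf (Hin a Hal) Oa) as Oj.
  assert (K1 : incl A (Vs (app f a))).
  { apply Vs_suc; [exact Oj|]. rewrite <- (se_suc Hf) by auto.
    rewrite <- (se_Vs Hf) by auto using ord_suc. rewrite <- EA at 1.
    apply (proj1 (se_in Hf HAl (HVs _ Hsl))), Hsa. }
  assert (K2 : ~ A ∈ Vs (app f a)).
  { rewrite <- (se_Vs Hf) by auto. rewrite <- EA. intros K.
    apply (proj2 (se_in Hf HAl (HVs _ Hal))) in K. apply NA, K. }
  destruct (ord_trichotomy Oj Oa) as [K|[K|K]]; [|exact K|].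
  - destruct NA. apply (mem_Vs _ Oa). eauto.
  - destruct K2. apply (mem_Vs _ Oj). eauto.
Qed.

(** An embedding fixing every member of [C] in its domain fixes every rank of such
    a member, hence commutes with the enumeration of these ranks, hence fixes
    the indices. *)
Lemma se_moves_member X sigma : movable_over X -> exists l f, stage_embedding l l f /\
  sigma ∈ Vs l /\ app f sigma = sigma /\ (forall x, x ∈ X -> app f x = x) /\
  exists A, A ∈ Vs l /\ C A /\ C (app f A) /\ app f A <> A.
Proof.
  intros HX.
  destruct (PDef_env C_def) as (pC & psC & HC). destruct (PDef_env PDef_theta) as (pT & psT & HT).
  destruct (stage_ex S0) as (r & Or & HS).
  (* [r] is a stage containing [S0], hence every symbol. Having [theta r] in [V_l] keeps all
     [theta b] with [b] in [r] below [l]. The lists [psC] and [psT] are the parameters defining [C]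
     and [theta]. *)
  set (c := enc (sigma :: r :: theta r :: psC ++ psT)).
  destruct (movable_over_stage HX (pC :: pT :: nil) c) as (l & f & Hf & Href & Hc & Ec & EX & x & HxS & Hxl & Nx).
  inversion_clear Href as [|? ? RC Hr']. inversion_clear Hr' as [|? ? RT _].
  pose proof (se_enc_fix Hf Hc Ec) as Hfix.
  assert (PC : forall A, A ∈ Vs l -> (C A <-> C (app f A))).
  { intros A HA. rewrite (HC (fun _ => A)), (HC (fun _ => app f A)).
    apply (se_env Hf RC RC (ps := psC)) with (e := fun _ => A); [|auto].
    intros a Ha. apply Hfix. do 3 right. apply in_or_app; auto. }
  assert (PT : forall y b, y ∈ Vs l -> b ∈ Vs l -> (y = theta b <-> app f y = theta (app f b))).
  { intros y b Hy Hb. etransitivity; [apply (HT (scons y (fun _ => b)))|].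
    etransitivity; [|symmetry; apply (HT (scons (app f y) (fun _ => app f b)))].
    replace (scons (app f y) (fun _ => app f b)) with (fun n => app f (scons y (fun _ => b) n))
      by (apply functional_extensionality; intros [|n]; reflexivity).
    apply (se_env Hf RT RT).
    - intros a Ha. apply Hfix. do 3 right. apply in_or_app; auto.
    - intros [|n]; assumption. }
  exists l, f. split; [exact Hf|]. split; [apply Hfix; left; reflexivity|].
  split; [apply Hfix; left; reflexivity|]. split; [exact EX|].
  apply NNPP; intros N.
  assert (FA : forall A, A ∈ Vs l -> C A -> app f A = A).
  { intros A HA HCA. apply NNPP; intros NA. apply N. exists A.
    pose proof (proj1 (PC A HA) HCA). auto. }
  pose proof (se_lim Hf) as Lim. pose proof (proj1 Lim) as Ol.
  assert (Hrl : r ∈ Vs l) by (apply Hfix; right; left; reflexivity).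
  assert (Htl : theta r ∈ l).
  { apply ord_mem_Vs; [apply (theta_spec Or)|exact Ol|]. apply Hfix; do 2 right; left; reflexivity. }
  (* The contradiction: all ordinals below [r] are fixed, so all of [V_r] is, including the moved
     symbol [x]. *)
  apply Nx. apply (se_fix_stage Hf Or).
  - apply Vs_mem; [exact Ol|]. apply ord_mem_Vs; assumption.
  - intros b Hb. pose proof (ord_in Or Hb) as Ob.
    pose proof (ord_trans Ol Htl (proj2 (theta_spec Or) b Hb)) as Htb.
    assert (Hbl : b ∈ Vs l) by (apply (se_trans Hf Hrl Hb)).
    destruct (proj1 (theta_spec Ob)) as (Ot & A & HA & IA & NA).
    assert (HAl : A ∈ Vs l) by (apply (mem_Vs _ Ol); eauto).
    assert (Et : app f (theta b) = theta b) by (apply (se_rank Hf Ot Htb IA NA); auto).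
    assert (Htv : theta b ∈ Vs l) by (apply (ord_sub_Vs Ol), Htb).
    pose proof (proj1 (PT (theta b) b Htv Hbl) eq_refl) as K. rewrite Et in K.
    symmetry. apply theta_inj; [exact Ob|apply (se_ord Hf Hbl Ob)|exact K].
  - apply (Vs_trans Or HS HxS).
Qed.

End ClassEnumeration.

Theorem movable_over_VP sigma S : is_function_on sigma S -> movable_over S ->
  forall C, definable_class C -> proper_class C -> (forall A, C A -> is_structure sigma A) ->
    exists A B f, C A /\ C B /\ A <> B /\ elementary_embedding sigma A B f.
Proof.
  intros Hs HS C HC HP Hstr.
  destruct (se_moves_member (definable_class_PDef HC) HP sigma HS)
    as (l & f & Hf & Hsl & Es & EX & A & HAl & HA & HB & N).
  destruct (Hstr A HA) as (D & I & E & _). apply is_opairE in E. subst A.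
  exists (pr D I), (app f (pr D I)), (lam D (app f)).
  split; [exact HA|]. split; [exact HB|]. split; [congruence|].
  apply (se_structure Hf Hsl Es); [|exact HAl].
  intros s w Hw. apply EX, (fun_dom Hs Hw).
Qed.

End Movable.

(** * The least stage which cannot be fixed *)

Section LeastStage.
Context {M : set_model} {hZF : ZF M}.
Variables tau0 S0 : M.
Local Notation movable_over := (movable_over S0).

Lemma movable_over_pair X c d : movable_over X -> exists l f, stage_embedding l l f /\
  c ∈ Vs l /\ app f c = c /\ d ∈ Vs l /\ app f d = d /\
  (forall x, x ∈ X -> app f x = x) /\ exists x, x ∈ S0 /\ app f x <> x.
Proof.
  intros H. destruct (movable_over_stage H nil (pr c d)) as (l & f & Hf & _ & Hx & E & EX & x & HxS & _ & Nx).
  apply (se_pair_fix Hf Hx) in E. destruct (pr_trans (se_trans Hf) Hx), E.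
  exists l, f. do 6 (split; [assumption|]). eauto.
Qed.

Lemma movable_over_sub X Y : incl X Y -> movable_over Y -> movable_over X.
Proof.
  intros HXY HY. apply stage_movable_over. intros c.
  destruct (movable_over_pair c c HY) as (l & f & Hf & Hc & Ec & _ & _ & EY & Hx).
  exists l, l, f. split; [exact Hf|split; [exact Hc|split; [exact Ec|split; [auto|exact Hx]]]].
Qed.

(** An embedding fixing the ordinals below [a] fixes [V_a] pointwise; [d] is an auxiliary parameter
    that may help to show that these ordinals are fixed. *)
Lemma movable_over_Vs X a d : is_ordinal a -> movable_over X ->
  (forall l f, stage_embedding l l f -> d ∈ Vs l -> app f d = d -> a ∈ l ->
    app f a = a -> (forall x, x ∈ X -> app f x = x) -> forall b, b ∈ a -> app f b = b) ->
  movable_over (Vs a).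
Proof.
  intros Oa HX K. apply stage_movable_over. intros c.
  destruct (movable_over_pair c (pr a d) HX) as (l & f & Hf & Hc & Ec & Hx & E & EX & Hm).
  apply (se_pair_fix Hf Hx) in E. destruct (pr_trans (se_trans Hf) Hx) as [Ha Hd], E as [Ea Ed].
  pose proof (se_ord_in Hf Ha Oa) as Hal.
  exists l, l, f. split; [exact Hf|split; [exact Hc|split; [exact Ec|split; [|exact Hm]]]].
  apply (se_fix_stage Hf Oa); [apply Vs_mem; [apply (se_lim Hf)|exact Hal]|].
  apply (K l f); assumption.
Qed.

Lemma movable_over_suc a : is_ordinal a -> movable_over (Vs a) -> movable_over (Vs (suc a)).
Proof.
  intros Oa HX. apply (@movable_over_Vs (Vs a) (suc a) a); [apply ord_suc, Oa|exact HX|].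
  intros l f _ _ Ea _ _ EX b Hb. apply mem_suc in Hb. destruct Hb as [Hb| ->]; [|exact Ea].
  apply EX, (ord_sub_Vs Oa), Hb.
Qed.

(** Natural numbers are fixed by every embedding of stages. This is what puts [delta] above [om]. *)
Lemma movable_over_om X : movable_over X -> movable_over (Vs om).
Proof.
  intros HX. apply (@movable_over_Vs X om om); [apply ord_om|exact HX|].
  intros l f Hf _ _ _ _ _ n Hn. apply (se_nat Hf Hn).
Qed.

Variable delta : M.
Hypothesis delta_ord : is_ordinal delta.
Hypothesis delta_not : ~ movable_over (Vs delta).
Hypothesis delta_least : forall b, b ∈ delta -> movable_over (Vs b).

Lemma least_limit X : movable_over X -> is_limit delta /\ om ∈ delta.
Proof.
  intros HX. pose proof (movable_over_om HX) as Hom.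
  assert (L : is_limit delta).
  { destruct (ord_cases delta_ord) as [E|[(b & Ob & E)|H]]; [| |exact H].
    - destruct delta_not. apply (movable_over_sub (Y := Vs om)); [|exact Hom]. intros x Hx.
      apply (mem_Vs _ delta_ord) in Hx. destruct Hx as (d & Hd & _). rewrite E in Hd.
      apply mem_emp in Hd. tauto.
    - destruct delta_not. rewrite E. apply (movable_over_suc Ob), delta_least.
      rewrite E. apply mem_suc; auto. }
  split; [exact L|]. destruct (limit_om_le L) as [H|H]; [exact H|].
  destruct delta_not. rewrite <- H. exact Hom.
Qed.

(** Given a bijection onto [delta] from some [a] below it, an embedding fixing the bijection and
    [V_a] pointwise fixes all its values, that is, all ordinals below [delta]; so the symbols would
    be movable over [V_delta]. *)
Lemma least_cardinal : is_cardinal delta.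
Proof.
  split; [exact delta_ord|]. intros a Ha (g & [Hg Sg]). apply delta_not.
  pose proof (ord_in delta_ord Ha) as Oa.
  apply (@movable_over_Vs (Vs a) delta (pr g a)); [exact delta_ord|apply delta_least, Ha|].
  intros l f Hf Hd Ed _ _ EX b Hb. apply (se_pair_fix Hf Hd) in Ed. destruct Ed as [Eg Ea].
  destruct (pr_trans (se_trans Hf) Hd) as [Hgl Hal].
  destruct (Sg b Hb) as (x & Hx & _). apply pair_inE in Hx.
  apply is_mapE in Hg. destruct Hg as [Hg _]. apply (fun_pair _ _ Hg) in Hx. destruct Hx as [Hx ->].
  rewrite (se_app Hf Hgl Hal Hg Hx), Eg. f_equal. apply EX, (ord_sub_Vs Oa), Hx.
Qed.

(** [delta_not] yields [N0] and [c0] such that an embedding fixing both cannot fix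
    [V_delta] pointwise; so its critical point is below [delta]. *)
Lemma least_proto_Berkeley X z : movable_over X -> z ∈ delta -> proto_Berkeley z delta.
Proof.
  intros HX Hz. split; [apply least_cardinal|]. split; [exact Hz|]. intros N HN HdN.
  destruct (least_limit HX) as [L _]. pose proof (ord_in delta_ord Hz) as Oz.
  (* [suc z] and not [z]: the point [z] must itself be fixed for the critical point to exceed it. *)
  assert (Hsz : suc z ∈ delta) by (apply L, Hz).
  assert (W : exists N0 c0, is_transitive N0 /\ c0 ∈ N0 /\ incl (Vs delta) N0 /\ incl S0 N0 /\
    ~ exists f, eps_elementary N0 f /\ pair_in f c0 c0 /\
      (forall x, x ∈ Vs delta -> pair_in f x x) /\ exists x, x ∈ S0 /\ ~ pair_in f x x).
  { apply NNPP; intros K. apply delta_not. intros N0 c0 H1 H2 H3 H4.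
    apply NNPP; intros K'. apply K. exists N0, c0. auto. }
  destruct W as (N0 & c0 & T0 & Hc0 & HV0 & HS0 & Nf).
  destruct (movable_over_pair (pr N delta) (pr N0 c0) (delta_least Hsz))
    as (l & f & Hf & HN' & EN' & HN0' & EN0' & EX & x & HxS & Nx).
  apply (se_pair_fix Hf HN') in EN'. apply (se_pair_fix Hf HN0') in EN0'.
  destruct EN' as [EN Ed], EN0' as [EN0 Ec0].
  destruct (pr_trans (se_trans Hf) HN') as [HNl Hdl].
  destruct (pr_trans (se_trans Hf) HN0') as [HN0l Hc0l].
  assert (DG : PDef (fun e : nat -> M => e 0 = app f (e 1))) by solve_def.
  (* If no ordinal below [delta] were moved, [V_delta] would be fixed pointwise, and the restriction
     of [f] to [N0] would be the embedding excluded by the choice of [N0] and [c0]. *)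
  assert (Hmoved : exists k, is_ordinal k /\ (k ∈ delta /\ app f k <> k) /\
    forall b, b ∈ k -> ~ (b ∈ delta /\ app f b <> b)).
  { apply (@ord_least _ _ (fun k => k ∈ delta /\ app f k <> k)); [solve_def|].
    apply NNPP; intros K. apply Nf. exists (lam N0 (app f)).
    split; [apply (se_eps Hf HN0l EN0)|]. split; [apply restrict_fix; assumption|]. split.
    - intros y Hy. apply restrict_fix; [exact DG|apply HV0, Hy|].
      apply (se_fix_stage Hf delta_ord); [| |exact Hy].
      + apply Vs_mem; [apply (se_lim Hf)|apply (se_ord_in Hf Hdl delta_ord)].
      + intros b Hb. apply NNPP; intros Nb. apply K. exists b.
        split; [apply (ord_in delta_ord Hb)|auto].
    - exists x. split; [exact HxS|]. rewrite restrict_fix; [exact Nx|exact DG|apply HS0, HxS]. }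
  destruct Hmoved as (k & Ok & [Hk Nk] & Lk).
  exists (lam N (app f)), k. split; [apply (se_eps Hf HNl EN)|].
  assert (HkN : k ∈ N) by apply (HN _ HdN _ Hk).
  split; [|split; [|exact Hk]].
  - split; [exact Ok|]. split.
    + exists (app f k). split; [|exact Nk]. apply pair_inE, (lam_pr _ _ _ DG). auto.
    + intros a Ha. apply restrict_fix; [exact DG| |].
      * apply (HN _ HdN), (ord_trans delta_ord Hk Ha).
      * apply NNPP; intros Na. apply (Lk a Ha). split; [apply (ord_trans delta_ord Hk Ha)|exact Na].
  - assert (Hout : ~ k ∈ suc z).
    { intros K. apply Nk, EX, (ord_sub_Vs (ord_suc Oz)), K. }
    rewrite mem_suc in Hout. destruct (ord_trichotomy Oz Ok) as [K|[K|K]]; [exact K| |].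
    + destruct Hout. right. auto.
    + destruct Hout. left. exact K.
Qed.

End LeastStage.

Theorem theorem5p2 (M : set_model) (hZF : ZF M) (hVP : ~ VP M)
    (omega : M) (homega : is_omega omega) (hVPomega : VP_at omega) :
  exists delta : M,
    is_ordinal delta /\ omega ∈ delta /\
    VP_at delta /\
    (exists delta1, is_succ delta1 delta /\ ~ VP_at delta1) /\
    Berkeley delta.
Proof.
  apply is_omegaE in homega. subst omega.
  assert (W : exists (C0 : M -> Prop) tau0, definable_class C0 /\ proper_class C0 /\
    is_signature tau0 /\ (forall A, C0 A -> is_structure tau0 A) /\
    forall A B f, C0 A -> C0 B -> A <> B -> ~ elementary_embedding tau0 A B f).
  { apply NNPP; intros K. apply hVP. intros C tau HC HP Ht _ Hs. apply NNPP; intros N.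
    apply K. exists C, tau. do 4 (split; [assumption|]). intros A B f HA HB NAB Hf.
    apply N. exists A, B, f. auto. }
  destruct W as (C0 & tau0 & C0_def & C0_proper & (S0 & tau0_fun & _) & C0_str & C0_rigid).
  pose proof (VP_movable_over tau0_fun (definable_class_PDef C0_def) C0_proper C0_str C0_rigid) as HA.
  (* Here the principle at [omega] enters: [num 1] is a nonempty set of symbols whose signature lies
     in [V_omega]. *)
  assert (P1 : movable_over S0 (num 1)).
  { apply HA.
    - exists emp. simpl. apply mem_suc; auto.
    - intros C HC HP Hs. apply (hVPomega C (bsig (num 1))); auto using bsig_signature.
      apply in_VE; [apply ord_om|]. apply bsig_num1_stage.
      split; [apply ord_om|split; [apply om_emp|apply om_suc]]. }
  destruct (@ord_least _ _ (fun a => ~ movable_over S0 (Vs a))) as (delta & Od & Nd & Ld').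
  { apply d_not, (d_app1 (R := movable_over S0)); [apply PDef_movable_over|dterm]. }
  (* Some stage contains all symbols, and no embedding can move a symbol while fixing that stage
     pointwise. *)
  { destruct (stage_ex S0) as (r & Or & Hr). exists r. split; [exact Or|]. intros H.
    destruct (movable_over_pair r r H) as (l & f & _ & _ & _ & _ & _ & E & x & Hx & Nx).
    apply Nx, E, (Vs_trans Or Hr Hx). }
  assert (Ld : forall b, b ∈ delta -> movable_over S0 (Vs b)) by (intros b Hb; apply NNPP, Ld', Hb).
  destruct (least_limit Od Nd Ld P1) as [L Hom].
  exists delta. split; [exact Od|]. split; [exact Hom|]. split; [|split; [|split]].
  (* As [delta] is a limit, the signature appears in some [V_b] with [b] below [delta], and so do
     its symbols. *)
  - intros C tau HC HP (S & HS & _) Hin Hs. apply (in_VE _ Od) in Hin.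
    apply (limit_Vs _ L) in Hin. destruct Hin as (b & Hb & Hin).
    pose proof (ord_in Od Hb) as Ob.
    apply (movable_over_VP (S0 := S0) HS); auto. apply (movable_over_sub (Y := Vs b)); [|apply Ld, Hb].
    intros s Hs'. apply (symbol_mem (Vs_trans Ob) Hin (v := app tau s)).
    apply (fun_app _ HS Hs'); reflexivity.
  (* The signature with a symbol for each element of [V_delta] is a subset of [V_delta], so it is
     available one level higher, where the principle would make the symbols movable over
     [V_delta]. *)
  - exists (suc delta). split; [apply is_succE; reflexivity|]. intros HVP. apply Nd, HA.
    + exists emp. apply (ord_sub_Vs Od), L.
    + intros C HC HP Hs. apply (HVP C (bsig (Vs delta))); auto using bsig_signature.
      apply in_VE; [apply ord_suc, Od|]. apply Vs_suc; [exact Od|]. intros p Hp.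
      apply (fun_mem _ (bsig_fun _)) in Hp. destruct Hp as (s & Hs' & ->).
      apply (limit_pr L Hs').
      replace (app (bsig (Vs delta)) s) with (pr (num 0) (num 2) : M).
      * apply (limit_pr L); apply (om_sub_limit L), om_num.
      * apply (fun_app _ (bsig_fun _) Hs'), bsig_pr; auto.
  - apply (least_cardinal Od Nd Ld).
  - intros z Hz. apply (least_proto_Berkeley Od Nd Ld P1 Hz).
Qed.
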